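(* Let $A\Rightarrow M$ be a Lie algebroid and $\mathfrak{k}\subset A$ a partially split bundle of ideals with IM connection 1-form $(L,l)\in\Omega^1_{\mathrm{IM}}(A;\mathfrak{k})$. Then $$\nabla^L_X\xi:=i_XL(\xi),\qquad X\in\mathfrak{X}(M),\ \xi\in\Gamma(\mathfrak{k}),$$ defines a linear connection on $\mathfrak{k}$ which preserves the Lie bracket: $$\nabla^L_X[\xi,\eta]_{\mathfrak{k}}=[\nabla^L_X\xi,\eta]_{\mathfrak{k}}+[\xi,\nabla^L_X\eta]_{\mathfrak{k}},\qquad X\in\mathfrak{X}(M),\ \xi,\eta\in\Gamma(\mathfrak{k}).$$ In particular, $\mathfrak{k}$ is a locally trivial bundle of Lie algebras.
   Context: A Lie algebroid $A\Rightarrow M$ has bracket $[\cdot,\cdot]$ and anchor $\rho$. A bundle of ideals is a vector subbundle $\mathfrak{k}\subset\ker\rho$ with $[\alpha,\gamma]\in\Gamma(\mathfrak{k})$ for all $\alpha\in\Gamma(A)$, $\gamma\in\Gamma(\mathfrak{k})$; the fibres are Lie algebras with bracket $[\cdot,\cdot]_{\mathfrak{k}}$, and $A$ acts on $\mathfrak{k}$ by $\nabla^{\mathfrak{k}}_\alpha\gamma:=[\alpha,\gamma]$. An IM connection 1-form for $\mathfrak{k}$ is a $\mathfrak{k}$-valued IM 1-form on $A$ with $l|_{\mathfrak{k}}=\mathrm{id}$: i.e. a linear map $L:\Gamma(A)\to\Omega^1(M,\mathfrak{k})$ and a bundle map $l:A\to\mathfrak{k}$ with $l|_{\mathfrak{k}}=\mathrm{id}$,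 $L(f\alpha)=fL(\alpha)+df\otimes l(\alpha)$ and $$L([\alpha,\beta])=\mathcal{L}_\alpha L(\beta)-\mathcal{L}_\beta L(\alpha),\qquad l([\alpha,\beta])=[\alpha,l(\beta)]-i_{\rho(\beta)}L(\alpha),$$ where $(\mathcal{L}_\alpha\gamma)(X)=[\alpha,\gamma(X)]-\gamma([\rho(\alpha),X])$ for $\gamma\in\Omega^1(M,\mathfrak{k})$. $\mathfrak{k}$ is partially split if it admits an IM connection 1-form (equivalently, if there is a VB subalgebroid $E\Rightarrow TM$ of the tangent algebroid $TA\Rightarrow TM$ complementary to the image of $A\times_M\mathfrak{k}\hookrightarrow TA$, $(a,\gamma)\mapsto\frac{d}{d\tau}|_{0}(a+\tau\gamma)$). A bundle of Lie algebras is locally trivial if around each point it is isomorphic, fibrewise as Lie algebras, to $U\times\mathfrak{g}$ for a fixed Lie algebra $\mathfrak{g}$. *)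

(* Defs.v *)
From HB Require Import structures.
From mathcomp Require Import all_boot all_order all_algebra.
From mathcomp Require Import all_classical all_reals all_analysis.
From mathcomp Require Import ring.
Set Implicit Arguments.
Unset Strict Implicit.
Unset Printing Implicit Defensive.
Import Order.TTheory GRing.Theory Num.Theory.
Import numFieldNormedType.Exports.
Local Open Scope classical_set_scope.
Local Open Scope ring_scope.

Fixpoint Ck (R : realType) (n k : nat) (U : set 'rV[R]_n) (f : 'rV[R]_n -> R)
    : Prop :=
  (forall y, U y -> {for y, continuous f}) /\
  if k is k'.+1 then
    forall i : 'I_n, (forall y, U y -> derivable f y (delta_mx 0 i)) /\
                     Ck k' U (fun y => 'D_(delta_mx 0 i) f y)
  else True.

Definition Cinf (R : realType) (n : nat) (U : set 'rV[R]_n)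
    (f : 'rV[R]_n -> R) : Prop :=
  forall k, Ck k U f.

Lemma Ck_ext (R : realType) (n k : nat) (U : set 'rV[R]_n)
    (f g : 'rV[R]_n -> R) :
  open U -> (forall y, U y -> f y = g y) -> Ck k U f -> Ck k U g.
Proof.
move=> oU; elim: k f g => [|k IH] f g fg /= [cf df].
all: have nfg y : U y -> \forall z \near y, f z = g z
  by move=> Uy; apply: filterS fg _; exact: open_nbhs_nbhs (conj oU Uy).
all: have cg y : U y -> {for y, continuous g}
  by move=> Uy; rewrite /prop_for /continuous_at -(fg y Uy);
     apply: cvg_trans (cf y Uy); exact: near_eq_cvg (nfg y Uy).
- by split.
- split=> // i; have [df1 df2] := df i; split.
  + by move=> y Uy; exact: near_eq_derivable (nfg y Uy) (df1 y Uy).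
  + by apply: IH df2 => y Uy; exact: near_eq_derive (nfg y Uy).
Qed.

Lemma Ck_cst (R : realType) (n k : nat) (U : set 'rV[R]_n) (a : R) :
  Ck k U (fun=> a).
Proof.
elim: k a => [|k IH] a /=; split=> //; try by move=> y _; exact: cst_continuous.
move=> i; split; first by move=> y _; exact: derivable_cst.
have -> : (fun y : 'rV[R]_n => 'D_(delta_mx 0 i) (fun=> a) y) = fun=> 0 :> R.
  by apply/funext => y; rewrite derive_cst.
exact: IH.
Qed.

Lemma CkS (R : realType) (n k : nat) (U : set 'rV[R]_n)
    (f : 'rV[R]_n -> R) : Ck k.+1 U f -> Ck k U f.
Proof.
elim: k f => [|k IH] f; first by case.
by case=> cf df; split=> // i; case: (df i) => d1 d2; split=> //; exact: IH.
Qed.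

Lemma CkD (R : realType) (n k : nat) (U : set 'rV[R]_n)
    (f g : 'rV[R]_n -> R) :
  open U -> Ck k U f -> Ck k U g -> Ck k U (f + g).
Proof.
move=> oU; elim: k f g => [|k IH] f g [cf df] [cg dg] /=; split=> //;
  try by (move=> y Uy; exact: continuousD (cf y Uy) (cg y Uy)).
move=> i; have [df1 df2] := df i; have [dg1 dg2] := dg i; split.
  by move=> y Uy; apply: derivableD; [exact: df1|exact: dg1].
apply: Ck_ext (IH _ _ df2 dg2) => // y Uy.
by rewrite deriveD; [|exact: df1|exact: dg1].
Qed.

Lemma CkM (R : realType) (n k : nat) (U : set 'rV[R]_n)
    (f g : 'rV[R]_n -> R) :
  open U -> Ck k U f -> Ck k U g -> Ck k U (f * g).
Proof.
move=> oU; elim: k f g => [|k IH] f g hf hg;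
  case: (hf) => cf df; case: (hg) => cg dg; split=> //;
  try by (move=> y Uy; exact: continuousM (cf y Uy) (cg y Uy)).
move=> i; have [df1 df2] := df i; have [dg1 dg2] := dg i; split.
  by move=> y Uy; apply: derivableM; [exact: df1|exact: dg1].
apply: Ck_ext (CkD oU (IH _ _ (CkS hf) dg2) (IH _ _ (CkS hg) df2)) => // y Uy.
by rewrite deriveM; [|exact: df1|exact: dg1].
Qed.

Record chart (R : realType) (T : Type) (n : nat) := Chart {
  chart_dom : set T ;
  chart_map : T -> 'rV[R]_n ;
  chart_inv : 'rV[R]_n -> T }.

Definition is_chart (R : realType) (T : topologicalType) (n : nat)
    (c : chart R T n) : Prop :=
  [/\ open (chart_dom c),
      open (chart_map c @` chart_dom c),
      forall x, chart_dom c x -> chart_inv c (chart_map c x) = x,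
      forall x, chart_dom c x -> {for x, continuous (chart_map c)} &
      forall y, (chart_map c @` chart_dom c) y ->
        {for y, continuous (chart_inv c)}].

Record manifold (R : realType) (n : nat) := Manifold {
  mf_top :> topologicalType ;
  mf_hausdorff : hausdorff_space mf_top ;
  mf_second_countable : @second_countable mf_top ;
  mf_atlas : set (chart R mf_top n) ;
  mf_chart : forall c, mf_atlas c -> is_chart c ;
  mf_cover : forall x, exists2 c, mf_atlas c & chart_dom c x ;
  mf_transition : forall c d, mf_atlas c -> mf_atlas d -> forall j : 'I_n,
    Cinf (chart_map c @` (chart_dom c `&` chart_dom d))
      (fun y => chart_map d (chart_inv c y) 0 j) }.

(* Only meaningful for open [W]. *)
Definition smooth_on (R : realType) (n : nat) (M : manifold R n) (W : set M)
    (f : M -> R) : Prop :=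
  forall c, mf_atlas c ->
    Cinf (chart_map c @` (chart_dom c `&` W)) (f \o chart_inv c).

Definition smooth (R : realType) (n : nat) (M : manifold R n) (f : M -> R) :=
  smooth_on setT f.

Section SmoothFunctions.
Variables (R : realType) (n : nat) (M : manifold R n).
Implicit Types f g : M -> R.

Lemma open_chart_image (c : chart R M n) : mf_atlas c ->
  open (chart_map c @` (chart_dom c `&` setT)).
Proof. by move=> /mf_chart[_ oc _ _ _]; rewrite setIT. Qed.

Lemma smooth_cst (a : R) : smooth (fun _ : M => a).
Proof. by move=> c _ k; exact: Ck_cst. Qed.

Lemma smoothD f g : smooth f -> smooth g -> smooth (f + g).
Proof.
by move=> sf sg c ac k; apply: (CkD (open_chart_image ac)); [exact: sf|exact: sg].
Qed.

Lemma smoothM f g : smooth f -> smooth g -> smooth (f * g).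
Proof.
by move=> sf sg c ac k; apply: (CkM (open_chart_image ac)); [exact: sf|exact: sg].
Qed.

Lemma smoothZ (a : R) f : smooth f -> smooth (a *: f).
Proof. by move=> sf; exact: (smoothM (smooth_cst a) sf). Qed.

Lemma smoothB f g : smooth f -> smooth g -> smooth (f - g).
Proof.
by move=> sf sg; rewrite -(scaleN1r g); apply: smoothD => //; exact: smoothZ.
Qed.

End SmoothFunctions.

(* A tangent vector at [x] is an R-linear derivation at [x] of the algebra of
   smooth functions. It is represented by a function on all of [M -> R], and
   the last clause, which fixes the value [0] on non-smooth functions, makes the
   representation unique. *)
Definition is_derivation (R : realType) (n : nat) (M : manifold R n) (x : M)
    (D : (M -> R) -> R^o) : Prop :=
  [/\ forall (a : R) f g, smooth f -> smooth g ->
        D (a *: f + g) = a * D f + D g,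
      forall f g, smooth f -> smooth g ->
        D (f * g) = f x * D g + g x * D f &
      forall f, ~ smooth f -> D f = 0].

Section TangentSpace.
Variables (R : realType) (n : nat) (M : manifold R n) (x : M).

Definition derivations : {pred ((M -> R) -> R^o)} :=
  fun D => `[< is_derivation x D >].

Fact derivations_submod : submod_closed derivations.
Proof.
split=> [|a D E /asboolP[D1 D2 D3] /asboolP[E1 E2 E3]]; apply/asboolP; split.
- by move=> a f g _ _; rewrite /= mulr0 addr0.
- by move=> f g _ _; rewrite !mulr0 addr0.
- by [].
- move=> b f g sf sg /=.
  rewrite !fctE D1 // E1 // /GRing.scale /=; ring.
- move=> f g sf sg /=.
  rewrite !fctE D2 // E2 // /GRing.scale /=; ring.
- by move=> f nsf; rewrite !fctE D3 // E3 // scaler0 addr0.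
Qed.

HB.instance Definition _ :=
  GRing.isSubmodClosed.Build R ((M -> R) -> R^o) derivations derivations_submod.

Record tangent := Tangent {
  tangent_val :> (M -> R) -> R^o ;
  tangentP : tangent_val \in derivations }.

HB.instance Definition _ := [isSub for tangent_val].
HB.instance Definition _ := [Choice of tangent by <:].
HB.instance Definition _ := [SubChoice_isSubLmodule of tangent by <:].

End TangentSpace.

Definition vfield (R : realType) (n : nat) (M : manifold R n) :=
  forall x : M, tangent x.

Section VectorFields.
Variables (R : realType) (n : nat) (M : manifold R n).
Implicit Types (X Y : vfield M) (f : M -> R).

Definition vf_app X f : M -> R := fun x => X x f.

Definition smooth_vf X := forall f, smooth f -> smooth (vf_app X f).

Definition commutator X Y (x : M) : (M -> R) -> R^o :=
  fun f => X x (vf_app Y f) - Y x (vf_app X f).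

(* The default value [0] is never used when [X] and [Y] are smooth; see
   [vf_bracketE]. *)
Definition vf_bracket X Y : vfield M :=
  fun x => insubd (0 : tangent x) (commutator X Y x).

Lemma tangent_lin (x : M) (v : tangent x) (a : R) f g :
  smooth f -> smooth g -> v (a *: f + g) = a * v f + v g.
Proof. by case: v => D /= /asboolP[D1 _ _]; exact: D1. Qed.

Lemma tangent_leibniz (x : M) (v : tangent x) f g :
  smooth f -> smooth g -> v (f * g) = f x * v g + g x * v f.
Proof. by case: v => D /= /asboolP[_ D2 _]; exact: D2. Qed.

Lemma tangent_out (x : M) (v : tangent x) f : ~ smooth f -> v f = 0.
Proof. by case: v => D /= /asboolP[_ _ D3]; exact: D3. Qed.

Lemma tangent0 (x : M) (v : tangent x) : v 0 = 0.
Proof.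
have s0 : smooth (0 : M -> R) by exact: smooth_cst.
by have := tangent_lin v (-1) s0 s0; rewrite scaler0 addr0 mulN1r addNr.
Qed.

Lemma commutator_derivation X Y x : smooth_vf X -> smooth_vf Y ->
  is_derivation x (commutator X Y x).
Proof.
move=> sX sY.
have lin (Z : vfield M) (a : R) f g : smooth f -> smooth g ->
    vf_app Z (a *: f + g) = a *: vf_app Z f + vf_app Z g.
  by move=> sf sg; apply/funext => y; rewrite /vf_app tangent_lin.
have lei (Z : vfield M) f g : smooth f -> smooth g ->
    vf_app Z (f * g) = f * vf_app Z g + g * vf_app Z f.
  by move=> sf sg; apply/funext => y; rewrite /vf_app tangent_leibniz.
have add (v : tangent x) f g : smooth f -> smooth g -> v (f + g) = v f + v g.
  by move=> sf sg; have := tangent_lin v 1 sf sg; rewrite scale1r mul1r.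
split.
- move=> a f g sf sg; rewrite /commutator !lin // !tangent_lin //;
    try by [exact: sX | exact: sY].
  ring.
- move=> f g sf sg; rewrite /commutator !lei //.
  have sXf := sX _ sf; have sXg := sX _ sg.
  have sYf := sY _ sf; have sYg := sY _ sg.
  rewrite !add; try exact: smoothM.
  rewrite !tangent_leibniz // /vf_app; ring.
- move=> f nsf; rewrite /commutator.
  have app0 (Z : vfield M) : vf_app Z f = 0.
    by apply/funext => y; rewrite /vf_app tangent_out.
  by rewrite !app0 !tangent0 subr0.
Qed.

Lemma vf_bracketE X Y x f : smooth_vf X -> smooth_vf Y ->
  vf_bracket X Y x f = X x (vf_app Y f) - Y x (vf_app X f).
Proof.
move=> sX sY; rewrite /vf_bracket -[LHS]/((val (insubd _ _)) f) insubdK //.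
by apply/asboolP; exact: commutator_derivation.
Qed.

Lemma smooth_vf_bracket X Y :
  smooth_vf X -> smooth_vf Y -> smooth_vf (vf_bracket X Y).
Proof.
move=> sX sY f sf.
have -> : vf_app (vf_bracket X Y) f =
    vf_app X (vf_app Y f) - vf_app Y (vf_app X f).
  by apply/funext => x; rewrite [LHS]vf_bracketE.
by apply: smoothB; [exact/sX/sY | exact/sY/sX].
Qed.

End VectorFields.

Definition section (R : realType) (T : Type) (E : T -> vectType R) :=
  forall x, E x.

Record local_frame (R : realType) (T : Type) (E : T -> vectType R) :=
  LocalFrame {
    fr_dom : set T ;
    fr_rank : nat ;
    fr_vec : 'I_fr_rank -> section E }.
Arguments fr_vec {R T E} l i.

Definition frame_at (R : realType) (T : Type) (E : T -> vectType R)
    (e : local_frame E) (x : T) : (fr_rank e).-tuple (E x) :=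
  [tuple fr_vec e i x | i < fr_rank e].

Definition frame_coord (R : realType) (T : Type) (E : T -> vectType R)
    (e : local_frame E) (s : section E) (i : 'I_(fr_rank e)) : T -> R :=
  fun x => coord (frame_at e x) i (s x).
Arguments frame_coord {R T E} e s i x.

(* A smooth vector bundle is a family of finite-dimensional vector spaces with
   an atlas of local frames whose transition functions are smooth. *)
Record vector_bundle (R : realType) (n : nat) (M : manifold R n) :=
  VectorBundle {
    vb_fibre :> M -> vectType R ;
    vb_atlas : set (local_frame vb_fibre) ;
    vb_open : forall e, vb_atlas e -> open (fr_dom e) ;
    vb_basis : forall e, vb_atlas e -> forall x, fr_dom e x ->
      basis_of fullv (frame_at e x) ;
    vb_cover : forall x, exists2 e, vb_atlas e & fr_dom e x ;
    vb_transition : forall e e', vb_atlas e -> vb_atlas e' -> forall i j,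
      smooth_on (fr_dom e `&` fr_dom e') (frame_coord e (fr_vec e' j) i)
  }.

Section Sections.
Variables (R : realType) (n : nat) (M : manifold R n) (E : vector_bundle M).

Definition smooth_section_on (W : set M) (s : section E) : Prop :=
  forall e, vb_atlas e -> forall i, smooth_on (fr_dom e `&` W) (frame_coord e s i).

Definition smooth_section (s : section E) := smooth_section_on setT s.

(* Frames compatible with the atlas, i.e. members of the maximal atlas. *)
Definition smooth_frame (e : local_frame E) : Prop :=
  [/\ open (fr_dom e),
      forall x, fr_dom e x -> basis_of fullv (frame_at e x),
      forall j, smooth_section_on (fr_dom e) (fr_vec e j) &
      forall e', vb_atlas e' -> forall i j,
        smooth_on (fr_dom e `&` fr_dom e')
          (frame_coord e (fr_vec e' j) i)].

(* A vector subbundle is locally spanned by the first [r] members of a smooth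
   local frame of the ambient bundle. *)
Definition subbundle (k : forall x, {vspace E x}) : Prop :=
  forall x, exists (e : local_frame E) (r : nat),
    [/\ smooth_frame e, fr_dom e x &
        forall y, fr_dom e y -> k y = <<take r (frame_at e y)>>%VS].

Definition section_of (k : forall x, {vspace E x}) (s : section E) : Prop :=
  smooth_section s /\ forall x, s x \in k x.

End Sections.

(* The bracket is a function on all set-theoretic sections, but only its values
   on smooth sections are constrained. That the anchor maps the bracket to the
   commutator of vector fields follows from the Jacobi and Leibniz identities. *)
Record lie_algebroid (R : realType) (n : nat) (M : manifold R n) :=
  LieAlgebroid {
    la_bundle :> vector_bundle M ;
    la_anchor : forall x, {linear la_bundle x -> tangent x} ;
    la_bracket : section la_bundle -> section la_bundle -> section la_bundle ;
    la_anchor_smooth : forall a : section la_bundle, smooth_section a ->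
      smooth_vf (fun x => la_anchor x (a x)) ;
    la_bracket_smooth : forall a b : section la_bundle,
      smooth_section a -> smooth_section b -> smooth_section (la_bracket a b) ;
    la_bracket_linear : forall (c : R) (a a' b : section la_bundle),
      smooth_section a -> smooth_section a' -> smooth_section b ->
      la_bracket (fun x => c *: a x + a' x) b =
      (fun x => c *: la_bracket a b x + la_bracket a' b x) ;
    la_bracket_antisym : forall a b : section la_bundle,
      smooth_section a -> smooth_section b ->
      la_bracket a b = (fun x => - la_bracket b a x) ;
    la_jacobi : forall a b c : section la_bundle,
      smooth_section a -> smooth_section b -> smooth_section c ->
      la_bracket a (la_bracket b c) =
      (fun x => la_bracket (la_bracket a b) c x +
                la_bracket b (la_bracket a c) x) ;
    la_leibniz : forall (f : M -> R) (a b : section la_bundle),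
      smooth f -> smooth_section a -> smooth_section b ->
      la_bracket a (fun x => f x *: b x) =
      (fun x => f x *: la_bracket a b x + la_anchor x (a x) f *: b x) }.

Section Algebroid.
Variables (R : realType) (n : nat) (M : manifold R n) (A : lie_algebroid M).

Definition anchor_vf (a : section A) : vfield M :=
  fun x => la_anchor A x (a x).

(* Objects with values in a bundle of ideals [k] (sections, 1-forms, bundle
   maps) are the objects with values in [A] that take their values in [k]. *)
Record bundle_of_ideals (k : forall x, {vspace A x}) : Prop := {
  bi_subbundle : subbundle k ;
  bi_anchor : forall x (v : A x), v \in k x -> la_anchor A x v = 0 ;
  bi_ideal : forall a c : section A, smooth_section a -> section_of k c ->
    forall x, la_bracket a c x \in k x }.

(* The bracket of the fibre [k x]: extend [u] and [v] to sections of [k], take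
   the bracket of the extensions, and evaluate at [x]. For a bundle of ideals
   the result does not depend on the extensions. *)
Definition fibre_bracket (k : forall x, {vspace A x}) (x : M) (u v : A x) : A x :=
  xget 0 [set w | exists a b : section A,
    [/\ section_of k a, section_of k b, a x = u, b x = v &
        w = la_bracket a b x]].

Definition section_bracket (k : forall x, {vspace A x}) (a b : section A) :
    section A :=
  fun x => fibre_bracket k (a x) (b x).

Definition oneform := forall x : M, {linear tangent x -> A x}.

Definition form_app (w : oneform) (X : vfield M) : section A :=
  fun x => w x (X x).

Definition oneform_of (k : forall x, {vspace A x}) (w : oneform) : Prop :=
  (forall X, smooth_vf X -> smooth_section (form_app w X)) /\
  (forall x (v : tangent x), w x v \in k x).

(* The section [(L_a w)(X) = [a, w(X)] - w([rho(a), X])]. *)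
Definition lie_derivative (a : section A) (w : oneform) (X : vfield M) :
    section A :=
  fun x => la_bracket a (form_app w X) x -
           form_app w (vf_bracket (anchor_vf a) X) x.

(* An IM 1-form [(L, l)] with values in [k] such that [l] is the identity on
   [k]; the representation of [A] on [k] is [c |-> [a, c]]. Only the values of
   [L] on smooth sections are constrained. *)
Record im_connection (k : forall x, {vspace A x})
    (L : section A -> oneform) (l : forall x, {linear A x -> A x}) : Prop := {
  im_form : forall a, smooth_section a -> oneform_of k (L a) ;
  im_linear : forall (c : R) (a b : section A),
    smooth_section a -> smooth_section b -> forall x (v : tangent x),
    L (fun y => c *: a y + b y) x v = c *: L a x v + L b x v ;
  im_symbol_smooth : forall a : section A,
    smooth_section a -> smooth_section (fun x => l x (a x) : A x) ;
  im_symbol_val : forall x (u : A x), l x u \in k x ;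
  im_symbol_id : forall x (u : A x), u \in k x -> l x u = u ;
  im_leibniz : forall (f : M -> R) (a : section A),
    smooth f -> smooth_section a -> forall x (v : tangent x),
    L (fun y => f y *: a y) x v = f x *: L a x v + v f *: l x (a x) ;
  im_bracket : forall a b : section A,
    smooth_section a -> smooth_section b ->
    forall X, smooth_vf X -> forall x,
    form_app (L (la_bracket a b)) X x =
    lie_derivative a (L b) X x - lie_derivative b (L a) X x ;
  im_symbol_bracket : forall a b : section A,
    smooth_section a -> smooth_section b -> forall x,
    l x (la_bracket a b x) =
    la_bracket a (fun y => l y (b y) : A y) x - form_app (L a) (anchor_vf b) x
  }.

Definition induced_connection (L : section A -> oneform) (X : vfield M)
    (s : section A) : section A :=
  form_app (L s) X.

Record linear_connection (k : forall x, {vspace A x})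
    (D : vfield M -> section A -> section A) : Prop := {
  lc_section : forall X s, smooth_vf X -> section_of k s ->
    section_of k (D X s) ;
  lc_function_linear : forall (f : M -> R) X Y s, smooth f ->
    smooth_vf X -> smooth_vf Y -> section_of k s ->
    forall x, D (fun y => f y *: X y + Y y) s x = f x *: D X s x + D Y s x ;
  lc_linear : forall (c : R) X (s t : section A),
    smooth_vf X -> section_of k s -> section_of k t ->
    forall x, D X (fun y => c *: s y + t y) x = c *: D X s x + D X t x ;
  lc_leibniz : forall (f : M -> R) X (s : section A), smooth f ->
    smooth_vf X -> section_of k s ->
    forall x, D X (fun y => f y *: s y) x = f x *: D X s x + X x f *: s x }.

End Algebroid.

Record lie_algebra (R : realType) := LieAlgebra {
  lg_space :> vectType R ;
  lg_bracket : lg_space -> lg_space -> lg_space ;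
  lg_bracket_linear : forall (c : R) u u' v,
    lg_bracket (c *: u + u') v = c *: lg_bracket u v + lg_bracket u' v ;
  lg_bracket_antisym : forall u v, lg_bracket u v = - lg_bracket v u ;
  lg_jacobi : forall u v w, lg_bracket u (lg_bracket v w) =
    lg_bracket (lg_bracket u v) w + lg_bracket v (lg_bracket u w) }.

Section LocalTriviality.
Variables (R : realType) (n : nat) (M : manifold R n) (E : vector_bundle M).
Variables (k : forall x, {vspace E x}) (br : forall x, E x -> E x -> E x).

(* [psi] is a smooth isomorphism from [U * g] onto the restriction of [k] to
   [U], fibrewise an isomorphism of Lie algebras. A [g]-valued function is
   smooth when its coordinates in a basis of [g] are. *)
Definition lie_trivialization (U : set M) (g : lie_algebra R)
    (psi : forall x, 'Hom(g, E x)) : Prop :=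
  [/\ forall x, U x -> lker (psi x) = 0%VS /\ limg (psi x) = k x,
      forall x, U x -> forall u v : g,
        psi x (lg_bracket u v) = br (psi x u) (psi x v) &
      forall s : section E, (forall x, U x -> s x \in k x) ->
        (smooth_section_on U s <->
         forall i, smooth_on U
           (fun x => coord (vbasis {: g}) i ((psi x)^-1%VF (s x))))].

(* The typical fibre [g] is the same over a whole connected component. *)
Definition locally_trivial : Prop :=
  forall x0 : M, exists g : lie_algebra R,
    forall x, connected_component [set: M] x0 x ->
      exists (U : set M) (psi : forall y, 'Hom(g, E y)),
        [/\ open U, U x & lie_trivialization U psi].

End LocalTriviality.

(* Main.v *)
(* A section [xi] of [k] has zero anchor, so the compatibility of [L] with brackets reduces to
   [L [xi, eta] X = [xi, L eta X] + [L xi X, eta]]: the induced connection is a derivation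
   of the fibre bracket. In a chart and a local frame of [k], this says that the structure
   functions are covariantly constant. Parallel transport along the rays issuing from a
   point is a linear differential equation depending smoothly on the end point; it yields
   a smooth frame in which the structure functions are constant along the rays, hence
   constant. Isomorphic fibres spread over connected components by a clopen argument. *)
Require Import Defs.
From HB Require Import structures.
From mathcomp Require Import all_boot all_order all_algebra.
From mathcomp Require Import all_classical all_reals all_analysis.
From mathcomp Require Import perm ring lra.
Set Implicit Arguments.
Unset Strict Implicit.
Unset Printing Implicit Defensive.
Import Order.TTheory GRing.Theory Num.Theory.
Import numFieldNormedType.Exports.
Local Open Scope classical_set_scope.
Local Open Scope ring_scope.

(** * Chain rule for functions of class C^k *)

(** The induced connection need not be flat, so a frame parallel in all directions cannot be
    expected. This does no harm: the bracket is covariantly constant in every direction, and a frame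
    that is parallel along the rays from one point already makes its components constant along those
    rays. The analytic weight lies in the smooth dependence of the transport on the end point. Time
    and end point become coordinates of one space; the rays are shrunk until the coefficients are
    small and a cutoff extends the equation to the whole space, so that a single contraction gives
    global solutions and none has to be continued. Smoothness is then an induction: a derivative in
    a parameter direction solves the same linear system with another source. The constants fit
    together as follows. The coefficients vanish for [|t| > 3], so only [|t| <= 4] matters and one
    integration costs a factor 4. The bound 1 / (16 (r + 1)) on [r * r] coefficients leaves at most
    1/4 for a Picard step, and at most 1/2 after the factor 8 of the stability estimate, which makes
    the solution matrix invertible. *)

Lemma abs_coord_le (R : realType) (n : nat) (w : 'rV[R]_n) i : `|w 0 i| <= `|w|.
Proof.
by rewrite [leRHS]/Num.Def.normr/= mx_normrE; exact: (le_bigmax _ _ (0, i)).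
Qed.

Lemma norm_row_le (R : realType) (n : nat) (w : 'rV[R]_n) (c : R) :
  0 <= c -> (forall i, `|w 0 i| <= c) -> `|w| <= c.
Proof.
move=> c0 wc; rewrite [leLHS]/Num.Def.normr/= mx_normrE (bigmax_le _ c0)//=.
by move=> -[i j] _; rewrite /= (ord1 i).
Qed.

Lemma norm_row_lt (R : realType) (n : nat) (w : 'rV[R]_n) (c : R) :
  0 < c -> (forall i, `|w 0 i| < c) -> `|w| < c.
Proof.
move=> c0 wc; rewrite [ltLHS]/Num.Def.normr/= mx_normrE; apply/bigmax_ltP; split=> //.
by move=> -[i j] _; rewrite /= (ord1 i).
Qed.

Lemma norm_delta_le1 (R : realType) (n : nat) i : `|delta_mx 0 i : 'rV[R]_n| <= 1.
Proof.
by apply: norm_row_le => // j; rewrite mxE eqxx /=; case: (j == i) => /=; rewrite ?normr1 ?normr0.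
Qed.

Lemma cvg_rowP (R : realType) (n : nat) (T : Type) (F : set_system T)
    (FF : Filter F) (phi : T -> 'rV[R]_n) (l : 'rV[R]_n) :
  (forall i, (fun x => phi x 0 i) @ F --> l 0 i) -> phi @ F --> l.
Proof.
move=> h; apply/cvgrPdist_lt => e e0; near=> x.
apply: norm_row_lt => // i; rewrite !mxE; move: i; near: x.
by apply: filter_forall => i; move/cvgrPdist_lt: (h i) => /(_ _ e0).
Unshelve. all: by end_near. Qed.

Lemma continuous_row (R : realType) (n : nat) (T : topologicalType)
    (phi : T -> 'rV[R]_n) (x : T) :
  (forall i, {for x, continuous (fun y => phi y 0 i)}) -> {for x, continuous phi}.
Proof. by move=> h; apply: cvg_rowP => i; exact: h. Qed.

Lemma near_dist_lt (R : realType) (V : normedModType R) (y : V) (e : R) :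
  0 < e -> \forall z \near y, `|z - y| < e.
Proof.
move=> e0; apply/nbhs_ballP; exists e => //= z.
by rewrite -ball_normE /ball_/= distrC.
Qed.

Lemma continuous_dist (R : realType) (V : normedModType R) (f : V -> R) (y : V) :
  (forall e, 0 < e -> \forall z \near y, `|f y - f z| < e) -> {for y, continuous f}.
Proof. by move=> h; apply/cvgrPdist_lt => e; exact: h. Qed.

(** Increments of coordinates and of time have no fixed sign; bounding the intermediate point by
    [|s|] spares every later use a case distinction. *)
Lemma MVT_symmetric (R : realType) (f df : R -> R) (s : R) :
  (forall c : R, `|c| <= `|s| -> is_derive c 1 f (df c)) ->
  exists2 c, `|c| <= `|s| & f s - f 0 = df c * s.
Proof.
move=> fd.
have fc (a b : R) : (forall c, a <= c <= b -> `|c| <= `|s|) ->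
    {within `[a, b], continuous f}.
  move=> ab; apply: continuous_in_subspaceT => c; rewrite inE/= in_itv/= => /ab/fd[dc _].
  exact/differentiable_continuous/derivable1_diffP.
have [s0|s0] := leP 0 s.
- have h c : 0 <= c <= s -> `|c| <= `|s| by move=> /andP[c0 cs]; rewrite !ger0_norm.
  have [x|c] := @MVT_segment R f df 0 s s0 _ (fc _ _ h).
    by rewrite in_itv/= => /andP[/ltW x0 /ltW xs]; apply: fd; apply: h; rewrite x0.
  by rewrite in_itv/= subr0 => /h; exists c.
- have h c : s <= c <= 0 -> `|c| <= `|s|.
    by move=> /andP[c0 cs]; rewrite !ler0_norm ?lerN2 // ltW.
  have [x|c] := @MVT_segment R f df s 0 (ltW s0) _ (fc _ _ h).
    by rewrite in_itv/= => /andP[/ltW x0 /ltW xs]; apply: fd; apply: h; rewrite x0.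
  rewrite in_itv/= sub0r mulrN => /h cs e; exists c => //.
  by rewrite -[LHS]opprB e opprK.
Qed.

Lemma is_derive_line (R : realType) (V : normedModType R) (f : V -> R) (x v : V) (t df : R) :
  is_derive (t *: v + x) v f df -> is_derive t 1 (fun s : R => f (s *: v + x)) df.
Proof.
move=> [/cvg_ex[/= l fl] <-]; have dl : 'D_v f (t *: v + x) = l by exact/cvg_lim.
have e : (fun h : R => h^-1 *:
      (((fun s : R => f (s *: v + x)) \o shift t) (h *: (1:R)) - f (t *: v + x))) =
    (fun h : R => h^-1 *: ((f \o shift (t *: v + x)) (h *: v) - f (t *: v + x))).
  by apply/funext => h /=; rewrite [h *: 1]mulr1 scalerDl addrA.
apply: DeriveDef; first by apply/cvg_ex; exists l; rewrite e.
by rewrite /derive e.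
Qed.

(** Corners of a staircase path from [y] to [z]: consecutive corners differ in one coordinate, so
    that an increment of [f] splits into increments of functions of one variable. *)
Definition row_mix (R : realType) (n : nat) (y z : 'rV[R]_n) (j : nat) : 'rV[R]_n :=
  \row_i (if (i < j)%N then z 0 i else y 0 i).

Lemma row_mixS (R : realType) (n : nat) (y z : 'rV[R]_n) (i : 'I_n) :
  row_mix y z i.+1 = (z 0 i - y 0 i) *: delta_mx 0 i + row_mix y z i.
Proof.
apply/rowP => j; rewrite !mxE eqxx /= ltnS leq_eqVlt -[(_ == _ :> nat)]/(j == i).
case: eqVneq => [->|_]; first by rewrite ltnn /= mulr1 subrK.
by rewrite /= mulr0 add0r.
Qed.

Lemma row_mix_telescope (R : realType) (n : nat) (f : 'rV[R]_n -> R) (y z : 'rV[R]_n) :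
  f z - f y = \sum_(i < n) (f (row_mix y z i.+1) - f (row_mix y z i)).
Proof.
rewrite -(big_mkord xpredT (fun i => f (row_mix y z i.+1) - f (row_mix y z i))).
rewrite telescope_sumr //; congr (f _ - f _); apply/rowP => i; rewrite !mxE //.
by rewrite ltn_ord.
Qed.

Lemma row_mix_dist (R : realType) (n : nat) (y z : 'rV[R]_n) (i : 'I_n) (c : R) :
  `|c| <= `|z 0 i - y 0 i| ->
  `|c *: delta_mx 0 i + row_mix y z i - y| <= `|z - y|.
Proof.
move=> h; apply: norm_row_le => // j; rewrite !mxE eqxx /=.
have zy : `|z 0 j - y 0 j| <= `|z - y| by have := abs_coord_le (z - y) j; rewrite !mxE.
case: eqVneq => [ji|_] /=; last by rewrite mulr0 add0r; case: ifP => _ //; rewrite subrr normr0.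
by subst j; rewrite ltnn mulr1 addrK (le_trans h).
Qed.

(** Hadamard's factorization in a weak form: the factors only converge at [y], which is all that the
    chain rule needs. Each factor is a partial derivative at the point that the mean value theorem
    picks on one leg of the staircase, and that leg stays as close to [y] as [z] is. *)
Lemma C1_hadamard (R : realType) (n : nat) (U : set 'rV[R]_n) (f : 'rV[R]_n -> R) y :
  open U -> Ck 1 U f -> U y ->
  exists g : 'I_n -> 'rV[R]_n -> R,
    (forall i, g i @ y --> 'D_(delta_mx 0 i) f y) /\
    \forall z \near y, f z - f y = \sum_(i < n) g i z * (z 0 i - y 0 i).
Proof.
move=> oU [_ df] Uy.
have [r /= r0 rU] : exists2 r : R, 0 < r & forall z, `|z - y| < r -> U z.
  have /nbhs_ballP[r r0 rU] : nbhs y U by exact: open_nbhs_nbhs.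
  by exists r => // z zy; apply: rU; rewrite -ball_normE /ball_/= distrC.
have key i (z : 'rV[R]_n) : exists c : R, `|c| <= `|z 0 i - y 0 i| /\ (`|z - y| < r ->
    f (row_mix y z i.+1) - f (row_mix y z i) =
    'D_(delta_mx 0 i) f (c *: delta_mx 0 i + row_mix y z i) * (z 0 i - y 0 i)).
  have [zy|zy] := ltP `|z - y| r; last by exists 0; rewrite normr0; split.
  have [|c ch ce] := @MVT_symmetric R (fun t : R => f (t *: delta_mx 0 i + row_mix y z i))
      (fun t => 'D_(delta_mx 0 i) f (t *: delta_mx 0 i + row_mix y z i)) (z 0 i - y 0 i).
    move=> c ch; apply: is_derive_line; apply: derivableP; apply: (df i).1; apply: rU.
    exact: le_lt_trans (row_mix_dist ch) zy.
  exists c; split=> // _; rewrite row_mixS -ce.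
  by rewrite scale0r add0r.
have /choice[c ch] : forall iz : 'I_n * 'rV[R]_n, exists c : R,
    `|c| <= `|iz.2 0 iz.1 - y 0 iz.1| /\ (`|iz.2 - y| < r ->
    f (row_mix y iz.2 iz.1.+1) - f (row_mix y iz.2 iz.1) =
    'D_(delta_mx 0 iz.1) f (c *: delta_mx 0 iz.1 + row_mix y iz.2 iz.1) * (iz.2 0 iz.1 - y 0 iz.1)).
  by move=> [i z]; exact: key.
exists (fun i z => 'D_(delta_mx 0 i) f (c (i, z) *: delta_mx 0 i + row_mix y z i)).
split=> [i|].
  have [_ [cdf _]] := df i.
  suff cy : (fun z : 'rV[R]_n => c (i, z) *: delta_mx 0 i + row_mix y z i) @ y --> y.
    have := @cvg_comp _ _ _ _ ('D_(delta_mx 0 i) f) _ _ _ cy (cdf y Uy). exact.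
  apply: (@cvg_rowP _ _ _ (nbhs y)) => j.
  apply/cvgrPdist_lt => e e0; apply: filterS (near_dist_lt y e0) => z zye.
  rewrite distrC; apply: le_lt_trans (le_lt_trans (row_mix_dist (ch (i, z)).1) zye).
  by have := abs_coord_le (c (i, z) *: delta_mx 0 i + row_mix y z i - y) j; rewrite !mxE.
apply: filterS (near_dist_lt y r0) => z zy.
by rewrite row_mix_telescope; apply: eq_bigr => i _; exact: (ch (i, z)).2.
Qed.

Lemma cvg_sum_fct (R : realType) (I : Type) (r : seq I) (T : Type) (F : set_system T)
    (FF : Filter F) (f : I -> T -> R) (l : I -> R) :
  (forall i, f i @ F --> l i) ->
  (fun x => \sum_(i <- r) f i x) @ F --> \sum_(i <- r) l i.
Proof.
move=> fl; elim: r => [|i r IH].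
  by rewrite big_nil; under eq_fun do rewrite big_nil; exact: cvg_cst.
by rewrite big_cons; under eq_fun do rewrite big_cons; apply: cvgD.
Qed.

Lemma derivable_cvg_line (R : realType) (V : normedModType R) (f : V -> R) (x v : V) :
  derivable f x v -> f (h *: v + x) @[h --> (0:R)^'] --> f x.
Proof.
move=> /derivable1P/derivable1_diffP/differentiable_continuous cf.
have {cf} := cf : (fun h : R => f (h *: v + x)) @ (0 : R) --> f (0 *: v + x).
rewrite scale0r add0r => cf'.
by apply: cvg_trans cf'; apply: cvg_app; exact: cvg_within.
Qed.

(** In the factorization of [C1_hadamard] at [phi x], the difference quotient of [f \o phi] is a sum
    of products of convergent factors. Thus [phi] needs a derivative in the direction [v] only. *)
Lemma is_derive_comp_C1 (R : realType) (n : nat) (V : normedModType R)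
    (U : set 'rV[R]_n) (f : 'rV[R]_n -> R) (phi : V -> 'rV[R]_n) (x v : V) (dphi : 'I_n -> R) :
  open U -> Ck 1 U f -> U (phi x) ->
  (forall i, is_derive x v (fun z => phi z 0 i) (dphi i)) ->
  is_derive x v (f \o phi) (\sum_(i < n) 'D_(delta_mx 0 i) f (phi x) * dphi i).
Proof.
move=> oU fU Ux dp; have [g [cg fg]] := C1_hadamard oU fU Ux.
have cphi : phi (h *: v + x) @[h --> (0:R)^'] --> phi x.
  by apply: cvg_rowP => i; apply: (@derivable_cvg_line _ _ (fun z => phi z 0 i)); case: (dp i).
have lim : (fun h : R => h^-1 *: (((f \o phi) \o shift x) (h *: v) - (f \o phi) x)) @ 0^' -->
    \sum_(i < n) 'D_(delta_mx 0 i) f (phi x) * dphi i.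
  apply: (@cvg_trans _ ((fun h : R => \sum_(i < n) g i (phi (h *: v + x)) *
      (h^-1 *: (phi (h *: v + x) 0 i - phi x 0 i))) @ 0^')).
    apply: near_eq_cvg; near=> h.
    rewrite /= (_ : f _ - _ =
      \sum_(i < n) g i (phi (h *: v + x)) * (phi (h *: v + x) 0 i - phi x 0 i)).
      by rewrite scaler_sumr; apply: eq_bigr => i _; rewrite /GRing.scale /=; ring.
    by near: h; exact: (cphi _ fg).
  apply: cvg_sum_fct => i; apply: cvgM.
    by apply: (cvg_comp _ _ cphi); exact: cg.
  have [/cvg_ex[/= l hl] <-] := dp i.
  by have -> : 'D_v (fun z => phi z 0 i) x = l by exact/cvg_lim.
apply: DeriveDef; first by apply/cvg_ex; eexists; exact: lim.
exact/cvg_lim.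
Unshelve. all: by end_near. Qed.

Section CkTheory.
Variables (R : realType) (n : nat).
Implicit Types (U V W : set 'rV[R]_n) (f g : 'rV[R]_n -> R) (k : nat).

Lemma Ck_subset k U V f : U `<=` V -> Ck k V f -> Ck k U f.
Proof.
move=> UV; elim: k f => [|k IH] f [cf df]; split=> //; try by move=> y /UV; exact: cf.
by move=> i; have [d1 d2] := df i; split; [move=> y /UV; exact: d1|exact: IH].
Qed.

(** [Ck] tests continuity and derivatives at the points of the set but within the whole space, so
    that the sets [V] need not be open. *)
Lemma Ck_local k U f :
  (forall y, U y -> exists2 V, V y & Ck k V f) -> Ck k U f.
Proof.
elim: k f => [|k IH] f h; split=> //; try by move=> y /h[V Vy [cf _]]; exact: cf.
move=> i; split=> [y /h[V Vy [_ /(_ i)[d _]]]|]; first exact: d.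
by apply: IH => y /h[V Vy [_ /(_ i)[_ d]]]; exists V.
Qed.

Lemma Ck_le k l U f : (k <= l)%N -> Ck l U f -> Ck k U f.
Proof. by move=> kl; rewrite -(subnK kl); elim: (l - k)%N => // m IH /CkS. Qed.

Lemma Ck_continuous k U f y : Ck k U f -> U y -> {for y, continuous f}.
Proof. by case: k => [|k] [cf _] /cf. Qed.

Lemma CkN k U f : open U -> Ck k U f -> Ck k U (- f).
Proof.
move=> oU fU; have -> : - f = cst (-1) * f by apply/funext => y; rewrite !fctE mulN1r.
by apply: CkM => //; exact: Ck_cst.
Qed.

Lemma CkB k U f g : open U -> Ck k U f -> Ck k U g -> Ck k U (f - g).
Proof. by move=> oU fU gU; apply: CkD => //; exact: CkN. Qed.

Lemma Ck_sum k U (I : Type) (r : seq I) (f : I -> 'rV[R]_n -> R) :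
  open U -> (forall i, Ck k U (f i)) -> Ck k U (fun y => \sum_(i <- r) f i y).
Proof.
move=> oU fU; elim: r => [|i r IH].
  by under eq_fun do rewrite big_nil; exact: Ck_cst.
under eq_fun do rewrite big_cons.
by have := CkD oU (fU i) IH.
Qed.

Lemma Ck_coord k U i : Ck k U (fun y => y 0 i).
Proof.
case: k => [|k]; split=> //; try by move=> y _; exact: coord_continuous.
have dc j y : is_derive y (delta_mx 0 j) (fun y : 'rV[R]_n => y 0 i) (i == j)%:R.
  have did := @derivable_id R 'rV[R]_n y (delta_mx 0 j).
  apply: DeriveDef; first exact: ((derivable_mxP _ _ _).1 did 0 i).
  by have /matrixP/(_ 0 i) := derive_mx did; rewrite derive_id !mxE eqxx /= => ->.
move=> j; split=> [y _|]; first by case: (dc j y).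
have -> : (fun y : 'rV[R]_n => 'D_(delta_mx 0 j) (fun y : 'rV[R]_n => y 0 i) y) = cst (i == j)%:R.
  by apply/funext => y; case: (dc j y).
exact: Ck_cst.
Qed.

Lemma CkV k U f : open U -> (forall y, U y -> f y != 0) -> Ck k U f ->
  Ck k U (fun y => (f y)^-1).
Proof.
move=> oU f0; elim: k => [|k IH] fU; have := fU => -[cf df]; split=> //;
  try by move=> y Uy; apply: cvgV (cf y Uy); exact: f0.
move=> i; have [d1 d2] := df i; split.
  by move=> y Uy; apply: derivableV; [exact: f0|exact: d1].
have Vk := IH (CkS fU).
apply: Ck_ext (CkM oU (CkN oU (CkM oU Vk Vk)) d2) => // y Uy.
rewrite deriveV; [|exact: f0|exact: d1].
by rewrite !fctE /GRing.scale /= -exprVn expr2.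
Qed.

End CkTheory.

Lemma Ck_comp (R : realType) (m n k : nat) (U : set 'rV[R]_m) (V : set 'rV[R]_n)
    (f : 'rV[R]_n -> R) (phi : 'rV[R]_m -> 'rV[R]_n) :
  open U -> open V -> (forall y, U y -> V (phi y)) -> Ck k V f ->
  (forall i, Ck k U (fun y => phi y 0 i)) -> Ck k U (f \o phi).
Proof.
move=> oU oV UV; elim: k f => [|k IH] f fV phiU.
  split=> // y Uy; apply: continuous_comp; last exact: fV.1 _ (UV _ Uy).
  by apply: continuous_row => i; exact: (phiU i).1.
have cphi y : U y -> {for y, continuous phi}.
  by move=> Uy; apply: continuous_row => i; exact: (phiU i).1.
have dcomp j y : U y -> is_derive y (delta_mx 0 j) (f \o phi)
    (\sum_(i < n) 'D_(delta_mx 0 i) f (phi y) * 'D_(delta_mx 0 j) (fun y => phi y 0 i) y).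
  move=> Uy; apply: is_derive_comp_C1 oV (Ck_le _ fV) (UV _ Uy) _ => // i.
  by apply: derivableP; exact: ((phiU i).2 j).1.
split=> [y Uy|j].
  by apply: continuous_comp; [exact: cphi|exact: fV.1 _ (UV _ Uy)].
split=> [y Uy|]; first by case: (dcomp j y Uy).
apply: (@Ck_ext _ _ _ _ (fun y => \sum_(i < n)
    (('D_(delta_mx 0 i) f \o phi) * 'D_(delta_mx 0 j) (fun y => phi y 0 i)) y)) => //.
  by move=> y Uy; case: (dcomp j y Uy) => _ ->.
apply: Ck_sum => // i; apply: CkM => //; last exact: ((phiU i).2 j).2.
by apply: IH => [|i']; [exact: (fV.2 i).2|exact: CkS].
Qed.

(** * Smooth cutoff functions *)

(** The family [F] is closed under differentiation, [d] being the effect on the index. Hence the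
    induction on [k] runs over all members at once; it is meant for [flat_fun], indexed by
    polynomials. *)
Lemma Ck_comp_real (R : realType) (n k : nat) (I : Type) (F : I -> R -> R) (d : I -> I)
    (U : set 'rV[R]_n) (g : 'rV[R]_n -> R) (i : I) :
  open U -> (forall i (t : R), is_derive t 1 (F i) (F (d i) t)) ->
  Ck k U g -> Ck k U (F i \o g).
Proof.
move=> oU dF; have cF j : continuous (F j).
  by move=> t; apply/differentiable_continuous/derivable1_diffP; case: (dF j t).
have dc (f : 'rV[R]_n -> R) j (v : 'rV[R]_n) y : derivable f y v ->
    is_derive y v (F j \o f) ('D_v f y * F (d j) (f y)).
  move=> dg; have dgF : differentiable (F j) (f y).
    by apply/derivable1_diffP; case: (dF j (f y)).
  have /derivable1P/derivable1_diffP dl := dg.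
  have [dgv Dgv] : is_derive (0 : R) 1 (F j \o (fun h : R => f (h *: v + y)))
      ('D_v f y * F (d j) (f y)).
    have -> : 'D_v f y * F (d j) (f y) = F (d j) (f (0 *: v + y)) * 'D_v f y.
      by rewrite scale0r add0r mulrC.
    have dl1 : is_derive (0 : R) 1 (fun h : R => f (h *: v + y)) ('D_v f y).
      by apply: (@is_derive_line R 'rV[R]_n f y v 0); rewrite scale0r add0r; exact: derivableP.
    exact: (@is_derive1_comp _ _ _ _ _ _ (dF j _) dl1).
  have dFg : derivable (F j \o f) y v by apply: (derivable1P _ _ _).2; exact: dgv.
  apply: (DeriveDef dFg).
  rewrite -Dgv /derive.
  under [in RHS]eq_fun do rewrite /= addr0 scale0r add0r [_%:A]mulr1.
  by [].
elim: k i g => [|k IH] i g gU; have := gU => -[cg dg]; split.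
- by move=> y Uy; apply: continuous_comp (cg y Uy) (cF i _).
- by [].
- by move=> y Uy; apply: continuous_comp (cg y Uy) (cF i _).
move=> j; have [d1 d2] := dg j; split=> [y Uy|]; first by case: (dc g i _ _ (d1 y Uy)).
apply: Ck_ext (CkM oU d2 (IH (d i) g (CkS gU))) => // y Uy.
by case: (dc g i _ _ (d1 y Uy)) => _ ->.
Qed.

Section FlatFunctions.
Variable R : realType.
Implicit Types (p : {poly R}) (t : R).

(** The polynomial factor makes the family stable under differentiation; [flat_fun 1] is the
    classical function that is flat at 0. *)
Definition flat_fun p t : R := if 0 < t then p.[t^-1] * expR (- t^-1) else 0.

Lemma flat_fun_le0 p t : t <= 0 -> flat_fun p t = 0.
Proof. by rewrite /flat_fun ltNge => ->. Qed.

Lemma flat_fun_small p : exists2 C : R, 0 <= C & forall t, `|flat_fun p t| <= C * `|t|.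
Proof.
exists (\sum_(i < size p) `|p`_i| * (i.+1)`!%:R); first by apply: sumr_ge0 => i _; rewrite mulr_ge0.
move=> t; rewrite /flat_fun; case: ltP => t0; last first.
  by rewrite normr0 mulr_ge0 // sumr_ge0 // => i _; rewrite mulr_ge0.
rewrite horner_coef mulr_suml mulr_suml (le_trans (ler_norm_sum _ _ _)) //.
apply: ler_sum => i _; have u0 : 0 < t^-1 by rewrite invr_gt0.
rewrite -mulrA normrM -mulrA; apply: ler_wpM2l => //.
rewrite ger0_norm; last by rewrite mulr_ge0 ?expR_ge0 // exprn_ge0 // ltW.
rewrite expRN ler_pdivrMr ?expR_gt0 // (ger0_norm (ltW t0)).
have := expR_ge1Dxn i (ltW u0).
set e := expR _; move=> h; have {}h : t^-1 ^+ i.+1 / i.+1`!%:R <= e.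
  by rewrite (le_trans _ h) // lerDr.
have f0 : 0 < i.+1`!%:R :> R by rewrite ltr0n fact_gt0.
rewrite ler_pdivrMr // in h.
rewrite (_ : t^-1 ^+ i = t^-1 ^+ i.+1 * t); last by rewrite exprSr -mulrA mulVf ?mulr1 // gt_eqF.
by rewrite mulrAC ler_pM2r // mulrC.
Qed.

(** With [u = t^-1] one has d/dt = - u^2 d/du, and d/du turns p(u) exp(-u) into (p' - p)(u)
    exp(-u). *)
Definition flat_deriv p : {poly R} := (p - p^`()) * 'X^2.

Lemma flat_fun_derive p t : is_derive t 1 (flat_fun p) (flat_fun (flat_deriv p) t).
Proof.
have [t0|t0|->] := ltgtP t 0.
- rewrite (flat_fun_le0 _ (ltW t0)).
  have d0 : is_derive t 1 (cst 0 : R -> R) 0 by exact: is_derive_cst.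
  apply: near_eq_is_derive d0.
  by near=> z; rewrite flat_fun_le0 // ltW //; near: z; exact: lt_nbhsl.
- apply: (@near_eq_is_derive _ _ _ (fun t => p.[t^-1] * expR (- t^-1))).
    near=> z; rewrite /flat_fun ifT //; near: z; exact: lt_nbhsr.
  have tn0 : t != 0 by rewrite gt_eqF.
  have dV : is_derive t 1 (fun y : R => y^-1) (- t ^- 2).
    by have := is_deriveV tn0 (is_derive_id t 1); rewrite /GRing.scale /= mulr1.
  have dp : is_derive t 1 (horner p \o (fun y : R => y^-1)) (p^`().[t^-1] * - t ^- 2).
    exact: is_derive1_comp.
  have de : is_derive t 1 (expR \o (fun y : R => - y^-1)) (expR (- t^-1) * t ^- 2).
    by apply: is_derive1_comp; have := is_deriveN dV; rewrite opprK.
  apply: (is_derive_eq (is_deriveM dp de)).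
  rewrite /flat_fun t0 /flat_deriv !hornerE ?hornerXn /GRing.scale /= -exprVn /=. ring.
(* At 0 the difference quotient of [flat_fun p] is [flat_fun ('X * p)], which tends to 0 by its
   linear bound. *)
- rewrite flat_fun_le0 //; have [C C0 Ch] := flat_fun_small ('X * p).
  have lim : (fun h : R => h^-1 *: ((flat_fun p \o shift 0) (h *: (1:R)) - flat_fun p 0))
      @ (0:R)^' --> (0 : R).
    apply/cvgrPdist_lt => e e0; near=> h.
    have h0 : h != 0 by near: h; exact: nbhs_dnbhs_neq.
    rewrite sub0r normrN /= addr0 [h *: 1]mulr1 (flat_fun_le0 p (lexx 0)) subr0.
    have -> : h^-1 *: flat_fun p h = flat_fun ('X * p) h.
      rewrite /flat_fun; case: ifP => _; rewrite ?scaler0 //.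
      by rewrite hornerM hornerX /GRing.scale /= mulrA.
    apply: le_lt_trans (Ch h) _.
    have hC : `|h| < e / (C + 1) by near: h; apply: dnbhs0_lt; rewrite divr_gt0 // ltr_wpDl.
    rewrite ltr_pdivlMr ?ltr_wpDl // in hC; apply: le_lt_trans hC.
    by rewrite mulrC ler_wpM2l // lerDl.
  apply: DeriveDef; first by apply/cvg_ex; exists 0; exact: lim.
  exact/cvg_lim.
Unshelve. all: by end_near. Qed.

Lemma flat_fun1_ge0 t : 0 <= flat_fun 1 t.
Proof. by rewrite /flat_fun hornerC mul1r; case: ifP => // _; exact: expR_ge0. Qed.

Lemma flat_fun1_gt0 t : 0 < t -> 0 < flat_fun 1 t.
Proof. by move=> t0; rewrite /flat_fun hornerC mul1r t0 expR_gt0. Qed.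

Lemma flat_fun1_le s t : s <= t -> flat_fun 1 s <= flat_fun 1 t.
Proof.
move=> st; rewrite /flat_fun !hornerC !mul1r; case: (ltP 0 s) => s0; last first.
  by case: ifP => // _; exact: expR_ge0.
by rewrite (lt_le_trans s0 st) ler_expR lerN2 lef_pV2 // posrE ?(lt_le_trans s0 st).
Qed.

(* With [h := flat_fun 1], the value [h (h 3 - h (|y|^2 - 1)) / h (h 3)] avoids the usual
   quotient of two non-constant functions. *)
Definition bump_row (n : nat) (y : 'rV[R]_n) : R :=
  (flat_fun 1 (flat_fun 1 3))^-1 *
  flat_fun 1 (flat_fun 1 3 - flat_fun 1 (\sum_i y 0 i ^+ 2 - 1)).

Lemma Ck_flat_fun n k (U : set 'rV[R]_n) p (f : 'rV[R]_n -> R) :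
  open U -> Ck k U f -> Ck k U (fun y => flat_fun p (f y)).
Proof. by move=> oU fU; exact: (Ck_comp_real p oU flat_fun_derive fU). Qed.

Lemma Cinf_bump_row n : Cinf setT (@bump_row n).
Proof.
move=> k; apply: (CkM openT (@Ck_cst _ _ _ _ (flat_fun 1 (flat_fun 1 3))^-1)).
apply: Ck_flat_fun; first exact: openT.
apply: (CkB openT (@Ck_cst _ _ _ _ _)).
apply: Ck_flat_fun; first exact: openT.
apply: (CkB openT _ (@Ck_cst _ _ _ _ _)).
apply: Ck_sum => [|i]; first exact: openT.
by apply: (CkM openT); exact: Ck_coord.
Qed.

Lemma bump_row_eq1 n (y : 'rV[R]_n) : \sum_i y 0 i ^+ 2 <= 1 -> bump_row y = 1.
Proof.
move=> y1; rewrite /bump_row (flat_fun_le0 _ (_ : \sum_i y 0 i ^+ 2 - 1 <= 0)) ?subr_le0 //.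
by rewrite subr0 mulVf // gt_eqF // !flat_fun1_gt0.
Qed.

Lemma bump_row_eq0 n (y : 'rV[R]_n) i : 2 <= `|y 0 i| -> bump_row y = 0.
Proof.
(* A coordinate of size at least 2 gives [|y|^2 - 1 >= 3]; this is the origin of the constant 3 in
   [bump_row]. *)
move=> y2; rewrite /bump_row (flat_fun_le0 1 (_ : _ - _ <= 0)) ?mulr0 //.
rewrite subr_le0 flat_fun1_le // (bigD1 i) //= -real_normK ?num_real //.
have : 0 <= \sum_(j < n | j != i) y 0 j ^+ 2 by apply: sumr_ge0 => j _; exact: sqr_ge0.
nra.
Qed.

Lemma bump_row_ge0 n (y : 'rV[R]_n) : 0 <= bump_row y.
Proof. by rewrite mulr_ge0 ?invr_ge0 ?flat_fun1_ge0. Qed.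

Lemma bump_row_le1 n (y : 'rV[R]_n) : bump_row y <= 1.
Proof.
rewrite /bump_row mulrC ler_pdivrMr ?flat_fun1_gt0 // mul1r flat_fun1_le //.
by rewrite gerBl flat_fun1_ge0.
Qed.

(** The open sets [|w| < 3] and [|w 0 j| > 2] cover the space, and the product vanishes on the
    latter. The values of [g] beyond norm 3 are therefore arbitrary. *)
Lemma Cinf_bump_mul n (g : 'rV[R]_n -> R) :
  Cinf [set w | `|w| < 3] g -> Cinf setT (fun w => bump_row w * g w).
Proof.
move=> sg k; apply: Ck_local => w _.
have [w3|] := pselect (forall j, `|w 0 j| < 3).
  have oB : open [set w : 'rV[R]_n | `|w| < 3].
    by apply: open_comp (@open_lt R 3) => x _; exact: norm_continuous.
  exists [set w | `|w| < 3]; first exact: norm_row_lt.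
  by apply: (CkM oB); [apply: Ck_subset (@Cinf_bump_row n k)|exact: sg].
move=> /existsNP[j /negP]; rewrite -leNgt => w3.
have oB : open [set w : 'rV[R]_n | 2 < `|w 0 j|].
  apply: (@open_comp _ _ (fun w : 'rV[R]_n => `|w 0 j|) [set x | 2 < x]); last exact: open_gt.
  by move=> x _; apply: continuous_comp; [exact: coord_continuous|exact: norm_continuous].
exists [set w : 'rV[R]_n | 2 < `|w 0 j|]; first by rewrite /= (lt_le_trans _ w3) // ltr_nat.
apply: (Ck_ext oB _ (@Ck_cst _ _ _ _ 0)) => z z2.
by rewrite (@bump_row_eq0 _ z j) ?mul0r // ltW.
Qed.

End FlatFunctions.

(** * Linear differential equations with smooth parameters *)

Section LinearODE.
Variable R : realType.

(** The bound [2 * C / 2 ^+ m] is the tail of the geometric series. The intervals of that radius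
    about [u m] are nested, and the supremum of their lower ends lies in all of them. *)
Lemma geometric_limit (u : nat -> R) (C : R) :
  (forall m, `|u m.+1 - u m| <= C / 2 ^+ m) ->
  exists l, forall m, `|l - u m| <= 2 * C / 2 ^+ m.
Proof.
move=> h; have p2 m : 0 < 2 ^+ m :> R by rewrite exprn_gt0.
have C0 : 0 <= C by have := h 0%N; rewrite expr0 divr1; apply: le_trans.
pose c m := 2 * C / 2 ^+ m.
have cS m : c m.+1 = c m - C / 2 ^+ m.
  by rewrite /c exprS; field; rewrite gt_eqF.
have c0 m : 0 <= c m by rewrite divr_ge0 ?mulr_ge0 // ltW.
have lo m : u m - c m <= u m.+1 - c m.+1.
  by have := h m; rewrite cS ler_norml => /andP[]; set q := C / _; lra.
have hi m : u m.+1 + c m.+1 <= u m + c m.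
  by have := h m; rewrite cS ler_norml => /andP[]; set q := C / _; lra.
have loM m k : u m - c m <= u (m + k)%N - c (m + k)%N.
  by elim: k => [|k IH]; rewrite ?addn0 // addnS (le_trans IH).
have hiM m k : u (m + k)%N + c (m + k)%N <= u m + c m.
  by elim: k => [|k IH]; rewrite ?addn0 // addnS (le_trans _ IH).
have lohi m k : u m - c m <= u k + c k.
  apply: (le_trans (loM m k)); apply: le_trans (hiM k m).
  by rewrite (addnC k) lerD2l; have := c0 (m + k)%N; lra.
exists (sup [set u m - c m | m in setT]) => m.
rewrite ler_norml -/(c m); apply/andP; split.
  rewrite lerBrDl; apply: sup_ubound; last by exists m.
  by exists (u 0%N + c 0%N) => _ [k _ <-].
rewrite lerBlDl; apply: ge_sup; first by exists (u 0%N - c 0%N); exists 0%N.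
by move=> _ [k _ <-].
Qed.

Lemma le_half_pow (x K c : R) : (forall m, x <= K / 2 ^+ m + c) -> x <= c.
Proof.
move=> h; rewrite leNgt; apply/negP => cx.
have d0 : 0 < x - c by rewrite subr_gt0.
pose m := Num.bound `|K / (x - c)|.
have := h m; rewrite leNgt => /negP; apply.
rewrite -ltrBrDr ltr_pdivrMr ?exprn_gt0 // mulrC -ltr_pdivrMr //.
apply: le_lt_trans (ler_norm _) _; rewrite (lt_trans (archi_boundP _)) // -natrX ltr_nat.
exact: ltn_expl.
Qed.

(** Reduces estimates over the whole line to [|t| <= 4]: further out, [p] keeps its value at 4 or at
    -4. *)
Lemma const_beyond (p q : R -> R) :
  (forall t : R, is_derive t 1 p (q t)) -> (forall t, 3 < `|t| -> q t = 0) ->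
  forall t, exists2 s, `|s| <= 4 & p t = p s.
Proof.
move=> dp q0 t; have cp (a b : R) : {within `[a, b], continuous p}.
  apply: continuous_subspaceT => c.
  by apply/differentiable_continuous/derivable1_diffP; case: (dp c).
have [t4|t4] := leP `|t| 4; first by exists t.
have [t0|t0] := leP 0 t.
- rewrite ger0_norm // in t4; exists 4; first by rewrite ger0_norm.
  have [c] := @MVT _ p q 4 t t4 (fun c _ => dp c) (cp _ _).
  rewrite in_itv /= => /andP[c4 _] /eqP.
  by rewrite q0 ?mul0r ?subr_eq0 => [/eqP//|]; rewrite ger0_norm; lra.
- rewrite ltr0_norm // ltrNr in t4; exists (- 4); first by rewrite normrN ger0_norm.
  have [c] := @MVT _ p q t (- 4) t4 (fun c _ => dp c) (cp _ _).
  rewrite in_itv /= => /andP[_ c4] /eqP.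
  by rewrite q0 ?mul0r ?subr_eq0 => [/eqP//|]; rewrite ltr0_norm; lra.
Qed.

Lemma primitive_bound (p q : R -> R) (T C : R) :
  p 0 = 0 -> (forall t : R, `|t| <= T -> is_derive t 1 p (q t)) ->
  (forall t, `|t| <= T -> `|q t| <= C) ->
  forall t, `|t| <= T -> `|p t| <= T * C.
Proof.
move=> p0 dp qC t tT.
have [|c ct] := @MVT_symmetric R p q t; first by move=> c ct; apply: dp; rewrite (le_trans ct).
rewrite p0 subr0 => ->; rewrite normrM mulrC ler_pM //.
by apply: qC; rewrite (le_trans ct).
Qed.

Section Stability.
Variables (r : nat) (T d : R).
Hypothesis (T4 : 0 <= T <= 4).
Hypothesis (rd : 16 * (r%:R * d) <= 1).

Lemma linear_system_bound (A : 'I_r -> 'I_r -> R) (E G : 'I_r -> R) (a : 'I_r) (K e : R) :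
  (forall a b, `|A a b| <= d) -> (forall b, `|E b| <= K) -> `|G a| <= e ->
  `|\sum_b A a b * E b + G a| <= r%:R * d * K + e.
Proof.
move=> Ad EK Ge; rewrite (le_trans (ler_normD _ _)) // lerD //.
rewrite (le_trans (ler_norm_sum _ _ _)) // (@le_trans _ _ (\sum_(b < r) d * K)) //.
  by apply: ler_sum => b _; rewrite normrM ler_pM.
by rewrite sumr_const card_ord mulr_natl -mulrnAl.
Qed.

(** A Gronwall estimate for short times and small coefficients. Inserting the bound
    [K / 2 ^+ m + 8 * e] in the equation and integrating over a time of at most 4, with
    [4 * r * d <= 1 / 4], yields the bound with [m.+1]. The a priori bound [K] only starts the
    iteration and is absent from the result; with [e = 0] this is uniqueness. *)
Lemma linear_ode_stability (A : 'I_r -> 'I_r -> R -> R) (E G : 'I_r -> R -> R) (K e : R) :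
  0 <= e ->
  (forall a, E a 0 = 0) ->
  (forall a (t : R), `|t| <= T -> is_derive t 1 (E a) (\sum_b A a b t * E b t + G a t)) ->
  (forall a b t, `|t| <= T -> `|A a b t| <= d) ->
  (forall a t, `|t| <= T -> `|G a t| <= e) ->
  (forall a t, `|t| <= T -> `|E a t| <= K) ->
  forall a t, `|t| <= T -> `|E a t| <= 8 * e.
Proof.
move=> e0 E0 dE Ad Ge EK a t tT; case/andP: T4 => T0 T4'.
have K0 : 0 <= K by apply: le_trans (EK a t tT).
have d0 : 0 <= d by apply: le_trans (Ad a a t tT).
have rd0 : 0 <= r%:R * d by rewrite mulr_ge0.
suff h m : forall a t, `|t| <= T -> `|E a t| <= K / 2 ^+ m + 8 * e.
  by apply: (@le_half_pow _ K) => m; exact: h.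
elim: m => [|m IH] b s sT.
  by rewrite expr0 divr1 (le_trans (EK b s sT)) // lerDl mulr_ge0.
have := primitive_bound (E0 b) (dE b)
  (fun t tT => @linear_system_bound _ _ (fun a => G a t) _ _ _
    (fun a b => Ad a b t tT) (fun c => IH c t tT) (Ge b t tT)) sT.
move=> /le_trans; apply.
have Km : 0 <= K / 2 ^+ m by rewrite divr_ge0 // exprn_ge0.
have -> : K / 2 ^+ m.+1 = K / 2 ^+ m / 2 by rewrite exprS invfM mulrA mulrAC.
move: Km (rd) rd0; set k := K / 2 ^+ m; set x := r%:R * d => k0 x1 x0.
apply: (@le_trans _ _ (4 * (x * (k + 8 * e) + e))).
  by apply: ler_wpM2r => //; rewrite addr_ge0 // mulr_ge0 // addr_ge0 // mulr_ge0.
have : 16 * x * (k + 8 * e) <= 1 * (k + 8 * e).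
  by apply: ler_wpM2r => //; rewrite addr_ge0 // mulr_ge0.
lra.
Qed.

End Stability.

(** Since [g] vanishes outside a segment it is integrable on the line, and integrating from minus
    infinity gives one formula for both signs of [t]; subtracting a constant normalizes it at 0. *)
Lemma primitive_exists (g : R -> R) :
  continuous g -> (forall t, 3 < `|t| -> g t = 0) ->
  exists2 G : R -> R, G 0 = 0 & forall t : R, is_derive t 1 G (g t).
Proof.
move=> cg g0; pose mu := @lebesgue_measure R.
have gE : EFin \o g = (EFin \o g) \_ `[(-4), 4].
  apply/funext => t; rewrite patchE; case: ifPn => // /negP; rewrite inE /= in_itv /= => h.
  rewrite g0 //; have [t0|t0] := leP 0 t; [rewrite ger0_norm|rewrite ltr0_norm] => //;
    rewrite ltNge; apply/negP => h'; apply: h; apply/andP; split; lra.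
have gi : mu.-integrable setT (EFin \o g).
  rewrite gE; apply/integrable_restrict => //; rewrite setTI.
  apply: continuous_compact_integrable; first exact: segment_compact.
  exact: continuous_subspaceT.
have giu (u : R) : mu.-integrable [set` `]-oo, u]] (EFin \o g).
  exact: integrableS gi.
pose F x := (\int[mu]_(t in [set` `]-oo, x]]) (g t))%R.
have dF (t : R) : is_derive t 1 F (g t).
  have [] := @continuous_FTC1 R g -oo%O t (t + 1) _ (giu _) _ (cg t).
  - by rewrite ltrDl.
  - by rewrite /Order.lt /=.
  by rewrite -[fun x => _]/F derive1E => h1 h2; exact: DeriveDef h1 h2.
exists (F - cst (F 0)); first by rewrite !fctE subrr.
by move=> t; have := is_deriveB (dF t) (is_derive_cst (F 0) t 1); rewrite subr0.
Qed.

End LinearODE.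

(** * Functions with bounded, uniformly continuous derivatives *)

Section BoundedUniform.
Variables (R : realType) (n : nat).
Implicit Types (f g : 'rV[R]_n -> R) (k : nat).

Definition bounded_fct f := exists C : R, forall w, `|f w| <= C.

Definition ucont_fct f := forall e : R, 0 < e ->
  exists2 d : R, 0 < d & forall z w, `|z - w| < d -> `|f z - f w| < e.

(** Boundedness gives finite sup norms, where Picard iteration contracts; uniform continuity makes
    difference quotients converge in the sup norm, as the differentiation of solutions in a
    parameter requires. *)
Fixpoint BUC k f : Prop :=
  [/\ bounded_fct f, ucont_fct f &
  if k is k'.+1 then
    forall i : 'I_n, (forall y, derivable f y (delta_mx 0 i)) /\
                     BUC k' (fun y => 'D_(delta_mx 0 i) f y)
  else True].

Lemma BUC_bounded k f : BUC k f -> bounded_fct f.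
Proof. by case: k => [|k] []. Qed.

Lemma BUC_ucont k f : BUC k f -> ucont_fct f.
Proof. by case: k => [|k] []. Qed.

Lemma BUC0 k f : BUC k f -> BUC 0 f.
Proof. by move=> fk; split=> //; [exact: BUC_bounded fk|exact: BUC_ucont fk]. Qed.

Lemma bounded_fct_gt0 f : bounded_fct f -> exists2 C : R, 0 < C & forall w, `|f w| <= C.
Proof.
move=> [C fC]; exists (C + 1) => [|w]; last by rewrite (le_trans (fC w)) // lerDl.
by rewrite ltr_pwDr // (le_trans _ (fC 0)).
Qed.

Lemma ucont_continuous f : ucont_fct f -> continuous f.
Proof.
move=> fu y; apply: continuous_dist => e e0; have [d d0 fd] := fu e e0.
by apply: filterS (near_dist_lt y d0) => z zy; rewrite distrC; exact: fd.
Qed.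

Lemma BUC_Ck k f : BUC k f -> Ck k setT f.
Proof.
elim: k f => [|k IH] f [_ fu df]; split=> //; try by move=> y _; exact: ucont_continuous.
by move=> i; have [d1 d2] := df i; split=> //; exact: IH.
Qed.

Lemma BUCS k f : BUC k.+1 f -> BUC k f.
Proof.
elim: k f => [|k IH] f; first by case.
by case=> bf cf df; split=> // i; case: (df i) => d1 d2; split=> //; exact: IH.
Qed.

Lemma ucontD f g : ucont_fct f -> ucont_fct g -> ucont_fct (f + g).
Proof.
move=> fu gu e e0; have e2 : 0 < e / 2 by rewrite divr_gt0.
have [d d0 fd] := fu _ e2; have [d' d'0 gd] := gu _ e2.
exists (Num.min d d'); first by rewrite lt_min d0.
move=> z w; rewrite lt_min => /andP[/fd h /gd h'].
by rewrite !fctE opprD addrACA (le_lt_trans (ler_normD _ _)) // (splitr e) ltrD.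
Qed.

Lemma ucontM f g : bounded_fct f -> bounded_fct g ->
  ucont_fct f -> ucont_fct g -> ucont_fct (f * g).
Proof.
move=> /bounded_fct_gt0[C C0 fC] /bounded_fct_gt0[D D0 gD] fu gu e e0.
have [d d0 fd] := fu (e / (2 * D)) (divr_gt0 e0 (mulr_gt0 (ltr0Sn R 1) D0)).
have [d' d'0 gd] := gu (e / (2 * C)) (divr_gt0 e0 (mulr_gt0 (ltr0Sn R 1) C0)).
exists (Num.min d d'); first by rewrite lt_min d0.
move=> z w; rewrite lt_min => /andP[/fd h /gd h']; rewrite !fctE.
have -> : f z * g z - f w * g w = f z * (g z - g w) + (f z - f w) * g w by ring.
rewrite (le_lt_trans (ler_normD _ _)) // (splitr e) ltr_leD //.
  have -> : e / 2 = C * (e / (2 * C)) by field; rewrite gt_eqF.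
  rewrite normrM; apply: le_lt_trans (ler_wpM2r _ (fC z)) _ => //.
  by rewrite ltr_pM2l.
have -> : e / 2 = e / (2 * D) * D by field; rewrite gt_eqF.
by rewrite normrM ler_pM // ltW.
Qed.

Lemma boundedD f g : bounded_fct f -> bounded_fct g -> bounded_fct (f + g).
Proof.
move=> [C fC] [D gD]; exists (C + D) => w.
by rewrite (le_trans (ler_normD _ _)) // lerD.
Qed.

Lemma boundedM f g : bounded_fct f -> bounded_fct g -> bounded_fct (f * g).
Proof. by move=> [C fC] [D gD]; exists (C * D) => w; rewrite normrM ler_pM. Qed.

Lemma BUC_cst k (a : R) : BUC k (fun=> a).
Proof.
elim: k a => [|k IH] a; split=> //; try by [exists `|a|];
  try by move=> e e0; exists 1 => // z w _; rewrite subrr normr0.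
move=> i; split; first by move=> y; exact: derivable_cst.
have -> : (fun y : 'rV[R]_n => 'D_(delta_mx 0 i) (fun=> a) y) = fun=> 0 :> R.
  by apply/funext => y; rewrite derive_cst.
exact: IH.
Qed.

Lemma BUCD k f g : BUC k f -> BUC k g -> BUC k (f + g).
Proof.
elim: k f g => [|k IH] f g [bf uf df] [bg ug dg];
  (split=> //; try by [exact: boundedD|exact: ucontD]).
move=> i; have [df1 df2] := df i; have [dg1 dg2] := dg i; split.
  by move=> y; apply: derivableD; [exact: df1|exact: dg1].
have -> : (fun y => 'D_(delta_mx 0 i) (f + g) y) =
    (fun y => 'D_(delta_mx 0 i) f y) + (fun y => 'D_(delta_mx 0 i) g y).
  by apply/funext => y; rewrite deriveD; [|exact: df1|exact: dg1].
exact: IH.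
Qed.

Lemma BUCM k f g : BUC k f -> BUC k g -> BUC k (f * g).
Proof.
elim: k f g => [|k IH] f g fk gk; have [bf uf df] := fk; have [bg ug dg] := gk;
  (split=> //; try by [exact: boundedM|exact: ucontM]).
move=> i; have [df1 df2] := df i; have [dg1 dg2] := dg i; split.
  by move=> y; apply: derivableM; [exact: df1|exact: dg1].
have -> : (fun y => 'D_(delta_mx 0 i) (f * g) y) =
    f * (fun y => 'D_(delta_mx 0 i) g y) + g * (fun y => 'D_(delta_mx 0 i) f y).
  by apply/funext => y; rewrite deriveM; [|exact: df1|exact: dg1].
by apply: BUCD; apply: IH => //; exact: BUCS.
Qed.

Lemma BUC_sum k (I : Type) (r : seq I) (f : I -> 'rV[R]_n -> R) :
  (forall i, BUC k (f i)) -> BUC k (fun y => \sum_(i <- r) f i y).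
Proof.
move=> fk; elim: r => [|i r IH].
  by under eq_fun do rewrite big_nil; exact: BUC_cst.
under eq_fun do rewrite big_cons.
by have := BUCD (fk i) IH.
Qed.

Lemma derive_bound_dist f (i : 'I_n) (K : R) (y : 'rV[R]_n) (s : R) :
  (forall w, derivable f w (delta_mx 0 i)) ->
  (forall w, `|'D_(delta_mx 0 i) f w| <= K) ->
  `|f (s *: delta_mx 0 i + y) - f y| <= K * `|s|.
Proof.
move=> df fK.
have [|c _] := @MVT_symmetric R (fun t : R => f (t *: delta_mx 0 i + y))
   (fun t => 'D_(delta_mx 0 i) f (t *: delta_mx 0 i + y)) s.
  by move=> c _; apply: is_derive_line; exact: derivableP.
by rewrite scale0r add0r => ->; rewrite normrM ler_wpM2r.
Qed.

Lemma ucont_bounded_derive f :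
  (forall i y, derivable f y (delta_mx 0 i)) ->
  (forall i, bounded_fct (fun y => 'D_(delta_mx 0 i) f y)) -> ucont_fct f.
Proof.
move=> df bf.
have /choice[C fC] : forall i, exists C : R, 0 < C /\
    forall w, `|'D_(delta_mx 0 i) f w| <= C.
  by move=> i; have [C C0 h] := bounded_fct_gt0 (bf i); exists C.
have K0 : 0 < 1 + \sum_i C i by rewrite ltr_pwDl // sumr_ge0 // => i _; case: (fC i) => /ltW.
move=> e e0; exists (e / (1 + \sum_i C i)) => [|z w zw]; first exact: divr_gt0.
rewrite ltr_pdivlMr // in zw; apply: le_lt_trans zw.
rewrite (row_mix_telescope f w z) (le_trans (ler_norm_sum _ _ _)) //.
apply: (@le_trans _ _ (\sum_i C i * `|z - w|)).
  apply: ler_sum => i _; rewrite row_mixS.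
  have := derive_bound_dist (row_mix w z i) (z 0 i - w 0 i) (df i) (fC i).2.
  move=> /le_trans; apply; rewrite ler_pM2l; last by case: (fC i).
  by have := abs_coord_le (z - w) i; rewrite !mxE.
by rewrite -mulr_suml mulrC ler_wpM2l // lerDr.
Qed.

Lemma bounded_compact_support f (rho : R) : 0 <= rho -> continuous f ->
  (forall (w : 'rV[R]_n) j, rho < `|w 0 j| -> f w = 0) -> bounded_fct f.
Proof.
move=> rho0 cf f0.
have cK : compact [set w : 'rV[R]_n | forall j, w 0 j \in `[(- rho), rho]].
  by apply: (@rV_compact _ _ (fun=> `[(- rho), rho]%classic)) => j; exact: segment_compact.
have /compact_bounded[M [_ fM]] :
    compact (f @` [set w : 'rV[R]_n | forall j, w 0 j \in `[(- rho), rho]]).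
  by apply: continuous_compact cK; exact: continuous_subspaceT.
exists (`|M| + 1) => w; have [h|] := pselect (forall j, `|w 0 j| <= rho).
  apply: (fM (`|M| + 1)); first by rewrite ltr_pwDr // ler_norm.
  by exists w => // j; rewrite /= in_itv /= -ler_norml.
by move=> /existsNP[j /negP]; rewrite -ltNge => /f0 ->; rewrite normr0 addr_ge0.
Qed.

Lemma derive_support f (i : 'I_n) (rho : R) (j : 'I_n) :
  (forall (w : 'rV[R]_n), rho < `|w 0 j| -> f w = 0) ->
  forall (w : 'rV[R]_n), rho < `|w 0 j| -> 'D_(delta_mx 0 i) f w = 0.
Proof.
move=> f0 w rw; rewrite (@near_eq_derive _ _ _ f (cst 0)); first exact: derive_cst.
have d0 : 0 < `|w 0 j| - rho by rewrite subr_gt0.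
apply: filterS (near_dist_lt w d0) => z zw; rewrite f0 //.
have := abs_coord_le (z - w) j; rewrite !mxE => /le_lt_trans/(_ zw).
by have := ler_normB (z 0 j) (z 0 j - w 0 j); rewrite subKr; lra.
Qed.

Lemma Cinf_compact_support k f (rho : R) : 0 <= rho -> Cinf setT f ->
  (forall (w : 'rV[R]_n) j, rho < `|w 0 j| -> f w = 0) -> BUC k f.
Proof.
move=> rho0; have main m g : Ck m.+1 setT g ->
    (forall (w : 'rV[R]_n) j, rho < `|w 0 j| -> g w = 0) -> BUC m g.
  elim: m g => [|m IH] g gC g0; have := gC => -[cg dg].
    have cg' : continuous g by move=> y; exact: cg.
    split=> //; first exact: bounded_compact_support g0.
    apply: ucont_bounded_derive => i; have [d1 d2] := dg i; first by move=> y; exact: d1.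
    apply: (bounded_compact_support rho0) => [y|w j]; first exact: (d2.1).
    by apply: derive_support => {}w; exact: g0.
  have gm := IH g (CkS gC) g0.
  split; [exact: BUC_bounded gm|exact: BUC_ucont gm|move=> i].
  have [d1 d2] := dg i; split=> [y|]; first exact: d1.
  by apply: IH => // w j; apply: derive_support => {}w; exact: g0.
by move=> fi; apply: main; exact: fi.
Qed.

End BoundedUniform.

(** * Linear systems in one time direction: existence and stability *)

Section ParametricODE.
Variables (R : realType) (n : nat) (i0 : 'I_n).
Local Notation e0 := (delta_mx 0 i0 : 'rV[R]_n).
Implicit Types (f g P : 'rV[R]_n -> R) (w z : 'rV[R]_n).

(* The coefficients are cut off for [|t| > 3], where solutions are then constant in [t]:
   Picard iteration contracts for the sup norm over all of ['rV_n]. *)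
Definition time_support f := forall w, 3 < `|w 0 i0| -> f w = 0.

Lemma is_derive_from_line (V : normedModType R) (P : V -> R) (p : R -> R) (x v : V) (t df : R) :
  (forall h, P (h *: v + x) = p (h + t)) -> is_derive t 1 p df -> is_derive x v P df.
Proof.
move=> Pp [/cvg_ex[/= l pl] <-]; have dl : 'D_1 p t = l by exact/cvg_lim.
have e : (fun h : R => h^-1 *: ((P \o shift x) (h *: v) - P x)) =
    (fun h : R => h^-1 *: ((p \o shift t) (h *: (1 : R)) - p t)).
  apply/funext => h /=; rewrite [h *: 1]mulr1 Pp; congr (_ *: (_ - _)).
  by have := Pp 0; rewrite scale0r !add0r.
apply: DeriveDef; first by apply/cvg_ex; exists l; rewrite e.
by rewrite /derive e.
Qed.

(** The projection along [e0] onto the hyperplane of time 0. It is constant on each line in the time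
    direction and serves as the name of that line. *)
Definition time0 w : 'rV[R]_n := - w 0 i0 *: e0 + w.

Lemma time0K w : w 0 i0 *: e0 + time0 w = w.
Proof. by rewrite addrA -scalerDl subrr scale0r add0r. Qed.

Lemma time_line (t : R) w : (t *: e0 + w) 0 i0 = t + w 0 i0.
Proof. by rewrite !mxE !eqxx mulr1. Qed.

Lemma time_time0 w : time0 w 0 i0 = 0.
Proof. by rewrite time_line addNr. Qed.

Lemma time0_line (t : R) w : time0 (t *: e0 + w) = time0 w.
Proof.
rewrite /time0 time_line addrA -scalerDl; congr (_ *: _ + _).
by rewrite opprD addrAC addNr add0r.
Qed.

Lemma time0_dist z w : `|time0 z - time0 w| <= `|z - w|.
Proof.
apply: norm_row_le => // j; rewrite !mxE eqxx /=.
have zw : `|z 0 j - w 0 j| <= `|z - w| by have := abs_coord_le (z - w) j; rewrite !mxE.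
case: eqVneq => [ji|_] /=; last by rewrite !mulr0 !add0r.
by subst j; rewrite !mulr1 !addNr subrr normr0.
Qed.

Lemma primitive_bound_line (p q : R -> R) (C : R) :
  p 0 = 0 -> (forall t : R, is_derive t 1 p (q t)) -> (forall t, 3 < `|t| -> q t = 0) ->
  (forall t, `|q t| <= C) -> forall t, `|p t| <= 4 * C.
Proof.
move=> p0 dp q0 qC t; have [s s4 ->] := const_beyond dp q0 t.
by apply: (@primitive_bound _ p q 4 C) => // u _; exact: qC.
Qed.

Lemma time_primitive_bound P g (C : R) :
  (forall w, w 0 i0 = 0 -> P w = 0) -> (forall w, is_derive w e0 P (g w)) ->
  time_support g -> (forall w, `|g w| <= C) -> forall w, `|P w| <= 4 * C.
Proof.
move=> P0 dP g0 gC w; rewrite -(time0K w).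
apply: (@primitive_bound_line (fun t => P (t *: e0 + time0 w)) (fun t => g (t *: e0 + time0 w))).
- by rewrite P0 // time_line time_time0 addr0.
- by move=> t; exact: is_derive_line.
- by move=> t t3; apply: g0; rewrite time_line time_time0 addr0.
- by move=> t; exact: gC.
Qed.

Lemma time_primitive_exists g : continuous g -> time_support g ->
  exists P, (forall w, w 0 i0 = 0 -> P w = 0) /\ forall w, is_derive w e0 P (g w).
Proof.
move=> cg g0.
have /choice[G GP] : forall w, exists G : R -> R, G 0 = 0 /\
    forall t : R, is_derive t 1 G (g (t *: e0 + time0 w)).
  move=> w; have [|t t3|G G0 dG] := @primitive_exists R (fun t => g (t *: e0 + time0 w)).
  - move=> t; apply: (@continuous_comp _ _ _ (fun t : R => t *: e0 + time0 w)); last exact: cg.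
    by apply: cvgD; [apply: cvgZr_tmp|]; [exact: cvg_id|exact: cvg_cst].
  - by apply: g0; rewrite time_line time_time0 addr0.
  by exists G.
(* Taking [G] at [time0 w] makes all points of a line share one chosen primitive. *)
exists (fun w => G (time0 w) (w 0 i0)); split=> [w w0|w].
  by rewrite w0; case: (GP (time0 w)).
apply: (@is_derive_from_line _ _ (G (time0 w)) _ _ (w 0 i0)).
  by move=> h; rewrite time0_line time_line.
have -> : g w = g (w 0 i0 *: e0 + time0 (time0 w)) by rewrite {2}/time0 time0_line time0K.
by case: (GP (time0 w)).
Qed.

Lemma time_primitive_BUC P g :
  (forall w, w 0 i0 = 0 -> P w = 0) -> (forall w, is_derive w e0 P (g w)) ->
  time_support g -> BUC 0 g -> BUC 0 P.
Proof.
move=> P0 dP g0 [/bounded_fct_gt0[C C0 gC] ug _].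
split=> //; first by exists (4 * C); exact: time_primitive_bound dP g0 gC.
move=> e e_gt0; have [d d0 gd] := ug (e / 8) (divr_gt0 e_gt0 (ltr0Sn R 7)).
exists (Num.min d (e / (4 * C))); first by rewrite lt_min d0 divr_gt0 // mulr_gt0.
move=> z w; rewrite lt_min => /andP[zwd zwC].
(* The passage from [z] to [w] first changes the line at fixed time, where the difference of the two
   primitives is estimated, and then the time on a fixed line, where [P] is Lipschitz with constant
   [C]. The costs are [e / 2] and less than [e / 4]. *)
have h1 : `|P (z 0 i0 *: e0 + time0 z) - P (z 0 i0 *: e0 + time0 w)| <= 4 * (e / 8).
  apply: (@primitive_bound_line (fun t => P (t *: e0 + time0 z) - P (t *: e0 + time0 w))
    (fun t => g (t *: e0 + time0 z) - g (t *: e0 + time0 w))).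
  - by rewrite !P0 ?subrr // time_line time_time0 addr0.
  - by move=> t; apply: (is_deriveB (is_derive_line _) (is_derive_line _)).
  - by move=> t t3; rewrite !g0 ?subrr // time_line time_time0 addr0.
  - move=> t; apply/ltW/gd; apply: le_lt_trans zwd.
    by rewrite opprD addrACA subrr add0r time0_dist.
have h2 : `|P (z 0 i0 *: e0 + time0 w) - P w| <= C * `|z 0 i0 - w 0 i0|.
  have -> : z 0 i0 *: e0 + time0 w = (z 0 i0 - w 0 i0) *: e0 + w.
    by rewrite /time0 addrA -scalerDl.
  apply: derive_bound_dist => v; first by case: (dP v).
  by case: (dP v) => _ ->.
have h3 : C * `|z 0 i0 - w 0 i0| < e / 4.
  have -> : e / 4 = C * (e / (4 * C)) by field; rewrite gt_eqF.
  rewrite ltr_pM2l //; apply: le_lt_trans zwC.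
  by have := abs_coord_le (z - w) i0; rewrite !mxE.
rewrite time0K in h1.
by have := ler_distD (P (z 0 i0 *: e0 + time0 w)) (P z) (P w); lra.
Qed.

Section System.
Variables (r : nat) (d : R).
Hypothesis rd : 16 * (r%:R * d) <= 1.
Implicit Types (A : 'I_r -> 'I_r -> 'rV[R]_n -> R) (E F G B : 'I_r -> 'rV[R]_n -> R).

(** Solutions start at 0, so that bounds on the source control them. The initial value 1 of a
    fundamental matrix is moved into the source: the matrix is 1 + F where F has source [A]. *)
Definition time_solution A B F := (forall a w, w 0 i0 = 0 -> F a w = 0) /\
  forall a w, is_derive w e0 (F a) (\sum_b A a b w * F b w + B a w).

(** Where [A] and the source [G] vanish, [E] is constant in time, so the estimate on [|t| <= 4]
    holds everywhere. *)
Lemma time_stability A E G (K e : R) :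
  (forall a b, time_support (A a b)) -> (forall a b w, `|A a b w| <= d) ->
  (forall a, time_support (G a)) -> 0 <= e -> (forall a w, `|G a w| <= e) ->
  (forall a w, `|E a w| <= K) -> time_solution A G E ->
  forall a w, `|E a w| <= 8 * e.
Proof.
move=> A0 Ad G0 e_ge0 Ge EK [E0 dE] a w; rewrite -(time0K w).
have dl b (t : R) : is_derive t 1 (fun t => E b (t *: e0 + time0 w))
   (\sum_c A b c (t *: e0 + time0 w) * E c (t *: e0 + time0 w) + G b (t *: e0 + time0 w)).
  exact: is_derive_line.
have [t t3|s s4 ->] := const_beyond (dl a) _ (w 0 i0).
  have t3' : 3 < `|(t *: e0 + time0 w) 0 i0| by rewrite time_line time_time0 addr0.
  by rewrite (G0 _ _ t3') addr0 big1 // => c _; rewrite (A0 _ _ _ t3') mul0r.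
apply: (@linear_ode_stability _ r 4 d _ rd (fun a b t => A a b (t *: e0 + time0 w))
  (fun b t => E b (t *: e0 + time0 w)) (fun b t => G b (t *: e0 + time0 w)) K) => //.
- by rewrite lexx ler0n.
- by move=> b; rewrite E0 // time_line time_time0 addr0.
Qed.

Lemma ucont_uniform_limit f :
  (forall e : R, 0 < e -> exists2 g, ucont_fct g & forall w, `|f w - g w| <= e) ->
  ucont_fct f.
Proof.
move=> h e e_gt0; have [g gu fg] := h (e / 4) (divr_gt0 e_gt0 (ltr0Sn R 3)).
have [d' d'0 gd] := gu (e / 4) (divr_gt0 e_gt0 (ltr0Sn R 3)).
exists d' => // z w /gd; have := fg z; have := fg w; rewrite (distrC (f w)).
by have := ler_distD (g z) (f z) (f w); have := ler_distD (g w) (g z) (f w); lra.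
Qed.

Lemma time_solution_exists A B :
  (forall a b, BUC 0 (A a b)) -> (forall a b, time_support (A a b)) ->
  (forall a b w, `|A a b w| <= d) ->
  (forall a, BUC 0 (B a)) -> (forall a, time_support (B a)) ->
  exists F, (forall a, BUC 0 (F a)) /\ time_solution A B F.
Proof.
move=> Ak A0 Ad Bk B0.
pose rhs F a := (fun w => \sum_b A a b w * F b w) + B a.
have rhs0 F a : time_support (rhs F a).
  by move=> w w3; rewrite /rhs !fctE B0 // big1 ?addr0 // => b _; rewrite A0 ?mul0r.
(* The Picard operator. Nothing is asked of [T F] when [F] is not [BUC 0]; the iteration never
   leaves that class. *)
have /choice[T TP] : forall F, exists F', (forall a, BUC 0 (F a)) ->
    forall a, [/\ BUC 0 (F' a), forall w, w 0 i0 = 0 -> F' a w = 0 &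
                  forall w, is_derive w e0 (F' a) (rhs F a w)].
  move=> F; have [Fk|] := pselect (forall a, BUC 0 (F a)); last by exists F.
  have rk a : BUC 0 (rhs F a).
    by apply: BUCD => //; apply: BUC_sum => b; exact: BUCM.
  have /choice[F' F'P] : forall a, exists P, (forall w, w 0 i0 = 0 -> P w = 0) /\
      forall w, is_derive w e0 P (rhs F a w).
    by move=> a; apply: time_primitive_exists => //; exact: ucont_continuous (BUC_ucont (rk a)).
  exists F' => _ a; have [F'0 dF'] := F'P a; split=> //.
  exact: time_primitive_BUC dF' _ (rk a).
pose S m := iter m T (fun _ _ => 0).
have Sk m a : BUC 0 (S m a).
  by elim: m a => [|m IH] a; [exact: BUC_cst|case: (TP (S m) IH a)].
have /choice[b bP] : forall a, exists b : R, forall w, `|B a w| <= b.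
  by move=> a; exact: BUC_bounded (Bk a).
pose Cb : R := \sum_a `|b a|; pose C := 4 * Cb.
have BC a w : `|B a w| <= Cb.
  rewrite (le_trans (bP a w)) // (le_trans (ler_norm _)) // /Cb (bigD1 a) //= lerDl.
  by apply: sumr_ge0.
have Cb0 : 0 <= Cb by apply: sumr_ge0.
have C0 : 0 <= C by rewrite mulr_ge0.
(* Integration costs 4 and the coefficients contribute [r * d], so the factor is even 1/4; 1/2
   matches [geometric_limit]. *)
have contr F F' (K : R) a w : (forall a, BUC 0 (F a)) -> (forall a, BUC 0 (F' a)) ->
    (forall a w, `|F a w - F' a w| <= K) -> `|T F a w - T F' a w| <= K / 2.
  move=> Fk F'k FK; have K0 : 0 <= K := le_trans (normr_ge0 _) (FK a w).
  have d0 : 0 <= d := le_trans (normr_ge0 _) (Ad a a w).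
  have [_ z1 d1] := TP _ Fk a; have [_ z2 d2] := TP _ F'k a.
  apply: (@le_trans _ _ (4 * (r%:R * d * K + 0))).
    apply: (@time_primitive_bound (T F a - T F' a) (rhs F a - rhs F' a)).
    - by move=> {}w w0; rewrite !fctE z1 // z2 // subrr.
    - by move=> {}w w3; rewrite !fctE !rhs0 // subrr.
    - move=> {}w; rewrite /rhs !fctE opprD addrACA subrr -sumrB.
      under eq_bigr do rewrite -mulrBr.
      apply: (@linear_system_bound R r d (fun a b => A a b w) (fun b => F b w - F' b w)
        (fun=> 0)) => //.
      by rewrite normr0.
  rewrite addr0; have : 16 * (r%:R * d) * K <= 1 * K by apply: ler_wpM2r.
  lra.
have step m a w : `|S m.+1 a w - S m a w| <= C / 2 ^+ m.
  elim: m a w => [|m IH] a w.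
    rewrite /= subr0 expr0 divr1; have [_ z1 d1] := TP _ (Sk 0%N) a.
    apply: (@time_primitive_bound _ _ Cb z1 d1 (rhs0 _ _)) => {}w.
    by rewrite /rhs !fctE big1 ?add0r // => c _; rewrite mulr0.
  by rewrite exprSr invfM mulrA; exact: (contr _ _ _ a w (Sk m.+1) (Sk m) IH).
have /choice[F0 F0P] : forall aw : 'I_r * 'rV[R]_n, exists l, forall m,
    `|l - S m aw.1 aw.2| <= 2 * C / 2 ^+ m.
  by move=> [a w]; apply: geometric_limit => m; exact: step.
pose F a w := F0 (a, w).
have FS a w m : `|F a w - S m a w| <= 2 * C / 2 ^+ m by exact: (F0P (a, w)).
have Fk a : BUC 0 (F a).
  split=> //.
    by exists (2 * C) => w; have := FS a w 0%N; rewrite subr0 expr0 divr1.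
  apply: ucont_uniform_limit => e e_gt0.
  have [m mP] : exists m, 2 * C / 2 ^+ m <= e.
    apply: contrapT => /forallNP h; have : e <= 0; last by rewrite leNgt e_gt0.
    apply: (@le_half_pow _ _ (2 * C)) => m; rewrite addr0; apply: ltW.
    by rewrite ltNge; apply/negP; exact: h.
  exists (S m a); first exact: BUC_ucont (Sk m a).
  by move=> w; exact: le_trans (FS a w m) mP.
suff TF a w : T F a w = F a w.
  exists F; split=> //; split=> a w; have [_ z1 d1] := TP _ Fk a.
    by rewrite -TF; exact: z1.
  by have := d1 w; have -> : T F a = F a by apply/funext => {}w; exact: TF.
(* The limit is a fixed point of [T]: by the contraction [T F] is as close to [S m.+1] as [F] is. *)
apply/eqP; rewrite -subr_eq0 -normr_le0; apply: (@le_half_pow _ _ (2 * (2 * C))) => m.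
have h1 : `|T F a w - S m.+1 a w| <= 2 * C / 2 ^+ m / 2.
  exact: (contr _ _ _ a w Fk (Sk m) (fun a w => FS a w m)).
have h2 := FS a w m.+1; rewrite addr0.
have := ler_distD (S m.+1 a w) (T F a w) (F a w); rewrite (distrC (S m.+1 a w)).
have e1 : 2 * C / 2 ^+ m.+1 = 2 * C / 2 ^+ m / 2 by rewrite exprSr invfM mulrA.
have e2 : 2 * (2 * C) / 2 ^+ m = 2 * (2 * C / 2 ^+ m) by rewrite -!mulrA.
have p0 : 0 <= 2 * C / 2 ^+ m by rewrite divr_ge0 ?mulr_ge0 // exprn_ge0.
rewrite e2; rewrite e1 in h2; move: h1 h2 p0; set q := 2 * C / 2 ^+ m; lra.
Qed.

End System.
End ParametricODE.

(** * Smooth dependence on the parameters *)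

Section ParametricODERegularity.
Variables (R : realType) (n : nat) (i0 : 'I_n).
Local Notation e0 := (delta_mx 0 i0 : 'rV[R]_n).
Local Notation time_support := (@time_support R n i0).
Implicit Types (f g : 'rV[R]_n -> R) (w : 'rV[R]_n).

Lemma is_derive_translate f (c w v : 'rV[R]_n) (df : R) :
  is_derive (c + w) v f df -> is_derive w v (fun z => f (c + z)) df.
Proof.
move=> dfv; apply: (@is_derive_from_line _ _ _ (fun t => f (t *: v + (c + w))) _ _ 0).
  by move=> h; rewrite addr0 addrCA.
by apply: is_derive_line; rewrite scale0r add0r.
Qed.

Lemma norm_scale_delta (j : 'I_n) (h : R) : `|h *: (delta_mx 0 j : 'rV[R]_n)| <= `|h|.
Proof. by rewrite normrZ ler_piMr // norm_delta_le1. Qed.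

Lemma ucont_shift f (j : 'I_n) (e : R) : ucont_fct f -> 0 < e ->
  \forall h \near (0 : R)^', forall w, `|f (h *: delta_mx 0 j + w) - f w| <= e.
Proof.
move=> fu e_gt0; have [d d0 fd] := fu e e_gt0; near=> h => w; apply/ltW/fd.
rewrite addrK (le_lt_trans (norm_scale_delta j h)) //.
by near: h; exact: dnbhs0_lt.
Unshelve. all: by end_near. Qed.

(** By the mean value theorem the quotient is the derivative at a point within [|h|] of [w]; the
    uniform continuity of the derivative makes the estimate uniform in [w]. *)
Lemma uniform_quotient f (j : 'I_n) (e : R) : BUC 1 f -> 0 < e ->
  \forall h \near (0 : R)^', forall w,
    `|h^-1 * (f (h *: delta_mx 0 j + w) - f w) - 'D_(delta_mx 0 j) f w| <= e.
Proof.
move=> [_ _ df] e_gt0; have [df1 [_ df2 _]] := df j.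
have [d d0 fd] := df2 e e_gt0; near=> h => w.
have h0 : h != 0 by near: h; exact: nbhs_dnbhs_neq.
have [|c ch] := @MVT_symmetric R (fun t : R => f (t *: delta_mx 0 j + w))
   (fun t => 'D_(delta_mx 0 j) f (t *: delta_mx 0 j + w)) h.
  by move=> c _; apply: is_derive_line; exact: derivableP.
rewrite scale0r add0r => ->; rewrite mulrC mulfK //; apply/ltW/fd.
rewrite addrK (le_lt_trans (norm_scale_delta j c)) // (le_lt_trans ch) //.
by near: h; exact: dnbhs0_lt.
Unshelve. all: by end_near. Qed.

Section System.
Variables (r : nat) (d : R).
Hypothesis rd : 16 * (r%:R * d) <= 1.
Variable A : 'I_r -> 'I_r -> 'rV[R]_n -> R.
Hypotheses (Ak : forall k a b, BUC k (A a b)) (A0 : forall a b, time_support (A a b))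
  (Ad : forall a b w, `|A a b w| <= d).
Implicit Types (F G B : 'I_r -> 'rV[R]_n -> R).

(* The difference quotients of [F] minus [G] solve the same linear equation with a source
   term that tends uniformly to 0. *)
Lemma time_solution_derive (j : 'I_n) B F G : j != i0 ->
  (forall a, BUC 1 (B a)) -> (forall a, time_support (B a)) ->
  (forall a, BUC 0 (F a)) -> time_solution i0 A B F ->
  (forall a, BUC 0 (G a)) -> time_solution i0 A
    (fun a w => \sum_b 'D_(delta_mx 0 j) (A a b) w * F b w + 'D_(delta_mx 0 j) (B a) w) G ->
  forall a w, is_derive w (delta_mx 0 j) (F a) (G a w).
Proof.
move=> ji Bk B0 Fk [F0 dF] Gk [G0 dG] a w.
set ej := delta_mx 0 j in dG *.
have tj (h : R) z : (h *: ej + z) 0 i0 = z 0 i0.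
  by rewrite !mxE eqxx /= eq_sym (negbTE ji) mulr0 add0r.
have /choice[bF bFP] : forall a, exists b : R, forall w, `|F a w| <= b.
  by move=> b; exact: BUC_bounded (Fk b).
have /choice[bG bGP] : forall a, exists b : R, forall w, `|G a w| <= b.
  by move=> b; exact: BUC_bounded (Gk b).
pose K : R := \sum_b (`|bF b| + `|bG b|).
have K0 : 0 <= K by apply: sumr_ge0 => b _; rewrite addr_ge0.
have FGK b z : `|F b z| + `|G b z| <= K.
  apply: (@le_trans _ _ (`|bF b| + `|bG b|)).
    by rewrite lerD // (le_trans (bFP b z), le_trans (bGP b z)) // ler_norm.
  by rewrite /K (bigD1 b) //= lerDl sumr_ge0 // => c _; rewrite addr_ge0.
have FK b z : `|F b z| <= K by apply: le_trans (FGK b z); rewrite lerDl.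
have GK b z : `|G b z| <= K by apply: le_trans (FGK b z); rewrite lerDr.
(* The stability factor 8 times the size of the source [Q] below in units of [e']: each of its [r]
   summands has two terms of size at most [K * e'], and the last term is at most [e']. *)
pose N : R := 8 * (r%:R * (2 * K) + 1).
have N0 : 0 < N by rewrite mulr_gt0 // ltr_wpDl // !mulr_ge0.
have lim : (fun h : R => h^-1 *: (F a (h *: ej + w) - F a w)) @ (0 : R)^' --> G a w.
  apply/cvgrPdist_le => e e_gt0; pose e' := e / N.
  have e'0 : 0 < e' by rewrite divr_gt0.
  have e'0' := ltW e'0.
  near=> h.
  have h0 : h != 0 by near: h; exact: nbhs_dnbhs_neq.
  have hA c b z : `|A c b (h *: ej + z) - A c b z| <= e'.
    move: c b z; near: h; apply: filter_forall => c; apply: filter_forall => b.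
    by apply: ucont_shift => //; exact: BUC_ucont (Ak 0 c b).
  have hA1 c b z : `|h^-1 * (A c b (h *: ej + z) - A c b z) - 'D_ej (A c b) z| <= e'.
    move: c b z; near: h; apply: filter_forall => c; apply: filter_forall => b.
    exact: uniform_quotient (Ak 1 c b) _.
  have hB c z : `|h^-1 * (B c (h *: ej + z) - B c z) - 'D_ej (B c) z| <= e'.
    move: c z; near: h; apply: filter_forall => c.
    exact: uniform_quotient (Bk c) _.
  pose Ah c b z := A c b (h *: ej + z).
  (* The error of the difference quotient. It solves the system with the shifted coefficients [Ah],
     because the quotient of a product [A * F] is [Ah] times the quotient of [F] plus the quotient
     of [A] times [F]; what is left over is [Q]. *)
  pose E c := h^-1 *: ((fun z => F c (h *: ej + z)) - F c) - G c.
  pose Q c z := (\sum_b ((A c b (h *: ej + z) - A c b z) * G b z +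
    (h^-1 * (A c b (h *: ej + z) - A c b z) - 'D_ej (A c b) z) * F b z)) +
    (h^-1 * (B c (h *: ej + z) - B c z) - 'D_ej (B c) z).
  have Esol : time_solution i0 Ah Q E.
    split=> c z.
      by move=> z0; rewrite /E !fctE !F0 ?tj // G0 // !subr0 scaler0.
    have dFh : is_derive z e0 (fun z => F c (h *: ej + z))
       (\sum_b A c b (h *: ej + z) * F b (h *: ej + z) + B c (h *: ej + z)).
      exact: is_derive_translate.
    apply: (is_derive_eq (is_deriveB (is_deriveZ h^-1 (is_deriveB dFh (dF c z))) (dG c z))).
    rewrite /Q [in RHS]addrA -[in RHS]big_split /= /Ah /E.
    rewrite [X in _ = X + _](_ : _ =
      h^-1 * (\sum_b A c b (h *: ej + z) * F b (h *: ej + z)) - h^-1 * (\sum_b A c b z * F b z)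
      - \sum_b A c b z * G b z - \sum_b 'D_ej (A c b) z * F b z); last first.
      rewrite !mulr_sumr -!sumrB; apply: eq_bigr => b _; rewrite !fctE /GRing.scale /=; ring.
    rewrite /GRing.scale /=; ring.
  have Eh : `|E a w| <= 8 * ((r%:R * (2 * K) + 1) * e').
    (* The a priori bound on [E] blows up as [h] tends to 0, which is harmless since the stability
       estimate does not depend on it. *)
    apply: (@time_stability _ _ i0 r d rd Ah E Q (`|h^-1| * (K + K) + K)) => //.
    - by move=> c b z z3; rewrite /Ah A0 ?tj.
    - by move=> c b z; exact: Ad.
    - move=> c z z3; have z3' : 3 < `|(h *: ej + z) 0 i0| by rewrite tj.
      have AD b : 'D_ej (A c b) z = 0 by apply: (@derive_support _ _ _ _ 3 i0) => // u; exact: A0.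
      have BD : 'D_ej (B c) z = 0 by apply: (@derive_support _ _ _ _ 3 i0) => // u; exact: B0.
      rewrite /Q BD !(B0 c) // !subr0 mulr0 addr0 big1 // => b _.
      by rewrite AD !(A0 c b) // !subr0 mulr0 !mul0r addr0.
    - by apply: mulr_ge0 => //; apply: addr_ge0 => //; rewrite !mulr_ge0.
    - move=> c z; rewrite /Q (le_trans (ler_normD _ _)) // mulrDl mul1r lerD //.
      rewrite (le_trans (ler_norm_sum _ _ _)) //.
      apply: (@le_trans _ _ (\sum_(b < r) 2 * K * e')).
        apply: ler_sum => b _; rewrite (le_trans (ler_normD _ _)) //.
        have -> : 2 * K * e' = e' * K + e' * K by ring.
        by rewrite lerD // normrM ler_pM.
      by rewrite sumr_const card_ord -[leLHS]mulr_natl !mulrA.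
    - move=> c z; rewrite /E !fctE (le_trans (ler_normB _ _)) // lerD //.
      by rewrite normrZ ler_wpM2l // (le_trans (ler_normB _ _)) // lerD.
  rewrite distrC; apply: le_trans Eh _.
  by rewrite mulrA -/N /e' mulrC divfK // gt_eqF.
apply: DeriveDef; first by apply/cvg_ex; exists (G a w); exact: lim.
exact/cvg_lim.
Unshelve. all: by end_near. Qed.

(** Induction on [k] over all sources. The time derivative is the right-hand side of the equation. A
    parameter derivative solves the system with source [B'], which involves [F] itself and is
    [BUC k] by the induction hypothesis for [F]; the hypothesis then applies to that derivative. *)
Lemma time_solution_BUC k B F :
  (forall a, BUC k (B a)) -> (forall a, time_support (B a)) ->
  (forall a, BUC 0 (F a)) -> time_solution i0 A B F -> forall a, BUC k (F a).
Proof.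
elim: k B F => [|k IH] B F Bk B0 Fk Fs //.
have Fk' := IH B F (fun a => BUCS (Bk a)) B0 Fk Fs.
move=> a; split; [exact: BUC_bounded (Fk a)|exact: BUC_ucont (Fk a)|move=> j].
have [->|ji] := eqVneq j i0.
  split=> [w|]; first by case: (Fs.2 a w).
  have -> : (fun w => 'D_e0 (F a) w) = (fun w => \sum_b A a b w * F b w) + B a.
    by apply/funext => w; case: (Fs.2 a w) => _ ->.
  apply: BUCD; last exact: BUCS.
  by apply: BUC_sum => b; apply: BUCM.
pose B' c w := \sum_b 'D_(delta_mx 0 j) (A c b) w * F b w + 'D_(delta_mx 0 j) (B c) w.
have B'k c : BUC k (B' c).
  apply: (@BUCD _ _ _ (fun w => \sum_b 'D_(delta_mx 0 j) (A c b) w * F b w)).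
    apply: BUC_sum => b; apply: (@BUCM _ _ _ ('D_(delta_mx 0 j) (A c b))) => //.
    by have [_ _ /(_ j)[_]] := Ak k.+1 c b.
  by have [_ _ /(_ j)[_]] := Bk c.
have B'0 c : time_support (B' c).
  move=> w w3; rewrite /B' (@derive_support _ _ _ _ 3 i0) //; last by move=> u; exact: B0.
  rewrite addr0 big1 // => b _; rewrite (@derive_support _ _ _ _ 3 i0) ?mul0r //.
  by move=> u; exact: A0.
have [G [Gk Gs]] := time_solution_exists rd (Ak 0) A0 Ad (fun c => BUC0 (B'k c)) B'0.
have dFG : forall a w, is_derive w (delta_mx 0 j) (F a) (G a w).
  apply: (time_solution_derive ji _ B0 Fk Fs Gk Gs) => c.
  have := Bk c; elim: (k) => // m IHm /BUCS; exact: IHm.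
split=> [w|]; first by case: (dFG a w).
have -> : (fun w => 'D_(delta_mx 0 j) (F a) w) = G a.
  by apply/funext => w; case: (dFG a w) => _ ->.
exact: (IH _ _ B'k B'0 Gk Gs).
Qed.

End System.

(* The bound on [A] makes Picard iteration contract and keeps [Phi] close enough to the
   identity to be invertible. *)
Theorem parametric_linear_ode (r : nat) (A : 'I_r -> 'I_r -> 'rV[R]_n -> R) :
  (forall a b, Cinf setT (A a b)) ->
  (forall a b (w : 'rV[R]_n) j, 3 < `|w 0 j| -> A a b w = 0) ->
  (forall a b w, `|A a b w| <= (16 * r.+1%:R)^-1) ->
  exists Phi : 'I_r -> 'I_r -> 'rV[R]_n -> R,
    [/\ forall a c, Cinf setT (Phi a c),
        forall a c w, w 0 i0 = 0 -> Phi a c w = (a == c)%:R,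
        forall a c w, is_derive w e0 (Phi a c) (\sum_b A a b w * Phi b c w) &
        forall w, (\matrix_(a, c) Phi a c w) \in unitmx].
Proof.
move=> Ai As Ad; set d := (16 * r.+1%:R)^-1 in Ad.
have r0 : 0 < r.+1%:R :> R by [].
have rd : 16 * (r%:R * d) <= 1.
  rewrite /d invfM mulrCA (mulrA 16) divff // mul1r ler_pdivrMr // mul1r.
  by rewrite ler_nat.
have d0 : 0 <= d by rewrite invr_ge0 mulr_ge0.
have Ak k a b : BUC k (A a b).
  by apply: (@Cinf_compact_support _ _ _ _ 3) => //; exact: As.
have A0 a b : time_support (A a b) by move=> w; exact: As.
(* [F c] is the column [c] of the fundamental matrix minus the identity, hence the source is column
   [c] of [A]. *)
have /choice[F FP] : forall c, exists F, (forall a, BUC 0 (F a)) /\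
    time_solution i0 A (fun a => A a c) F.
  by move=> c; apply: (time_solution_exists rd).
exists (fun a c => cst (a == c)%:R + F c a); split.
- move=> a c k; have [Fk Fs] := FP c; apply: (CkD openT); first exact: Ck_cst.
  apply: BUC_Ck; apply: (time_solution_BUC rd Ak A0 Ad _ _ Fk Fs) => //.
- by move=> a c w w0; rewrite !fctE (FP c).2.1 // addr0.
- move=> a c w; have := (FP c).2.2 a w.
  move=> /(is_deriveD (is_derive_cst ((a == c)%:R : R) w e0)) h; apply: (is_derive_eq h).
  rewrite add0r; under [RHS]eq_bigr do rewrite !fctE mulrDr addrC.
  rewrite big_split /=; congr (_ + _).
  rewrite (bigD1 c) //= eqxx mulr1 big1 ?addr0 // => b /negbTE ->.
  by rewrite mulr0.
- move=> w; have Fd a c : `|F c a w| <= 8 * d.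
    have [Fk Fs] := FP c.
    have /choice[bF bFP] : forall a, exists b : R, forall w, `|F c a w| <= b.
      by move=> b; exact: BUC_bounded (Fk b).
    apply: (@time_stability _ _ i0 r d rd A (F c) (fun a => A a c) (\sum_b `|bF b|)) => //.
    move=> b z; rewrite (le_trans (bFP b z)) // (le_trans (ler_norm _)) //.
    by rewrite (bigD1 b) //= lerDl sumr_ge0.
  (* A row [v] killed by 1 + F equals [- v F], and [|v F| <= r * (8 * d) * |v| <= |v| / 2] forces
     [v = 0]. *)
  rewrite -row_free_unit -kermx_eq0; apply/rowV0P => v /sub_kermxP v0.
  apply/rowP => c0; rewrite mxE; apply/eqP; rewrite -normr_le0.
  suff [h1 h2] : `|v| <= `|v| / 2 /\ `|v 0 c0| <= `|v|.
    by rewrite (le_trans h2) //; lra.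
  split; last exact: abs_coord_le.
  apply: norm_row_le => [|c]; first by rewrite divr_ge0.
  have := congr1 (fun u : 'rV[R]_r => u 0 c) v0; rewrite !mxE.
  under eq_bigr do rewrite mxE !fctE mulrDr.
  rewrite big_split /= (bigD1 c) //= eqxx mulr1 big1 ?addr0; last first.
    by move=> a /negbTE ->; rewrite mulr0.
  move=> /eqP; rewrite addr_eq0 => /eqP ->; rewrite normrN.
  rewrite (le_trans (ler_norm_sum _ _ _)) //.
  apply: (@le_trans _ _ (\sum_(a < r) `|v| * (8 * d))).
    by apply: ler_sum => a _; rewrite normrM ler_pM // abs_coord_le.
  rewrite sumr_const card_ord -mulrnAr ler_wpM2l // -mulr_natl.
  by move: rd; set x := r%:R; lra.
Qed.

End ParametricODERegularity.

(** * Smooth functions and vector fields on manifolds *)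

Section ManifoldSmooth.
Variables (R : realType) (n : nat) (M : manifold R n).
Implicit Types (f g : M -> R) (U V W : set M) (c d : chart R M n) (x : M).

Lemma chart_mapK c x : mf_atlas c -> chart_dom c x -> chart_inv c (chart_map c x) = x.
Proof. by move=> /mf_chart[_ _ cK _ _]; exact: cK. Qed.

Lemma chart_image_inv c V y : mf_atlas c -> (chart_map c @` (chart_dom c `&` V)) y ->
  [/\ chart_dom c (chart_inv c y), V (chart_inv c y) & chart_map c (chart_inv c y) = y].
Proof. by move=> ac [x [cx Vx] <-]; rewrite (chart_mapK ac cx). Qed.

Lemma chart_image_open c V : mf_atlas c -> open V -> open (chart_map c @` (chart_dom c `&` V)).
Proof.
move=> ac oV; have [oc oi cK _ ci] := mf_chart ac.
rewrite openE => y [x [cx Vx] cxy].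
have iy : (chart_map c @` chart_dom c) y by exists x.
have h : \forall z \near y, (chart_dom c `&` V) (chart_inv c z).
  apply: (ci y iy); rewrite -cxy cK //.
  by apply: filterI; apply: open_nbhs_nbhs.
have h' : \forall z \near y, (chart_map c @` chart_dom c) z by exact: open_nbhs_nbhs.
apply: filterS2 h h' => z [cz Vz] [x' cx' zE]; exists x' => //.
by move: cz Vz; rewrite -zE cK.
Qed.

Lemma chart_preimage_open c (U : set 'rV[R]_n) : mf_atlas c -> open U ->
  open (chart_dom c `&` chart_map c @^-1` U).
Proof.
move=> ac oU; have [oc _ _ cc _] := mf_chart ac.
rewrite openE => x [cx Ux]; apply: filterI; first exact: open_nbhs_nbhs.
by apply: (cc x cx); exact: open_nbhs_nbhs.
Qed.

Lemma smooth_on_subset V W f : V `<=` W -> smooth_on W f -> smooth_on V f.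
Proof.
move=> VW fW c ac k; apply: Ck_subset (fW c ac k) => _ [x [cx /VW Wx] <-].
by exists x.
Qed.

Lemma smooth_smooth_on W f : smooth f -> smooth_on W f.
Proof. exact: smooth_on_subset. Qed.

Lemma smooth_on_local W f :
  (forall x, W x -> exists2 V, V x & smooth_on V f) -> smooth_on W f.
Proof.
move=> h c ac k; apply: Ck_local => _ [x [cx Wx] <-].
have [V Vx fV] := h x Wx; exists (chart_map c @` (chart_dom c `&` V)); first by exists x.
exact: fV.
Qed.

Lemma smooth_on_ext W f g : open W -> (forall x, W x -> f x = g x) ->
  smooth_on W f -> smooth_on W g.
Proof.
move=> oW fg fW c ac k; apply: Ck_ext (fW c ac k); first exact: chart_image_open.
by move=> y /(chart_image_inv ac)[_ Wy _] /=; exact: fg.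
Qed.

Lemma smooth_on_cst W (a : R) : smooth_on W (fun=> a).
Proof. by move=> c _ k; exact: Ck_cst. Qed.

Lemma smooth_onD W f g : open W -> smooth_on W f -> smooth_on W g -> smooth_on W (f + g).
Proof.
move=> oW fW gW c ac k.
by apply: (CkD (chart_image_open ac oW)); [exact: fW|exact: gW].
Qed.

Lemma smooth_onM W f g : open W -> smooth_on W f -> smooth_on W g -> smooth_on W (f * g).
Proof.
move=> oW fW gW c ac k.
by apply: (CkM (chart_image_open ac oW)); [exact: fW|exact: gW].
Qed.

Lemma smooth_on_sum W (I : Type) (r : seq I) (f : I -> M -> R) : open W ->
  (forall i, smooth_on W (f i)) -> smooth_on W (fun x => \sum_(i <- r) f i x).
Proof.
move=> oW fW; elim: r => [|i r IH].
  by under eq_fun do rewrite big_nil; exact: smooth_on_cst.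
under eq_fun do rewrite big_cons.
exact: (smooth_onD oW (fW i) IH).
Qed.

Lemma smooth_on_prod W (I : Type) (r : seq I) (f : I -> M -> R) : open W ->
  (forall i, smooth_on W (f i)) -> smooth_on W (fun x => \prod_(i <- r) f i x).
Proof.
move=> oW fW; elim: r => [|i r IH].
  by under eq_fun do rewrite big_nil; exact: smooth_on_cst.
under eq_fun do rewrite big_cons.
exact: (smooth_onM oW (fW i) IH).
Qed.

Lemma smooth_onV W f : open W -> (forall x, W x -> f x != 0) -> smooth_on W f ->
  smooth_on W (fun x => (f x)^-1).
Proof.
move=> oW f0 fW c ac k; apply: (CkV (chart_image_open ac oW) _ (fW c ac k)).
by move=> y /(chart_image_inv ac)[_ Wy _] /=; exact: f0.
Qed.

Lemma smooth_on_chart c V f : mf_atlas c -> open V -> V `<=` chart_dom c ->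
  Cinf (chart_map c @` V) (f \o chart_inv c) -> smooth_on V f.
Proof.
move=> ac oV Vc fc d ad k.
have oc : open (chart_map c @` V) by rewrite -(setIidr Vc); exact: chart_image_open.
have od := chart_image_open ad oV.
apply: (@Ck_ext _ _ _ _ ((f \o chart_inv c) \o (fun y => chart_map c (chart_inv d y)))) => //.
  by move=> y /(chart_image_inv ad)[_ Vy _] /=; rewrite chart_mapK //; exact: Vc.
apply: (Ck_comp od oc _ (fc k)).
  by move=> y /(chart_image_inv ad)[_ Vy _]; exists (chart_inv d y).
move=> i; apply: Ck_subset (mf_transition ad ac i k) => _ [x [dx Vx] <-].
by exists x => //; split=> //; exact: Vc.
Qed.

Definition cutoff (chi : M -> R) (W V : set M) :=
  [/\ smooth chi, open V, forall x, V x -> chi x = 1 &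
      exists K, [/\ closed K, K `<=` W & forall x, ~ K x -> chi x = 0]].

Lemma cutoff_out chi W V x : cutoff chi W V -> ~ W x -> chi x = 0.
Proof. by move=> [_ _ _ [K [_ KW K0]]] Wx; apply: K0 => /KW. Qed.

Lemma cutoff_sub chi W V : cutoff chi W V -> V `<=` W.
Proof.
move=> h x Vx; apply: contrapT => Wx; have [_ _ c1 _] := h.
by have := c1 x Vx; rewrite (cutoff_out h Wx) => /eqP; rewrite eq_sym oner_eq0.
Qed.

Lemma smooth_on_cutoff chi W V f : open W -> cutoff chi W V -> smooth_on W f ->
  smooth (chi * f).
Proof.
move=> oW [schi _ _ [K [cK KW K0]]] fW; apply: smooth_on_local => x _.
have [Wx|Wx] := pselect (W x).
  exists W => //; apply: smooth_onM => //; exact: smooth_smooth_on.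
have oK : open (~` K) by exact: closed_openC.
exists (~` K); first by move=> /KW.
apply: (smooth_on_ext oK _ (smooth_on_cst (~` K) 0)) => z Kz.
by rewrite !fctE K0 // mul0r.
Qed.

Lemma cutoff_exists (p : M) W : open W -> W p -> exists chi V, cutoff chi W V /\ V p.
Proof.
move=> oW Wp; have [c ac cp] := mf_cover p.
have [oc oi cK cc ci] := mf_chart ac.
have : nbhs (chart_map c p) (chart_map c @` (chart_dom c `&` W)).
  by apply: open_nbhs_nbhs; split; [exact: chart_image_open|exists p].
move=> /nbhs_ballP[t /= t0 tW].
(* The bump rescaled by [s] lives in the cube [Q] of radius [2 * s], inside the ball of radius
   [t = 3 * s]. *)
pose s := t / 3; have s0 : 0 < s by rewrite divr_gt0.
pose Q := [set y : 'rV[R]_n | forall j,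
  y 0 j \in `[chart_map c p 0 j - 2 * s, chart_map c p 0 j + 2 * s]].
have QW : Q `<=` chart_map c @` (chart_dom c `&` W).
  move=> y Qy; apply: tW; rewrite -ball_normE /ball_/=.
  apply: norm_row_lt => // j; rewrite !mxE; have := Qy j; rewrite in_itv /= => /andP[h1 h2].
  by rewrite /s in h1 h2; rewrite ltr_norml; apply/andP; split; lra.
pose K := chart_inv c @` Q.
have cptK : compact K.
  apply: continuous_compact; last first.
    apply: (@rV_compact _ _
      (fun j => `[chart_map c p 0 j - 2 * s, chart_map c p 0 j + 2 * s]%classic)) => j.
    exact: segment_compact.
  apply: continuous_in_subspaceT => y /set_mem/QW [x [cx _] xy].
  by apply: ci; exists x.
pose u (x : M) : 'rV[R]_n := s^-1 *: (chart_map c x - chart_map c p).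
pose chi x := if `[< chart_dom c x >] then bump_row (u x) else 0.
(* Here the Hausdorff property enters: a compact set in a chart could fail to be closed in [M], and
   the extension by 0 to be smooth. *)
have clK : closed K by apply: compact_closed => //; exact: mf_hausdorff.
have KW : K `<=` chart_dom c `&` W.
  by move=> _ [y /QW [x cWx <-] <-]; rewrite cK //; case: cWx.
have chi0 x : ~ K x -> chi x = 0.
  move=> Kx; rewrite /chi; case: asboolP => // cx.
  have [Qx|] := pselect (Q (chart_map c x)).
    by exfalso; apply: Kx; exists (chart_map c x) => //; rewrite cK.
  move=> /existsNP[j]; rewrite in_itv /= => /negP h.
  apply: (@bump_row_eq0 _ _ _ j); rewrite leNgt; apply/negP => h2; move/negP: h; apply.
  rewrite /u !mxE normrM gtr0_norm ?invr_gt0 // ltr_pdivrMl // in h2.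
  by move: h2; rewrite ltr_norml => /andP[h3 h4]; apply/andP; split; lra.
(* On this ball each rescaled coordinate is at most 1 / (n + 1), so that their squares add up to at
   most 1, where the bump is 1. *)
pose V := chart_dom c `&` chart_map c @^-1` (ball (chart_map c p) (s / n.+1%:R)).
exists chi, V; split; last by split=> //; apply: ballxx; rewrite divr_gt0.
split.
- apply: smooth_on_local => x _; have [cx|cx] := pselect (chart_dom c x).
    exists (chart_dom c) => //; apply: (smooth_on_chart ac oc (@subset_refl _ _)) => k.
    refine (@Ck_ext R n k _
      (@bump_row R n \o (fun y => (s^-1 *: (y - chart_map c p) : matrix R 1 n))) _ oi _ _).
      by move=> _ [z cz <-] /=; rewrite /chi cK //; case: asboolP.
    apply: (Ck_comp oi openT _ (@Cinf_bump_row R n k)) => // i.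
    have -> : (fun y : 'rV[R]_n => (s^-1 *: (y - chart_map c p)) 0 i) =
        cst s^-1 * ((fun y : 'rV[R]_n => y 0 i) - cst (chart_map c p 0 i)).
      by apply/funext => y; rewrite !mxE.
    apply: (CkM oi); first exact: Ck_cst.
    by apply: (CkB oi); [exact: Ck_coord|exact: Ck_cst].
  have oK : open (~` K) by exact: closed_openC.
  exists (~` K); first by move=> /KW[].
  by apply: (smooth_on_ext oK _ (smooth_on_cst (~` K) 0)) => z /chi0.
- by apply: chart_preimage_open => //; exact: ball_open.
- move=> x [cx]; rewrite /= -ball_normE /ball_/= => xp.
  rewrite /chi; case: asboolP => // _; apply: bump_row_eq1.
  apply: (@le_trans _ _ (\sum_(i < n) n.+1%:R^-1)).
    apply: ler_sum => i _; have := abs_coord_le (chart_map c x - chart_map c p) i.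
    rewrite distrC in xp; move=> /le_lt_trans/(_ xp); rewrite /u !mxE => h.
    have : `|s^-1 * (chart_map c x 0 i - chart_map c p 0 i)| <= n.+1%:R^-1.
      by rewrite normrM gtr0_norm ?invr_gt0 // ler_pdivrMl // ltW.
    rewrite -real_normK ?num_real // => h'; rewrite expr2.
    rewrite -[leRHS]mulr1 ler_pM // (le_trans h') // invf_le1 // ler1n.
    by [].
  by rewrite sumr_const card_ord -[leLHS]mulr_natl ler_pdivrMr // mul1r ler_nat.
- by exists K; split=> // x /KW[].
Qed.

(** The factor [chi] turns a coordinate field into a global one; the value 0 on non-smooth functions
    is the normal form that [is_derivation] prescribes. *)
Definition coord_derivation (chi : M -> R) c (i : 'I_n) (x : M) : (M -> R) -> R^o :=
  fun f => if `[< smooth f >]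
    then chi x * 'D_(delta_mx 0 i) (f \o chart_inv c) (chart_map c x) else 0.

Definition coord_vf (chi : M -> R) c (i : 'I_n) : vfield M :=
  fun x => insubd (0 : tangent x) (coord_derivation chi c i x).

Lemma smooth_derivable f c i x : mf_atlas c -> chart_dom c x -> smooth f ->
  derivable (f \o chart_inv c) (chart_map c x) (delta_mx 0 i).
Proof.
move=> ac cx sf; have [_ /(_ i)[d1 _]] := sf c ac 1%N; apply: d1.
by exists x.
Qed.

Lemma coord_vfE chi c i x f : mf_atlas c -> chart_dom c x -> smooth f ->
  coord_vf chi c i x f = chi x * 'D_(delta_mx 0 i) (f \o chart_inv c) (chart_map c x).
Proof.
move=> ac cx sf; rewrite /coord_vf -[LHS]/((val (insubd _ _)) f) insubdK.
  by rewrite /coord_derivation; case: asboolP.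
apply/asboolP; split.
- move=> a g h sg sh; rewrite /coord_derivation !asboolT //; last exact: smoothD (smoothZ _ sg) sh.
  have -> : (a *: g + h) \o chart_inv c = a *: (g \o chart_inv c) + (h \o chart_inv c) by [].
  have dg := @smooth_derivable _ c i x ac cx sg; have dh := @smooth_derivable _ c i x ac cx sh.
  rewrite (deriveD (@derivableZ _ _ _ _ a _ _ dg) dh) (@deriveZ _ _ _ _ a _ _ dg).
  by rewrite /GRing.scale /=; ring.
- move=> g h sg sh; rewrite /coord_derivation !asboolT //; last exact: smoothM.
  have -> : (g * h) \o chart_inv c = (g \o chart_inv c) * (h \o chart_inv c) by [].
  have dg := @smooth_derivable _ c i x ac cx sg; have dh := @smooth_derivable _ c i x ac cx sh.
  by rewrite (deriveM dg dh) /= chart_mapK // /GRing.scale /=; ring.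
- by move=> g sg; rewrite /coord_derivation asboolF.
Qed.

Lemma coord_vf_eq0 chi c i x : chi x = 0 -> coord_vf chi c i x = 0.
Proof.
move=> x0; apply: val_inj; rewrite /coord_vf.
have -> : coord_derivation chi c i x = val (0 : tangent x).
  by apply/funext => f; rewrite /coord_derivation x0 mul0r; case: ifP.
by rewrite valKd.
Qed.

Lemma smooth_coord_vf chi c i V : mf_atlas c -> cutoff chi (chart_dom c) V ->
  smooth_vf (coord_vf chi c i).
Proof.
move=> ac hchi f sf; have [oc oi _ _ _] := mf_chart ac.
have -> : vf_app (coord_vf chi c i) f =
    chi * (fun x => 'D_(delta_mx 0 i) (f \o chart_inv c) (chart_map c x)).
  apply/funext => x; rewrite /vf_app fctE.
  have [cx|cx] := pselect (chart_dom c x); first exact: coord_vfE.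
  by rewrite coord_vf_eq0 (cutoff_out hchi cx) ?mul0r.
apply: (smooth_on_cutoff oc hchi); apply: (smooth_on_chart ac oc (@subset_refl _ _)) => k.
have [_ /(_ i)[_ d2]] := sf c ac k.+1; rewrite setIT in d2.
apply: (Ck_ext oi _ d2) => _ [x cx <-] /=.
by rewrite chart_mapK.
Qed.

End ManifoldSmooth.

(** * Smooth sections and frames *)

Section SmoothSections.
Variables (R : realType) (n : nat) (M : manifold R n) (E : vector_bundle M).
Implicit Types (s t : section E) (V W : set M) (f : M -> R) (e : local_frame E).

Lemma smooth_section_on_subset V W s : V `<=` W ->
  smooth_section_on W s -> smooth_section_on V s.
Proof.
move=> VW sW e ae i; apply: smooth_on_subset (sW e ae i).
by move=> x [ex /VW Wx].
Qed.

Lemma smooth_section_on_local W s :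
  (forall x, W x -> exists2 V, V x & smooth_section_on V s) -> smooth_section_on W s.
Proof.
move=> h e ae i; apply: smooth_on_local => x [ex Wx]; have [V Vx sV] := h x Wx.
by exists (fr_dom e `&` V); [split|exact: sV].
Qed.

Lemma open_frameI e W : vb_atlas e -> open W -> open (fr_dom e `&` W).
Proof. by move=> /vb_open oe oW; exact: openI. Qed.

Lemma smooth_section_on_ext W s t : open W -> (forall x, W x -> s x = t x) ->
  smooth_section_on W s -> smooth_section_on W t.
Proof.
move=> oW st sW e ae i; apply: smooth_on_ext (sW e ae i); first exact: open_frameI.
by move=> x [_ Wx]; rewrite /frame_coord st.
Qed.

Lemma smooth_section_on0 W : smooth_section_on W (fun x => 0 : E x).
Proof.
move=> e ae i; rewrite (_ : frame_coord e _ i = fun=> 0); first exact: smooth_on_cst.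
by apply/funext => x; rewrite /frame_coord linear0.
Qed.

Lemma smooth_section_onD W s t : open W -> smooth_section_on W s ->
  smooth_section_on W t -> smooth_section_on W (fun x => s x + t x).
Proof.
move=> oW sW tW e ae i.
rewrite (_ : frame_coord e _ i = frame_coord e s i + frame_coord e t i).
  by apply: smooth_onD; [exact: open_frameI|exact: sW|exact: tW].
by apply/funext => x; rewrite fctE /frame_coord linearD.
Qed.

Lemma smooth_section_onZ W f s : open W -> smooth_on W f ->
  smooth_section_on W s -> smooth_section_on W (fun x => f x *: s x).
Proof.
move=> oW fW sW e ae i.
rewrite (_ : frame_coord e _ i = f * frame_coord e s i).
  apply: smooth_onM; [exact: open_frameI|apply: smooth_on_subset fW|exact: sW].
  by move=> x [].
by apply/funext => x; rewrite fctE /frame_coord linearZ.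
Qed.

Lemma smooth_section_on_sum W (I : Type) (r : seq I) (s : I -> section E) : open W ->
  (forall i, smooth_section_on W (s i)) ->
  smooth_section_on W (fun x => \sum_(i <- r) s i x).
Proof.
move=> oW sW; elim: r => [|i r IH].
  apply: (smooth_section_on_ext oW _ (smooth_section_on0 W)) => x _.
  by rewrite big_nil.
apply: (smooth_section_on_ext oW _ (smooth_section_onD oW (sW i) IH)) => x _.
by rewrite big_cons.
Qed.

Lemma smooth_sectionD s t : smooth_section s -> smooth_section t ->
  smooth_section (fun x => s x + t x).
Proof. exact: smooth_section_onD openT. Qed.

Lemma smooth_sectionZ f s : smooth f -> smooth_section s ->
  smooth_section (fun x => f x *: s x).
Proof. exact: smooth_section_onZ openT. Qed.

Lemma smooth_section_on_cutoff chi W V s : open W -> cutoff chi W V ->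
  smooth_section_on W s -> smooth_section (fun x => chi x *: s x).
Proof.
move=> oW [schi _ _ [K [cK KW K0]]] sW; apply: smooth_section_on_local => x _.
have [Wx|Wx] := pselect (W x).
  exists W => //; apply: smooth_section_onZ => //; exact: smooth_smooth_on.
have oK : open (~` K) by exact: closed_openC.
exists (~` K); first by move=> /KW.
apply: (smooth_section_on_ext oK _ (smooth_section_on0 (~` K))) => z Kz.
by rewrite K0 // scale0r.
Qed.

Lemma frame_coord_expand e s x : basis_of fullv (frame_at e x) ->
  s x = \sum_i frame_coord e s i x *: fr_vec e i x.
Proof.
move=> eb; rewrite {1}(coord_basis eb (memvf (s x))).
by apply: eq_bigr => i _; rewrite (nth_map i) ?size_enum_ord // nth_ord_enum.
Qed.

Lemma smooth_frame_coord e W s (i : 'I_(fr_rank e)) : smooth_frame e -> open W ->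
  smooth_section_on W s -> smooth_on (fr_dom e `&` W) (frame_coord e s i).
Proof.
move=> [oe eb es ee] oW sW; apply: smooth_on_local => x [ex Wx].
have [e' ae' e'x] := vb_cover E x.
have oX : open (fr_dom e `&` fr_dom e' `&` W).
  by apply: openI => //; apply: openI => //; exact: vb_open.
exists (fr_dom e `&` fr_dom e' `&` W) => //.
apply: (@smooth_on_ext _ _ _ _ (fun y =>
  \sum_j frame_coord e' s j y * frame_coord e (fr_vec e' j) i y)) => //.
  move=> y [[ey e'y] Wy]; rewrite [in RHS]/frame_coord (frame_coord_expand s (vb_basis ae' e'y)).
  by rewrite linear_sum /=; apply: eq_bigr => j _; rewrite linearZ.
apply: smooth_on_sum => // j; apply: (smooth_onM oX (f := frame_coord e' s j)).
  by apply: smooth_on_subset (sW e' ae' j) => y [[]].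
by apply: smooth_on_subset (ee e' ae' i j) => y [[]].
Qed.

(** A local frame of [k] detached from the frame of [E] that it comes from. Smoothness of
    coordinates is a field, so that it survives the change of frame in [subframe_change]. *)
Record subframe (k : forall x, {vspace E x}) (W : set M) (r : nat)
    (e : 'I_r -> section E) : Prop := Subframe {
  sf_open : open W ;
  sf_basis : forall x, W x -> basis_of (k x) [tuple e a x | a < r] ;
  sf_smooth : forall a, smooth_section_on W (e a) ;
  sf_coord : forall V s, open V -> V `<=` W -> smooth_section_on V s ->
    (forall x, V x -> s x \in k x) ->
    forall a, smooth_on V (fun x => coord [tuple e b x | b < r] a (s x)) }.

Lemma subframe_exists (k : forall x, {vspace E x}) (p : M) : subbundle k ->
  exists W r (e : 'I_r -> section E), subframe k W e /\ W p.
Proof.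
(* [subbundle] does not bound [r0] by the rank of the frame, and [take] stops at the end of the
   tuple; hence the minimum. *)
move=> /(_ p)[e [r0 [es ep ke]]]; pose r := minn r0 (fr_rank e).
have ri : (r <= fr_rank e)%N by exact: geq_minr.
pose b (a : 'I_r) := fr_vec e (widen_ord ri a).
have [oe eb esm _] := es.
have bE x : [tuple b a x | a < r] = take r0 (frame_at e x) :> seq _.
  apply: (@eq_from_nth _ 0); first by rewrite size_tuple size_take size_tuple /r /minn.
  move=> i; rewrite size_tuple => ir; have ir0 : (i < r0)%N := leq_trans ir (geq_minl _ _).
  rewrite nth_take // (nth_map (Ordinal ir)) ?size_enum_ord //.
  rewrite (nth_map (widen_ord ri (Ordinal ir))) ?size_enum_ord ?(leq_trans ir) //.
  rewrite /b; congr (fr_vec e _ x); apply: val_inj => /=.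
  by rewrite !nth_enum_ord // (leq_trans ir).
have bf x : fr_dom e x -> free [tuple b a x | a < r].
  move=> /eb/basis_free; rewrite bE -{1}(cat_take_drop r0 (frame_at e x)).
  exact: catl_free.
have bb x : fr_dom e x -> basis_of (k x) [tuple b a x | a < r].
  by move=> ex; rewrite basisEfree bf // ke // bE subvv /= dim_span // size_take.
exists (fr_dom e), r, b; split=> //; split=> //.
  by move=> a; exact: esm.
move=> V s oV Ve sV sk a.
apply: (@smooth_on_ext _ _ _ _ (frame_coord e s (widen_ord ri a))) => //; last first.
  apply: smooth_on_subset (smooth_frame_coord _ es oV sV) => x Vx.
  by split=> //; exact: Ve.
move=> x Vx; have ex := Ve x Vx.
rewrite /frame_coord {1}(coord_basis (bb x ex) (sk x Vx)) linear_sum /=.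
have full i : frame_coord e (fr_vec e i) (widen_ord ri a) x = (i == widen_ord ri a)%:R.
  have := coord_free i (widen_ord ri a) (basis_free (eb x ex)).
  by rewrite (nth_map i) ?size_enum_ord // nth_ord_enum.
rewrite (bigD1 a) //= big1 ?addr0.
  rewrite linearZ /= (nth_map a) ?size_enum_ord // nth_ord_enum.
  by have := full (widen_ord ri a); rewrite /frame_coord eqxx => ->; rewrite mulr1.
move=> c ca; rewrite linearZ /= (nth_map c) ?size_enum_ord // nth_ord_enum.
have := full (widen_ord ri c); rewrite /frame_coord => ->.
by rewrite -(inj_eq val_inj) /= (inj_eq val_inj) (negbTE ca) mulr0.
Qed.

Section Subframe.
Variables (k : forall x, {vspace E x}) (W : set M) (r : nat) (e : 'I_r -> section E).
Hypothesis sf : subframe k W e.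

Lemma subframe_in x a : W x -> e a x \in k x.
Proof.
move=> /(sf_basis sf)/basis_mem; apply; apply/mapP; exists a => //.
by rewrite mem_enum.
Qed.

Lemma subframe_expand x (u : E x) : W x -> u \in k x ->
  u = \sum_a coord [tuple e b x | b < r] a u *: e a x.
Proof.
move=> Wx uk; rewrite {1}(coord_basis (sf_basis sf Wx) uk).
by apply: eq_bigr => i _; rewrite (nth_map i) ?size_enum_ord // nth_ord_enum.
Qed.

Lemma subframe_coord_sum x (c : 'I_r -> R) a : W x ->
  coord [tuple e b x | b < r] a (\sum_b c b *: e b x) = c a.
Proof.
move=> Wx; have := coord_sum_free c a (basis_free (sf_basis sf Wx)).
congr (coord _ _ _ = _); apply: eq_bigr => i _.
by rewrite (nth_map i) ?size_enum_ord // nth_ord_enum.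
Qed.

End Subframe.
End SmoothSections.

(** * Fibre brackets of a bundle of ideals *)

Section IdealBundle.
Variables (R : realType) (n : nat) (M : manifold R n) (A : lie_algebroid M).
Implicit Types (s t : section A) (f : M -> R).

Lemma la_bracket_addl (a a' b : section A) x :
  smooth_section a -> smooth_section a' -> smooth_section b ->
  la_bracket (fun y => a y + a' y) b x = la_bracket a b x + la_bracket a' b x.
Proof.
move=> sa sa' sb; have := congr1 (@^~ x) (la_bracket_linear 1 sa sa' sb).
rewrite /= scale1r => <-; congr (la_bracket _ b x).
by apply: functional_extensionality_dep => y; rewrite scale1r.
Qed.

Lemma la_bracket_0l (b : section A) x : smooth_section b -> la_bracket (fun y => 0 : A y) b x = 0.
Proof.
move=> sb; have s0 : smooth_section (fun y => 0 : A y) by exact: smooth_section_on0.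
have := la_bracket_addl x s0 s0 sb.
rewrite (_ : (fun y => 0 + 0 : A y) = fun y => 0).
  by move=> /eqP; rewrite -subr_eq0 opprD addNKr oppr_eq0 => /eqP.
by apply: functional_extensionality_dep => y; rewrite addr0.
Qed.

Section Ideals.
Variable k : forall x, {vspace A x}.

Lemma section_ofD s t : section_of k s -> section_of k t -> section_of k (fun x => s x + t x).
Proof.
by move=> [ss sk] [ts tk]; split=> [|x]; [exact: smooth_sectionD|rewrite memvD].
Qed.

Lemma section_ofZ f s : smooth f -> section_of k s -> section_of k (fun x => f x *: s x).
Proof.
by move=> sf [ss sk]; split=> [|x]; [exact: smooth_sectionZ|rewrite memvZ].
Qed.

Lemma section_of_sum (I : Type) (r : seq I) (s : I -> section A) :
  (forall i, section_of k (s i)) -> section_of k (fun x => \sum_(i <- r) s i x).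
Proof.
move=> sk; split=> [|x]; last by apply: memv_suml => i _; case: (sk i).
by apply: smooth_section_on_sum; [exact: openT|move=> i; case: (sk i)].
Qed.

Hypothesis hk : bundle_of_ideals k.

Lemma ideal_anchor s x : section_of k s -> la_anchor A x (s x) = 0.
Proof. by move=> [_ sk]; exact: bi_anchor hk _ _ (sk x). Qed.

Lemma ideal_bracket s t : section_of k s -> section_of k t -> section_of k (la_bracket s t).
Proof.
move=> [ss _] tk; split; last by move=> x; exact: (bi_ideal hk ss tk x).
by apply: la_bracket_smooth => //; case: tk.
Qed.

(** The derivative term of the Leibniz rule involves the anchor of [t], which is 0. The bracket of
    [k] is therefore linear over functions, which makes the fibre bracket independent of
    extensions. *)
Lemma ideal_bracketZl f s t x : smooth f -> section_of k s -> section_of k t ->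
  la_bracket (fun y => f y *: s y) t x = f x *: la_bracket s t x.
Proof.
move=> sf sk tk; have [ss _] := sk; have [st _] := tk.
have sfs : smooth_section (fun y => f y *: s y) by exact: smooth_sectionZ.
rewrite (la_bracket_antisym sfs st) (la_leibniz sf st ss) (ideal_anchor x tk).
by rewrite scale0r addr0 -scalerN (la_bracket_antisym st ss) opprK.
Qed.

Lemma ideal_bracket_suml (r : nat) (f : 'I_r -> M -> R) (s : 'I_r -> section A) t x :
  (forall i, smooth (f i)) -> (forall i, section_of k (s i)) -> section_of k t ->
  la_bracket (fun y => \sum_i f i y *: s i y) t x = \sum_i f i x *: la_bracket (s i) t x.
Proof.
move=> sf sk tk; have [st _] := tk.
suff h (l : seq 'I_r) : la_bracket (fun y => \sum_(i <- l) f i y *: s i y) t x =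
    \sum_(i <- l) f i x *: la_bracket (s i) t x by exact: h.
elim: l => [|i l IH].
  rewrite big_nil -(la_bracket_0l x st); congr (la_bracket _ t x).
  by apply: functional_extensionality_dep => y; rewrite big_nil.
rewrite big_cons -IH -(ideal_bracketZl x (sf i) (sk i) tk) -la_bracket_addl //.
- congr (la_bracket _ t x).
  by apply: functional_extensionality_dep => y; rewrite big_cons.
- by case: (section_ofZ (sf i) (sk i)).
- by have [] := @section_of_sum _ l (fun i y => f i y *: s i y)
    (fun i => section_ofZ (sf i) (sk i)).
Qed.

Lemma subframe_cutoff_section W r (e : 'I_r -> section A) chi V (a : 'I_r) :
  subframe k W e -> cutoff chi W V -> section_of k (fun y => chi y *: e a y).
Proof.
move=> sf hchi; split.
  exact: smooth_section_on_cutoff (sf_open sf) hchi (sf_smooth sf a).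
move=> y; have [Wy|Wy] := pselect (W y); first by rewrite memvZ // (subframe_in sf).
by rewrite (cutoff_out hchi Wy) scale0r mem0v.
Qed.

Lemma subframe_cutoff_expand W r (e : 'I_r -> section A) chi V s y :
  subframe k W e -> cutoff chi W V -> s y \in k y ->
  chi y *: s y = \sum_a (chi y * coord [tuple e b y | b < r] a (s y)) *: e a y.
Proof.
move=> sf hchi sk; have [Wy|Wy] := pselect (W y).
  rewrite {1}(subframe_expand sf Wy sk) scaler_sumr.
  by apply: eq_bigr => a _; rewrite scalerA.
rewrite (cutoff_out hchi Wy) scale0r big1 // => a _.
by rewrite mul0r scale0r.
Qed.

Lemma smooth_cutoff_coord W r (e : 'I_r -> section A) chi W' V s (a : 'I_r) :
  subframe k W e -> open W' -> W' `<=` W -> cutoff chi W' V -> section_of k s ->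
  smooth (fun y => chi y * coord [tuple e b y | b < r] a (s y)).
Proof.
move=> sf oW' W'W hchi [ss sk]; apply: (smooth_on_cutoff oW' hchi).
by apply: (sf_coord sf) => //; exact: smooth_section_on_subset ss.
Qed.

(* Near [x], [chi ^ 2 * s] is a combination of the global sections [chi * e a] whose
   coefficients vanish at [x]. *)
Lemma ideal_bracket_vanish s t x : section_of k s -> section_of k t ->
  s x = 0 -> la_bracket s t x = 0.
Proof.
move=> sk tk sx; have [W [r [e [sf Wx]]]] := subframe_exists x (bi_subbundle hk).
have [chi [V [hchi Vx]]] := cutoff_exists (sf_open sf) Wx.
have [schi _ chi1 _] := hchi; have x1 := chi1 x Vx.
pose c (a : 'I_r) y := chi y * coord [tuple e b y | b < r] a (s y).
have cs (a : 'I_r) : smooth (c a).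
  exact: (smooth_cutoff_coord a sf (sf_open sf) (@subset_refl _ _) hchi sk).
have := @ideal_bracket_suml r c (fun (a : 'I_r) y => chi y *: e a y) t x cs
  (fun a : 'I_r => subframe_cutoff_section a sf hchi) tk.
have -> : (fun y => \sum_i c i y *: (chi y *: e i y)) = (fun y => (chi y * chi y) *: s y).
  apply: functional_extensionality_dep => y.
  rewrite -scalerA (subframe_cutoff_expand sf hchi (sk.2 y)) scaler_sumr.
  by apply: eq_bigr => a _; rewrite !scalerA mulrC.
rewrite ideal_bracketZl //; last exact: smoothM.
rewrite x1 mul1r scale1r => ->; apply: big1 => a _.
by rewrite /c sx linear0 mulr0 scale0r.
Qed.

Lemma ideal_bracket_eql s s' t x : section_of k s -> section_of k s' -> section_of k t ->
  s x = s' x -> la_bracket s t x = la_bracket s' t x.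
Proof.
move=> sk sk' tk ss'; have sm : smooth (fun _ : M => - 1 : R) by exact: smooth_cst.
have Nk := section_ofZ sm sk'.
have := @ideal_bracket_vanish _ _ x (section_ofD sk Nk) tk.
rewrite (la_bracket_addl _ sk.1 Nk.1 tk.1) (ideal_bracketZl _ sm) //=.
by rewrite ss' !scaleN1r subrr => /(_ erefl)/eqP; rewrite subr_eq0 => /eqP.
Qed.

Lemma ideal_bracket_eq s s' t t' x :
  section_of k s -> section_of k s' -> section_of k t -> section_of k t' ->
  s x = s' x -> t x = t' x -> la_bracket s t x = la_bracket s' t' x.
Proof.
move=> sk sk' tk tk' ss' tt'; rewrite (ideal_bracket_eql sk sk' tk ss').
have [s1 _] := sk'; have [t1 _] := tk; have [t1' _] := tk'.
rewrite (la_bracket_antisym s1 t1) (la_bracket_antisym s1 t1').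
by rewrite (ideal_bracket_eql tk tk' sk' tt').
Qed.

Lemma fibre_bracketE s t x : section_of k s -> section_of k t ->
  fibre_bracket k (s x) (t x) = la_bracket s t x.
Proof.
move=> sk tk; apply: xget_subset1; first by exists s, t.
move=> w w' [s1 [t1 [sk1 tk1 es1 et1 ->]]] [s2 [t2 [sk2 tk2 es2 et2 ->]]].
by apply: ideal_bracket_eq => //; rewrite ?es1 ?et1.
Qed.

Lemma section_through x (u : A x) : u \in k x -> exists2 s, section_of k s & s x = u.
Proof.
move=> uk; have [W [r [e [sf Wx]]]] := subframe_exists x (bi_subbundle hk).
have [chi [V [hchi Vx]]] := cutoff_exists (sf_open sf) Wx.
have [_ _ chi1 _] := hchi.
exists (fun y => \sum_a coord [tuple e b x | b < r] a u *: (chi y *: e a y)).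
  apply: section_of_sum => a.
  have := section_ofZ (@smooth_cst _ _ M (coord [tuple e b x | b < r] a u))
    (subframe_cutoff_section a sf hchi).
  exact.
rewrite [RHS](subframe_expand sf Wx uk); apply: eq_bigr => a _.
by rewrite chi1 // scale1r.
Qed.

Lemma fibre_bracket_in x (u v : A x) : u \in k x -> v \in k x -> fibre_bracket k u v \in k x.
Proof.
move=> /section_through[s sk <-] /section_through[t tk <-].
by rewrite fibre_bracketE //; case: (ideal_bracket sk tk).
Qed.

Lemma fibre_bracket_linearl x (c : R) (u u' v : A x) :
  u \in k x -> u' \in k x -> v \in k x ->
  fibre_bracket k (c *: u + u') v = c *: fibre_bracket k u v + fibre_bracket k u' v.
Proof.
move=> /section_through[s sk <-] /section_through[s' sk' <-] /section_through[t tk <-].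
have ck := section_ofD (section_ofZ (@smooth_cst _ _ M c) sk) sk'.
rewrite !fibre_bracketE // -[LHS]/(fibre_bracket k ((fun y => c *: s y + s' y) x) (t x)).
rewrite fibre_bracketE //.
have [s1 _] := sk; have [s1' _] := sk'; have [t1 _] := tk.
by rewrite (la_bracket_linear c s1 s1' t1).
Qed.

Lemma fibre_bracket_antisym x (u v : A x) : u \in k x -> v \in k x ->
  fibre_bracket k u v = - fibre_bracket k v u.
Proof.
move=> /section_through[s sk <-] /section_through[t tk <-].
by rewrite !fibre_bracketE //; case: sk tk => [s1 _] [t1 _]; rewrite (la_bracket_antisym s1 t1).
Qed.

Lemma fibre_bracket_jacobi x (u v w : A x) : u \in k x -> v \in k x -> w \in k x ->
  fibre_bracket k u (fibre_bracket k v w) =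
  fibre_bracket k (fibre_bracket k u v) w + fibre_bracket k v (fibre_bracket k u w).
Proof.
move=> /section_through[s sk <-] /section_through[t tk <-] /section_through[q qk <-].
rewrite !fibre_bracketE //; try exact: ideal_bracket.
by case: sk tk qk => [s1 _] [t1 _] [q1 _]; rewrite (la_jacobi s1 t1 q1).
Qed.

Lemma fibre_bracket0l x (v : A x) : v \in k x -> fibre_bracket k 0 v = 0.
Proof.
move=> vk; have := fibre_bracket_linearl 1 (mem0v (k x)) (mem0v (k x)) vk.
rewrite scale1r addr0 scale1r => /eqP.
by rewrite -subr_eq0 opprD addNKr oppr_eq0 => /eqP.
Qed.

Lemma fibre_bracket_suml x (r : nat) (c : 'I_r -> R) (u : 'I_r -> A x) (v : A x) :
  (forall a, u a \in k x) -> v \in k x ->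
  fibre_bracket k (\sum_a c a *: u a) v = \sum_a c a *: fibre_bracket k (u a) v.
Proof.
move=> uk vk; suff h (l : seq 'I_r) : fibre_bracket k (\sum_(a <- l) c a *: u a) v =
    \sum_(a <- l) c a *: fibre_bracket k (u a) v by exact: h.
elim: l => [|a l IH]; first by rewrite !big_nil fibre_bracket0l.
by rewrite !big_cons fibre_bracket_linearl ?IH // memv_suml // => b _; rewrite memvZ.
Qed.

Lemma fibre_bracket_sumr x (r : nat) (c : 'I_r -> R) (u : 'I_r -> A x) (v : A x) :
  (forall a, u a \in k x) -> v \in k x ->
  fibre_bracket k v (\sum_a c a *: u a) = \sum_a c a *: fibre_bracket k v (u a).
Proof.
move=> uk vk; rewrite fibre_bracket_antisym //; last first.
  by rewrite memv_suml // => b _; rewrite memvZ.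
rewrite fibre_bracket_suml // -sumrN; apply: eq_bigr => a _.
by rewrite -scalerN -(fibre_bracket_antisym vk).
Qed.

End Ideals.
End IdealBundle.

(** * The induced connection *)

Section IMConnection.
Variables (R : realType) (n : nat) (M : manifold R n) (A : lie_algebroid M).
Variables (k : forall x : M, {vspace A x}) (L : section A -> oneform A)
  (l : forall x : M, {linear A x -> A x}).
Hypotheses (hk : bundle_of_ideals k) (hL : im_connection k L l).
Implicit Types (s t : section A) (X : vfield M) (f : M -> R).

(** The Leibniz rule for the connection is the symbol rule of [L], because [l] is the identity on
    [k]. *)
Lemma induced_linear_connection : linear_connection k (induced_connection L).
Proof.
split.
- move=> X s sX [ss sk]; have [h1 h2] := im_form hL ss.
  by split=> [|x]; [exact: h1|exact: h2].
- by move=> f X Y s _ _ _ _ x; rewrite /induced_connection /form_app linearP.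
- move=> c X s t _ [ss _] [st _] x.
  exact: (im_linear hL c ss st).
- move=> f X s sf _ [ss sk] x; rewrite /induced_connection /form_app (im_leibniz hL sf ss).
  by rewrite (im_symbol_id hL (sk x)).
Qed.

Lemma im_form_section X s : smooth_vf X -> section_of k s -> section_of k (form_app (L s) X).
Proof. exact: (lc_section induced_linear_connection). Qed.

Lemma im_form_bracket X s t x : smooth_vf X -> section_of k s -> section_of k t ->
  form_app (L (la_bracket s t)) X x =
  la_bracket (form_app (L s) X) t x + la_bracket s (form_app (L t) X) x.
Proof.
move=> sX sk tk; have [ss _] := sk; have [st _] := tk.
have nul q (w : oneform A) : section_of k q -> form_app w (vf_bracket (anchor_vf q) X) x = 0.
  move=> qk; rewrite /form_app (_ : vf_bracket _ _ x = 0) ?linear0 //.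
  apply: val_inj; rewrite /vf_bracket (_ : commutator _ _ x = val (0 : tangent x)) ?valKd //.
  apply/funext => f; rewrite /commutator.
  have -> : vf_app (anchor_vf q) f = 0.
    by apply/funext => y; rewrite /vf_app /anchor_vf (ideal_anchor hk y qk).
  by rewrite /anchor_vf (ideal_anchor hk x qk) tangent0 subr0.
rewrite (im_bracket hL ss st sX) /lie_derivative !nul // !subr0 addrC.
have [s1 _] := im_form_section sX sk.
by rewrite (la_bracket_antisym s1 st).
Qed.

Lemma induced_connection_bracket X s t x : smooth_vf X -> section_of k s -> section_of k t ->
  induced_connection L X (section_bracket k s t) x =
  section_bracket k (induced_connection L X s) t x +
  section_bracket k s (induced_connection L X t) x.
Proof.
move=> sX sk tk; rewrite /section_bracket.
have -> : (fun y => fibre_bracket k (s y) (t y)) = la_bracket s t.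
  by apply: functional_extensionality_dep => y; exact: fibre_bracketE.
rewrite !(fibre_bracketE hk) //; try exact: im_form_section.
exact: im_form_bracket.
Qed.

Lemma im_form_sum (r : nat) (f : 'I_r -> M -> R) (s : 'I_r -> section A) x (v : tangent x) :
  (forall i, smooth (f i)) -> (forall i, section_of k (s i)) ->
  L (fun y => \sum_i f i y *: s i y) x v = \sum_i (f i x *: L (s i) x v + v (f i) *: s i x).
Proof.
move=> sf sk; have fs i : section_of k (fun y => f i y *: s i y) by exact: section_ofZ.
suff h (q : seq 'I_r) : L (fun y => \sum_(i <- q) f i y *: s i y) x v =
    \sum_(i <- q) (f i x *: L (s i) x v + v (f i) *: s i x) by exact: h.
elim: q => [|i q IH].
  have s0 : smooth_section (fun y => 0 : A y) by exact: smooth_section_on0.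
  have := im_linear hL 1 s0 s0 v; rewrite scale1r big_nil.
  rewrite (_ : (fun y => 1 *: 0 + 0 : A y) = fun y => 0).
    rewrite (_ : (fun y => \sum_(i <- [::]) f i y *: s i y) = fun y => 0).
      by move=> /eqP; rewrite -subr_eq0 opprD addNKr oppr_eq0 => /eqP.
    by apply: functional_extensionality_dep => y; rewrite big_nil.
  by apply: functional_extensionality_dep => y; rewrite scaler0 addr0.
have [sq _] := @section_of_sum _ _ _ _ k _ q _ fs.
have [ssi ski] := sk i; have [sfi _] := fs i.
rewrite big_cons -IH -(im_symbol_id hL (ski x)) -(im_leibniz hL (sf i) ssi).
rewrite -[L _ x v in RHS]scale1r -(im_linear hL 1 sfi sq); congr (L _ x v).
by apply: functional_extensionality_dep => y; rewrite big_cons scale1r.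
Qed.

(** * The structure functions are covariantly constant *)

Section StructureEquation.
Variables (c : chart R M n) (W : set M) (r : nat) (e : 'I_r -> section A).
Variables (chi : M -> R) (V : set M).
Hypotheses (ac : mf_atlas c) (sf : subframe k W e).
Hypothesis (hchi : cutoff chi (chart_dom c `&` W) V).

(* [L] and the bracket are only constrained on global sections, so the frame [e] is replaced
   by [chi * e]; all formulas are meant on [V], where [chi = 1]. *)
Definition loc_section (a : 'I_r) : section A := fun y => chi y *: e a y.

Definition loc_coord (a : 'I_r) (s : section A) : M -> R :=
  fun y => coord [tuple e b y | b < r] a (s y).

Definition christoffel (i : 'I_n) (a b : 'I_r) : M -> R :=
  loc_coord b (form_app (L (loc_section a)) (coord_vf chi c i)).

Definition structure_fun (a b g : 'I_r) : M -> R :=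
  loc_coord g (la_bracket (loc_section a) (loc_section b)).

Let oU : open (chart_dom c `&` W).
Proof. by apply: openI; [case: (mf_chart ac)|exact: sf_open sf]. Qed.

Let UW : chart_dom c `&` W `<=` W. Proof. by move=> x []. Qed.

Let VU : V `<=` chart_dom c `&` W. Proof. exact: cutoff_sub hchi. Qed.

Let cutoff_chart : cutoff chi (chart_dom c) V.
Proof.
have [h1 h2 h3 [K [h4 h5 h6]]] := hchi; split=> //; exists K; split=> //.
by move=> x /h5[].
Qed.

Let cutoff_frame : cutoff chi W V.
Proof.
have [h1 h2 h3 [K [h4 h5 h6]]] := hchi; split=> //; exists K; split=> //.
by move=> x /h5[].
Qed.

Lemma loc_section_of a : section_of k (loc_section a).
Proof. exact: subframe_cutoff_section sf cutoff_frame. Qed.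

Let smooth_X i : smooth_vf (coord_vf chi c i).
Proof. exact: smooth_coord_vf ac cutoff_chart. Qed.

Lemma smooth_on_loc_coord a s : section_of k s ->
  smooth_on (chart_dom c `&` W) (loc_coord a s).
Proof.
move=> [ss sk]; apply: (sf_coord sf) => //.
exact: smooth_section_on_subset ss.
Qed.

Lemma smooth_christoffel i a b : smooth_on (chart_dom c `&` W) (christoffel i a b).
Proof. by apply: smooth_on_loc_coord; exact: im_form_section (loc_section_of a). Qed.

Lemma smooth_structure_fun a b g : smooth_on (chart_dom c `&` W) (structure_fun a b g).
Proof. by apply: smooth_on_loc_coord; apply: ideal_bracket => //; exact: loc_section_of. Qed.

Lemma loc_sectionE a x : V x -> loc_section a x = e a x.
Proof. by move=> Vx; rewrite /loc_section; have [_ _ -> // _] := hchi; rewrite scale1r. Qed.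

Lemma structure_funE a b x : V x ->
  fibre_bracket k (e a x) (e b x) = \sum_g structure_fun a b g x *: e g x.
Proof.
move=> Vx; rewrite -!loc_sectionE // fibre_bracketE //; try exact: loc_section_of.
apply: (subframe_expand sf (UW (VU Vx))).
by case: (ideal_bracket hk (loc_section_of a) (loc_section_of b)).
Qed.

(** Both sides are components of the covariant derivative of the bracket of [e a] and [e b]: on the
    left by the Leibniz rule for its expansion in the frame, on the right by the derivation property
    and the bilinearity of the fibre bracket. *)
Lemma structure_equation (i : 'I_n) (a b g : 'I_r) x : V x ->
  'D_(delta_mx 0 i) (structure_fun a b g \o chart_inv c) (chart_map c x) +
    \sum_h structure_fun a b h x * christoffel i h g x =
  \sum_h christoffel i a h x * structure_fun h b g x +
    \sum_h christoffel i b h x * structure_fun a h g x.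
Proof.
move=> Vx; have [cx Wx] := VU Vx.
have [_ oV chi1 _] := hchi; have chix := chi1 x Vx.
(* The expansion of [B] in the sections [loc_section h] with these coefficients is available on [V]
   only, whereas [L] needs an identity of global sections. A second cutoff [eta], supported in [V],
   makes the identity global. *)
have [eta [V' [heta V'x]]] := cutoff_exists oV Vx.
have [seta oV' eta1 _] := heta; have etax := eta1 x V'x.
pose X := coord_vf chi c i; pose v := X x.
pose B := la_bracket (loc_section a) (loc_section b).
have Bk : section_of k B by apply: ideal_bracket => //; exact: loc_section_of.
pose C h : M -> R := eta * structure_fun a b h.
have sC h : smooth (C h).
  apply: (smooth_on_cutoff oV heta).
  exact: smooth_on_subset VU (smooth_structure_fun a b h).
have BE : (fun y => eta y *: B y) = (fun y => \sum_h C h y *: loc_section h y).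
  apply: functional_extensionality_dep => y.
  rewrite (subframe_cutoff_expand sf (W := W) (V := V')); last 2 first.
  - have [h1 h2 h3 [K [h4 h5 h6]]] := heta; split=> //; exists K; split=> //.
    by move=> z /h5/VU/UW.
  - by case: Bk => _; apply.
  apply: eq_bigr => h _; have [Vy|Vy] := pselect (V y); first by rewrite loc_sectionE.
  by rewrite /C fctE (cutoff_out heta Vy) !mul0r !scale0r.
have near1 : \forall y \near chart_map c x, eta (chart_inv c y) = 1.
  have o1 := chart_image_open ac oV'.
  have : nbhs (chart_map c x) (chart_map c @` (chart_dom c `&` V')).
    by apply: open_nbhs_nbhs; split=> //; exists x.
  by apply: filterS => y /(chart_image_inv ac)[_ /eta1].
(* As [eta] is 1 near [x], replacing [B] by [eta * B] does not change [L] at [x]. *)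
have veta : v eta = 0.
  rewrite /v /X coord_vfE // chix mul1r (@near_eq_derive _ _ _ _ (cst (1 : R))) ?derive_cst //.
have vC h : v (C h) = 'D_(delta_mx 0 i) (structure_fun a b h \o chart_inv c) (chart_map c x).
  rewrite /v /X coord_vfE // chix mul1r; apply: near_eq_derive.
  by apply: filterS near1 => y y1; rewrite /= /C fctE y1 mul1r.
have Gam a' : L (loc_section a') x v = \sum_h christoffel i a' h x *: e h x.
  apply: (subframe_expand sf Wx).
  by case: (im_form_section (smooth_X i) (loc_section_of a')).
have lhs : L B x v = \sum_g (\sum_h structure_fun a b h x * christoffel i h g x +
    'D_(delta_mx 0 i) (structure_fun a b g \o chart_inv c) (chart_map c x)) *: e g x.
  have [sB kB] := Bk.
  have := im_leibniz hL seta sB v; rewrite veta scale0r addr0 etax scale1r => <-.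
  rewrite BE (im_form_sum v sC loc_section_of).
  rewrite big_split /=; under [RHS]eq_bigr do rewrite scalerDl.
  rewrite big_split /=; congr (_ + _); last first.
    by apply: eq_bigr => h _; rewrite vC loc_sectionE.
  under [RHS]eq_bigr do rewrite scaler_suml.
  rewrite exchange_big /=; apply: eq_bigr => h _.
  rewrite Gam scaler_sumr; apply: eq_bigr => g' _.
  by rewrite scalerA /C fctE etax mul1r.
have ek h : e h x \in k x by apply: (subframe_in sf).
have rhs : L B x v = \sum_g (\sum_h christoffel i a h x * structure_fun h b g x +
    \sum_h christoffel i b h x * structure_fun a h g x) *: e g x.
  rewrite -[LHS]/(form_app (L B) X x) (im_form_bracket _ (smooth_X i)); try exact: loc_section_of.
  have Xk a' : section_of k (form_app (L (loc_section a')) X).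
    exact: im_form_section (smooth_X i) (loc_section_of a').
  rewrite -!(fibre_bracketE hk); try by [exact: Xk | exact: loc_section_of].
  rewrite -[form_app (L (loc_section a)) X x]/(L (loc_section a) x v).
  rewrite -[form_app (L (loc_section b)) X x]/(L (loc_section b) x v) !Gam.
  rewrite !loc_sectionE // (fibre_bracket_suml hk) // (fibre_bracket_sumr hk) //.
  under [RHS]eq_bigr do rewrite scalerDl !scaler_suml.
  rewrite big_split /= [in RHS]exchange_big /= [X in _ = _ + X]exchange_big /=.
  by congr (_ + _); apply: eq_bigr => h _; rewrite structure_funE // scaler_sumr;
    apply: eq_bigr => g' _; rewrite scalerA.
have := subframe_coord_sum sf (fun g => \sum_h structure_fun a b h x * christoffel i h g x +
    'D_(delta_mx 0 i) (structure_fun a b g \o chart_inv c) (chart_map c x)) g Wx.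
by rewrite -lhs rhs (subframe_coord_sum sf) // => ->; rewrite addrC.
Qed.

End StructureEquation.
End IMConnection.

(** * Frames with constant structure functions *)

Section SmoothMatrix.
Variables (R : realType) (n : nat) (M : manifold R n) (W : set M).
Hypothesis oW : open W.

Lemma smooth_on_det (m : nat) (P : M -> 'M[R]_m) :
  (forall i j, smooth_on W (fun x => P x i j)) -> smooth_on W (fun x => \det (P x)).
Proof.
move=> sP; apply: smooth_on_sum => // s.
apply: (smooth_onM oW (f := fun=> (-1) ^+ s) (g := fun x => \prod_i P x i (s i))).
  exact: smooth_on_cst.
by apply: smooth_on_prod => // i; exact: sP.
Qed.

Lemma smooth_on_invmx (m : nat) (P : M -> 'M[R]_m) (i j : 'I_m) :
  (forall x, W x -> P x \in unitmx) ->
  (forall i j, smooth_on W (fun x => P x i j)) -> smooth_on W (fun x => invmx (P x) i j).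
Proof.
move=> uP sP.
have sdet : smooth_on W (fun x => (\det (P x))^-1).
  apply: (smooth_onV oW) => [x Wx|]; last exact: smooth_on_det.
  by rewrite -unitfE -unitmxE uP.
have scof : smooth_on W (fun x => cofactor (P x) j i).
  apply: (smooth_onM oW (f := fun=> (-1) ^+ (j + i)) (g := fun x => \det (row' j (col' i (P x))))).
    exact: smooth_on_cst.
  apply: smooth_on_det => a b.
  by under eq_fun do rewrite !mxE; exact: sP.
apply: (smooth_on_ext oW _ (smooth_onM oW sdet scof)) => x Wx.
by rewrite fctE /invmx uP // !mxE.
Qed.

End SmoothMatrix.

Section SubframeChange.
Variables (R : realType) (n : nat) (M : manifold R n) (E : vector_bundle M).
Variables (k : forall x, {vspace E x}) (W : set M) (r : nat) (e : 'I_r -> section E).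
Hypothesis sf : subframe k W e.

Lemma subframe_change (U : set M) (P : M -> 'M[R]_r) : open U -> U `<=` W ->
  (forall a b, smooth_on U (fun x => P x a b)) -> (forall x, U x -> P x \in unitmx) ->
  subframe k U (fun a x => \sum_b P x b a *: e b x).
Proof.
move=> oU UW sP uP.
pose f (a : 'I_r) : section E := fun x => \sum_b P x b a *: e b x.
have fsum x (c : 'I_r -> R) : \sum_a c a *: f a x = \sum_b (\sum_a P x b a * c a) *: e b x.
  under eq_bigr do rewrite scaler_sumr; rewrite exchange_big /=.
  apply: eq_bigr => b _; rewrite scaler_suml; apply: eq_bigr => a _.
  by rewrite scalerA mulrC.
have nthf x (a : 'I_r) : [tuple f b x | b < r]`_a = f a x.
  by rewrite (nth_map a) ?size_enum_ord // nth_ord_enum.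
have ff x : U x -> free [tuple f b x | b < r].
  move=> Ux; apply/freeP => c; under eq_bigr do rewrite nthf; rewrite fsum => h i.
  have PC : P x *m (\col_a c a) = 0.
    apply/colP => b; rewrite !mxE.
    have := subframe_coord_sum sf (fun b => \sum_a P x b a * c a) b (UW x Ux).
    rewrite h linear0 => h0; rewrite [RHS]h0.
    by apply: eq_bigr => a _; rewrite mxE.
  have := congr1 (fun Q => invmx (P x) *m Q) PC.
  rewrite mulmxA mulVmx ?uP // mul1mx mulmx0 => /colP/(_ i).
  by rewrite !mxE.
have fk x a : U x -> f a x \in k x.
  by move=> Ux; apply: memv_suml => b _; rewrite memvZ // (subframe_in sf) //; exact: UW.
have fb x : U x -> basis_of (k x) [tuple f b x | b < r].
  move=> Ux; rewrite basisEfree ff //=; apply/andP; split.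
    apply/span_subvP => _ /mapP[a _ ->]; exact: fk.
  by rewrite size_map size_enum_ord (size_basis (sf_basis sf (UW x Ux))).
split=> //.
  move=> a; apply: smooth_section_on_sum => // b.
  exact: (smooth_section_onZ oU (sP b a) (smooth_section_on_subset UW (sf_smooth sf b))).
move=> V s oV VU sV sk a.
have VW : V `<=` W by move=> x /VU/UW.
apply: (@smooth_on_ext _ _ _ V (fun x =>
  \sum_b invmx (P x) a b * coord [tuple e c x | c < r] b (s x))) => //.
  move=> x Vx; have Ux := VU x Vx.
  have sE : s x = \sum_a (\sum_b invmx (P x) a b * coord [tuple e c x | c < r] b (s x)) *: f a x.
    rewrite fsum [LHS](subframe_expand sf (UW x Ux) (sk x Vx)).
    apply: eq_bigr => b _; congr (_ *: _).
    have := mulmxV (uP x Ux); set Q := invmx _; pose u b := coord [tuple e c x | c < r] b (s x).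
    move=> PQ; have : (P x *m Q *m (\col_b u b)) b 0 = u b by rewrite PQ mul1mx mxE.
    rewrite -mulmxA mxE => ue; rewrite -[LHS]/(u b) -ue.
    apply: eq_bigr => c _; rewrite mxE; congr (_ * _).
    by apply: eq_bigr => d _; rewrite mxE.
  rewrite [in RHS]sE.
  have := coord_sum_free
    (fun a => \sum_b invmx (P x) a b * coord [tuple e c x | c < r] b (s x)) a (ff x Ux).
  by under eq_bigr do rewrite nthf; move=> ->.
apply: smooth_on_sum => // b.
apply: (smooth_onM oV (f := fun x => invmx (P x) a b)); last exact: (sf_coord sf).
by apply: smooth_on_invmx => // [x /VU/uP //|i j]; exact: smooth_on_subset VU (sP i j).
Qed.

End SubframeChange.

(** * Local triviality from constant structure functions *)

Section ConstantSubframe.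
Variables (R : realType) (n : nat) (M : manifold R n) (A : lie_algebroid M).
Variables (k : forall x : M, {vspace A x}).
Hypothesis hk : bundle_of_ideals k.

Definition constant_subframe (U : set M) (r : nat) (f : 'I_r -> section A)
    (C : 'I_r -> 'I_r -> 'I_r -> R) : Prop :=
  subframe k U f /\
  forall x a b, U x -> fibre_bracket k (f a x) (f b x) = \sum_g C a b g *: f g x.

Definition fibre_iso (g : lie_algebra R) (x : M) (theta : 'Hom(g, A x)) : Prop :=
  [/\ lker theta = 0%VS, limg theta = k x &
      forall u v : g, theta (lg_bracket u v) = fibre_bracket k (theta u) (theta v)].

Section Trivialization.
Variables (U : set M) (r : nat) (f : 'I_r -> section A) (C : 'I_r -> 'I_r -> 'I_r -> R).
Hypothesis cf : constant_subframe U f C.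
Variables (g : lie_algebra R) (y : M) (theta : 'Hom(g, A y)).
Hypotheses (Uy : U y) (it : fibre_iso theta).

(** Matches vectors of [k y] and [k x] with equal coordinates; equal structure constants make this a
    morphism of Lie algebras. It is defined on the whole fibre [A y] to be a linear map of the
    ambient spaces, but is applied to [k y] only. *)
Definition frame_transport (x : M) (u : A y) : A x :=
  \sum_a coord [tuple f b y | b < r] a u *: f a x.

Lemma frame_transport_linear x : linear (frame_transport x).
Proof.
move=> a u v; rewrite /frame_transport scaler_sumr -big_split /=.
by apply: eq_bigr => b _; rewrite linearP scalerDl scalerA.
Qed.

HB.instance Definition _ x := GRing.isLinear.Build R (A y) (A x) _ (frame_transport x)
  (frame_transport_linear x).

Definition frame_trivialization (x : M) : 'Hom(g, A x) := (linfun (frame_transport x) \o theta)%VF.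

Lemma frame_trivializationE x u : frame_trivialization x u = frame_transport x (theta u).
Proof. by rewrite /frame_trivialization comp_lfunE lfunE. Qed.

Lemma theta_in u : theta u \in k y.
Proof. by case: it => _ <- _; exact: memv_img (memvf u). Qed.

(** In the frame [f] the trivialization has the constant matrix of [theta]. So smoothness of a
    section and of its image in [g] both mean smoothness of the coordinates in [f]. *)
Lemma frame_trivializationP :
  lie_trivialization k (@fibre_bracket R n M A k) U frame_trivialization.
Proof.
have [sf Cf] := cf; have [t0 tk tb] := it.
have fk x a : U x -> f a x \in k x by move=> Ux; apply: (subframe_in sf).
have thetaVK u : u \in k y -> theta (theta^-1%VF u) = u by move=> uk; rewrite limg_lfunVK ?tk.
have ker0 x : U x -> lker (frame_trivialization x) = 0%VS.
  move=> Ux; apply/eqP; rewrite -subv0; apply/subvP => u; rewrite memv_ker frame_trivializationE.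
  move=> /eqP fu0; have : theta u = 0.
    rewrite (subframe_expand sf Uy (theta_in u)); apply: big1 => a _.
    have := subframe_coord_sum sf (fun a => coord [tuple f b y | b < r] a (theta u)) a Ux.
    rewrite -/(frame_transport x (theta u)) fu0 linear0 => <-.
    by rewrite scale0r.
  by move=> /eqP; rewrite -memv_ker t0.
have inv x (v : A x) : U x -> v \in k x ->
    frame_trivialization x (\sum_a coord [tuple f b x | b < r] a v *: theta^-1%VF (f a y)) = v.
  move=> Ux vk; rewrite frame_trivializationE linear_sum /=.
  under eq_bigr do rewrite linearZ /= thetaVK ?fk //.
  rewrite [RHS](subframe_expand sf Ux vk); apply: eq_bigr => a _.
  by rewrite (subframe_coord_sum sf).
have VK x (v : A x) : U x -> v \in k x -> (frame_trivialization x)^-1%VF v =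
    \sum_a coord [tuple f b x | b < r] a v *: theta^-1%VF (f a y).
  move=> Ux vk; rewrite -{1}(inv x v Ux vk) lker0_lfunK //; exact/eqP/ker0.
split.
- move=> x Ux; split; first exact: ker0.
  apply/vspaceP => v; apply/idP/idP => [/memv_imgP[u _ ->]|vk].
    by rewrite frame_trivializationE; apply: memv_suml => a _; rewrite memvZ // fk.
  by rewrite -(inv x v Ux vk) memv_img ?memvf.
- move=> x Ux u v; rewrite !frame_trivializationE tb.
  have tu := theta_in u; have tv := theta_in v.
  rewrite {2 3}/frame_transport (fibre_bracket_suml hk); last 2 first.
  + by move=> a; exact: fk.
  + by apply: memv_suml => a _; rewrite memvZ // fk.
  rewrite {1}(subframe_expand sf Uy tu) {1}(subframe_expand sf Uy tv).
  rewrite (fibre_bracket_suml hk); last 2 first.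
  + by move=> a; exact: fk.
  + by apply: memv_suml => a _; rewrite memvZ // fk.
  rewrite linear_sum; apply: eq_bigr => a _; rewrite linearZ /=; congr (_ *: _).
  rewrite !(fibre_bracket_sumr hk) //; try by [move=> b; exact: fk|exact: fk].
  rewrite linear_sum; apply: eq_bigr => b _; rewrite linearZ /=; congr (_ *: _).
  rewrite !Cf // /frame_transport; apply: eq_bigr => d _.
  by rewrite (subframe_coord_sum sf).
- move=> s sk; split=> [ss i|sc].
    have sc a : smooth_on U (fun x => coord [tuple f b x | b < r] a (s x)).
      by apply: (sf_coord sf) => //; exact: sf_open sf.
    apply: (@smooth_on_ext _ _ _ U (fun x => \sum_a coord [tuple f b x | b < r] a (s x) *
        coord (vbasis {: g}) i (theta^-1%VF (f a y)))); first exact: sf_open sf.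
      move=> x Ux; rewrite VK //; last exact: sk.
      by rewrite linear_sum; apply: eq_bigr => a _; rewrite linearZ.
    apply: smooth_on_sum => [|a]; first exact: sf_open sf.
    by apply: (smooth_onM (sf_open sf) (sc a)); exact: smooth_on_cst.
  have oU := sf_open sf.
  apply: (@smooth_section_on_ext _ _ _ _ U (fun x => \sum_i
     coord (vbasis {: g}) i ((frame_trivialization x)^-1%VF (s x)) *:
     (\sum_a coord [tuple f b y | b < r] a (theta (vbasis {: g})`_i) *: f a x))) => //.
    move=> x Ux; rewrite -[RHS](inv x (s x) Ux (sk x Ux)) -VK //; last exact: sk.
    set w := (_^-1)%VF (s x).
    rewrite [in RHS](coord_vbasis (memvf w)) linear_sum.
    by apply: eq_bigr => i _; rewrite linearZ /= frame_trivializationE.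
  apply: smooth_section_on_sum => // i; apply: smooth_section_onZ => //.
  apply: smooth_section_on_sum => // a; apply: smooth_section_onZ => //; first exact: smooth_on_cst.
  exact: sf_smooth sf a.
Qed.

End Trivialization.

Section FibreAlgebra.
Variable x : M.
Local Notation g := (subvs_of (k x)).

Definition fibre_lie_bracket (u v : g) : g := vsproj (k x) (fibre_bracket k (vsval u) (vsval v)).

Lemma fibre_lie_bracketE u v : vsval (fibre_lie_bracket u v) = fibre_bracket k (vsval u) (vsval v).
Proof. by rewrite vsprojK // (fibre_bracket_in hk) // subvsP. Qed.

Lemma fibre_lie_linear (c : R) u u' v :
  fibre_lie_bracket (c *: u + u') v = c *: fibre_lie_bracket u v + fibre_lie_bracket u' v.
Proof.
apply: val_inj; rewrite /= fibre_lie_bracketE !linearP /= !fibre_lie_bracketE.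
by rewrite (fibre_bracket_linearl hk) ?subvsP.
Qed.

Lemma fibre_lie_antisym u v : fibre_lie_bracket u v = - fibre_lie_bracket v u.
Proof.
apply: val_inj; rewrite -[RHS]/(vsval (- fibre_lie_bracket v u)) linearN /= !fibre_lie_bracketE.
by rewrite (fibre_bracket_antisym hk) ?subvsP.
Qed.

Lemma fibre_lie_jacobi u v w : fibre_lie_bracket u (fibre_lie_bracket v w) =
  fibre_lie_bracket (fibre_lie_bracket u v) w + fibre_lie_bracket v (fibre_lie_bracket u w).
Proof.
apply: val_inj; rewrite -[RHS]/(vsval (_ + _)) linearD /= !fibre_lie_bracketE.
by rewrite (fibre_bracket_jacobi hk) ?subvsP.
Qed.

Definition fibre_lie : lie_algebra R :=
  LieAlgebra fibre_lie_linear fibre_lie_antisym fibre_lie_jacobi.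

Lemma fibre_lie_iso : @fibre_iso fibre_lie x (linfun (@vsval _ _ (k x))).
Proof.
split.
- apply/eqP; rewrite -subv0; apply/subvP => u; rewrite memv_ker lfunE /= => /eqP u0.
  by rewrite memv0; apply/eqP/val_inj; rewrite -[RHS]/(vsval 0) linear0.
- apply/vspaceP => v; apply/idP/idP => [/memv_imgP[u _ ->]|vk].
    by rewrite lfunE /= subvsP.
  by apply/memv_imgP; exists (vsproj (k x) v); rewrite ?memvf // lfunE /= vsprojK.
- by move=> u v; rewrite !lfunE /= fibre_lie_bracketE.
Qed.

End FibreAlgebra.

(* The points near which [k] is trivial with fibre the Lie algebra at [x0] form a clopen
   set. *)
Lemma constant_subframe_locally_trivial :
  (forall p : M, exists U r (f : 'I_r -> section A) C, constant_subframe U f C /\ U p) ->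
  locally_trivial k (@fibre_bracket R n M A k).
Proof.
move=> loc x0; exists (fibre_lie x0) => x [B [Bx0 _ cB] Bx].
pose S := [set z : M | exists (U : set M) (psi : forall y, 'Hom(fibre_lie x0, A y)),
  [/\ open U, U z & lie_trivialization k (@fibre_bracket R n M A k) U psi]].
(* One fibre over [U] isomorphic to the fibre at [x0] puts all of [U] in [S]; this gives both the
   closedness of [S] and the membership of [x0]. *)
have iso_spread z U r (f : 'I_r -> section A) C theta : constant_subframe U f C -> U z ->
    @fibre_iso (fibre_lie x0) z theta -> U `<=` S.
  move=> cf Uz it w Uw; exists U, (frame_trivialization f theta); split=> //.
    by case: cf => sf _; exact: sf_open sf.
  exact: (frame_trivializationP cf Uz it).
have oS : open S.
  rewrite openE => z [U [psi [oU Uz h]]].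
  by apply: (filterS _ (open_nbhs_nbhs (conj oU Uz))) => w Uw; exists U, psi.
have cS : closed S.
  move=> z Sz; have [U [r [f [C [cf Uz]]]]] := loc z.
  have oU : open U by case: cf => sf _; exact: sf_open sf.
  have [w [[V [psi [oV Vw [h1 h2 _]]]] Uw]] := Sz U (open_nbhs_nbhs (conj oU Uz)).
  apply: (iso_spread w U r f C (psi w) cf Uw _ z Uz); have [h3 h4] := h1 w Vw.
  by split=> //; exact: h2.
(* The start is the tautological isomorphism of the fibre Lie algebra at [x0] with [k x0]. *)
have Sx0 : S x0.
  have [U [r [f [C [cf Ux0]]]]] := loc x0.
  exact: (iso_spread x0 U r f C _ cf Ux0 (fibre_lie_iso x0)).
have BS : B `&` S = B.
  apply: cB; first by exists x0.
  - by exists S.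
  - by exists S.
by have [] : (B `&` S) x by rewrite BS.
Qed.

End ConstantSubframe.

(** * Parallel transport along rays *)

Lemma is_derive_sumf (R : realType) (V : normedModType R) (r : nat) (f : 'I_r -> V -> R)
    (x v : V) (df : 'I_r -> R) :
  (forall i, is_derive x v (f i) (df i)) ->
  is_derive x v (fun z => \sum_i f i z) (\sum_i df i).
Proof.
move=> h; have := is_derive_sum h.
by congr (is_derive x v _ _); apply/funext => z; rewrite fct_sumE.
Qed.

(** Supplies the a priori bound that [linear_ode_stability] needs to start. *)
Lemma bounded_on_segment (R : realType) (f df : R -> R) (T : R) :
  (forall t : R, `|t| <= T -> is_derive t 1 f (df t)) ->
  exists K : R, forall t, `|t| <= T -> `|f t| <= K.
Proof.
move=> fd; have cf : {within `[(- T), T], continuous f}.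
  apply: continuous_in_subspaceT => t; rewrite inE/= in_itv/= -ler_norml => /fd[dt _].
  exact/differentiable_continuous/derivable1_diffP.
have /compact_bounded[M [_ fM]] : compact (f @` `[(- T), T]).
  by apply: continuous_compact => //; exact: segment_compact.
exists (`|M| + 1) => t tT; apply: (fM (`|M| + 1)); first by rewrite ltr_pwDr // ler_norm.
by exists t => //; rewrite /= in_itv /= -ler_norml.
Qed.

(* The terms in which [N] acts on an argument of the bracket cancel. *)
Lemma gauge_cancellation (R : realType) (r : nat) (N C : 'I_r -> 'I_r -> R)
    (u v : 'I_r -> R) (D : 'I_r -> 'I_r -> R) :
  \sum_a \sum_b (- (\sum_h N a h * u h) * v b * C a b + u a * - (\sum_h N b h * v h) * C a b
    + u a * v b * (\sum_h N h a * C h b + \sum_h N h b * C a h - D a b)) =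
  - \sum_a \sum_b u a * v b * D a b.
Proof.
have e1 : \sum_a \sum_b (\sum_h N a h * u h) * v b * C a b =
    \sum_a \sum_b u a * v b * (\sum_h N h a * C h b).
  rewrite [LHS]exchange_big /= [RHS]exchange_big /=; apply: eq_bigr => b _.
  under [LHS]eq_bigr do rewrite -mulrA mulr_suml; rewrite [LHS]exchange_big /=.
  apply: eq_bigr => a _; rewrite mulr_sumr; apply: eq_bigr => h _; ring.
have e2 : \sum_a \sum_b u a * (\sum_h N b h * v h) * C a b =
    \sum_a \sum_b u a * v b * (\sum_h N h b * C a h).
  apply: eq_bigr => a _.
  under [LHS]eq_bigr do rewrite mulrAC mulr_sumr; rewrite [LHS]exchange_big /=.
  apply: eq_bigr => b _; rewrite mulr_sumr; apply: eq_bigr => h _; ring.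
transitivity (- (\sum_a \sum_b (\sum_h N a h * u h) * v b * C a b)
  - (\sum_a \sum_b u a * (\sum_h N b h * v h) * C a b)
  + (\sum_a \sum_b u a * v b * (\sum_h N h a * C h b)
  + \sum_a \sum_b u a * v b * (\sum_h N h b * C a h)
  - \sum_a \sum_b u a * v b * D a b)); last by rewrite e1 e2; ring.
rewrite -![in RHS]sumrN -![in RHS]big_split /=; apply: eq_bigr => a _.
rewrite -?[in RHS]sumrN -![in RHS]big_split /=; apply: eq_bigr => b _.
ring.
Qed.

Section RadialGauge.
Variables (R : realType) (n r : nat) (O : set 'rV[R]_n) (y0 : 'rV[R]_n).
Variables (G : 'I_n -> 'I_r -> 'I_r -> 'rV[R]_n -> R).
Variables (C : 'I_r -> 'I_r -> 'I_r -> 'rV[R]_n -> R).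
Hypotheses (oO : open O) (Oy0 : O y0).
Hypotheses (sG : forall i a b, Cinf O (G i a b)) (sC : forall a b g, Cinf O (C a b g)).
Hypothesis structure_eq : forall i a b g y, O y ->
  'D_(delta_mx 0 i) (C a b g) y + \sum_h C a b h y * G i h g y =
  \sum_h G i a h y * C h b g y + \sum_h G i b h y * C a h g y.

(* Points of ['rV_n.+1] are pairs [(t, z)]; the ray through [z] is
   [t |-> y0 + t * s * z]. *)
Definition ray_dir (w : 'rV[R]_n.+1) : 'rV[R]_n := \row_j w 0 (lift ord0 j).

Definition ray (s : R) (w : 'rV[R]_n.+1) : 'rV[R]_n := y0 + (s * w 0 ord0) *: ray_dir w.

Definition ray_pt (t : R) (z : 'rV[R]_n) : 'rV[R]_n.+1 :=
  \row_j (if unlift ord0 j is Some i then z 0 i else t).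

Lemma ray_pt0 t z : ray_pt t z 0 ord0 = t.
Proof. by rewrite mxE unlift_none. Qed.

Lemma ray_ptS t z i : ray_pt t z 0 (lift ord0 i) = z 0 i.
Proof. by rewrite mxE liftK. Qed.

Lemma ray_dir_pt t z : ray_dir (ray_pt t z) = z.
Proof. by apply/rowP => j; rewrite mxE ray_ptS. Qed.

Lemma ray_ptE s t z : ray s (ray_pt t z) = y0 + (s * t) *: z.
Proof. by rewrite /ray ray_pt0 ray_dir_pt. Qed.

Lemma ray_pt_line t z : ray_pt t z = t *: delta_mx 0 ord0 + ray_pt 0 z.
Proof.
apply/rowP => j; rewrite !mxE eqxx /=; case: unliftP => [i ->|->].
  by rewrite [_ == ord0]eq_sym (negbTE (neq_lift _ _)) mulr0 add0r.
by rewrite eqxx mulr1 addr0.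
Qed.

Lemma Ck_ray_coord k U s i : open U -> Ck k U (fun w => ray s w 0 i).
Proof.
move=> oU; rewrite (_ : (fun w => _) =
  cst (y0 0 i) + (cst s * (fun w : 'rV[R]_n.+1 => w 0 ord0)) *
    (fun w : 'rV[R]_n.+1 => w 0 (lift ord0 i))).
  apply: (CkD oU (@Ck_cst _ _ _ _ _)); apply: (CkM oU); last exact: Ck_coord.
  by apply: (CkM oU (@Ck_cst _ _ _ _ _)); exact: Ck_coord.
by apply/funext => w; rewrite !mxE.
Qed.

Lemma norm_ray_pt t z c : `|t| <= c -> `|z| <= c -> `|ray_pt t z| <= c.
Proof.
move=> tc zc; apply: norm_row_le => [|j]; first exact: le_trans tc.
rewrite mxE; case: unliftP => [i _|//]; exact: le_trans (abs_coord_le z i) zc.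
Qed.

(* [P y] is the parallel transport along the ray to [y]. The defect of [P y] from being a
   morphism solves the transport equation along the ray and vanishes at its origin. The
   rays are followed up to [t = 1 / 2], where the cutoff [bump_row] is still 1. *)
Lemma radial_gauge : exists (rho : R) (P : 'rV[R]_n -> 'M[R]_r),
  [/\ 0 < rho, ball y0 rho `<=` O,
      forall a b, Cinf (ball y0 rho) (fun y => P y a b),
      forall y, ball y0 rho y -> P y \in unitmx &
      forall y, ball y0 rho y -> forall a b d,
        \sum_a' \sum_b' P y a' a * P y b' b * C a' b' d y =
        \sum_g C a b g y0 * P y d g].
Proof.
pose K : R := 1 + \sum_i \sum_a \sum_b `|G i a b y0|.
have GK i a b : `|G i a b y0| <= K - 1.
  rewrite /K addrAC subrr add0r (bigD1 i) //= (bigD1 a) //= (bigD1 b) //= -!addrA lerDl.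
  by do !(apply: addr_ge0); do !(apply: sumr_ge0 => * //).
have K1 : 1 <= K by rewrite lerDl; do !(apply: sumr_ge0 => * //).
have [rho0 rho00 near0] : exists2 rho0 : R, 0 < rho0 & forall y, `|y - y0| < rho0 ->
    O y /\ forall i a b, `|G i a b y| <= K.
  have nG : \forall y \near y0, O y /\ forall i a b, `|G i a b y| <= K.
    have n1 : nbhs y0 O by exact: open_nbhs_nbhs.
    suff n2 : nbhs y0 [set y | forall p : 'I_n * 'I_r * 'I_r, `|G p.1.1 p.1.2 p.2 y| <= K].
      by apply: filterS2 n1 n2 => y Oy h; split=> // i a b; exact: h (i, a, b).
    apply: (@filter_forall _ _ _ (nbhs y0)) => -[[i a] b] /=.
    have cG : {for y0, continuous (G i a b)} by exact: Ck_continuous (sG i a b 0) _.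
    have h1 : nbhs y0 [set y | `|G i a b y0 - G i a b y| < 1].
      exact: ((cvgrPdist_lt _ _).1 cG 1 ltr01).
    apply: (filterS _ h1) => y /= h.
    have := GK i a b; have := ler_normB (G i a b y0) (G i a b y0 - G i a b y).
    by rewrite subKr; lra.
  have /nbhs_ballP[d d0 dn] := nG; exists d => // y yd; apply: dn.
  by rewrite -ball_normE /ball_/= distrC.
have r0 : 0 < (16 * r.+1%:R)^-1 :> R by rewrite invr_gt0.
have D0 : 0 < 3 * n.+1%:R * K by rewrite !mulr_gt0 // (lt_le_trans ltr01).
(* The first bound keeps the rays with [|w| < 3], which move by at most [9 * s], in the ball of
   radius [rho0]. The second makes the coefficients [A] as small as [parametric_linear_ode]
   demands. *)
pose s : R := Num.min (rho0 / 10) ((16 * r.+1%:R)^-1 / (3 * n.+1%:R * K)).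
have s0 : 0 < s by rewrite lt_min !divr_gt0.
have s1 : s <= rho0 / 10 by rewrite ge_min lexx.
have s2 : s * (3 * n.+1%:R * K) <= (16 * r.+1%:R)^-1.
  by rewrite -ler_pdivlMr // ge_min lexx orbT.
have rayO w : `|w| < 3 -> O (ray s w) /\ forall i a b, `|G i a b (ray s w)| <= K.
  move=> w3; apply: near0; rewrite /ray addrAC subrr add0r normrZ normrM (gtr0_norm s0).
  have h1 : `|w 0 ord0| <= 3 by rewrite (le_trans (abs_coord_le _ _)) // ltW.
  have h2 : `|ray_dir w| <= 3.
    apply: norm_row_le => // j; rewrite mxE.
    by rewrite (le_trans (abs_coord_le _ _)) // ltW.
  apply: (@le_lt_trans _ _ (s * 3 * 3)); last by lra.
  by apply: ler_pM => //; rewrite ?mulr_ge0 ?(ltW s0) // ler_pM2l.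
(* The connection matrix along the ray, whose velocity is [s] times its direction. The indices of
   [G] are exchanged because the equation is written for columns of coordinates. *)
pose N (a b : 'I_r) (w : 'rV[R]_n.+1) := \sum_i s * w 0 (lift ord0 i) * G i b a (ray s w).
pose A a b w := bump_row w * - N a b w.
have oB : open [set w : 'rV[R]_n.+1 | `|w| < 3].
  by apply: open_comp (@open_lt R 3) => x _; exact: norm_continuous.
have sN a b : Cinf [set w | `|w| < 3] (- N a b).
  move=> k; apply: (CkN oB); apply: (Ck_sum _ oB) => i.
  apply: (CkM oB (f := fun w => s * w 0 (lift ord0 i))).
    by apply: (CkM oB (@Ck_cst _ _ _ _ s)); exact: Ck_coord.
  apply: (Ck_comp oB oO _ (sG i b a k)); first by move=> w /rayO[].
  by move=> j; exact: Ck_ray_coord.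
have Ad a b w : `|A a b w| <= (16 * r.+1%:R)^-1.
  have [w3|w3] := ltP `|w| 3; last first.
    have [j wj] : exists j, 2 <= `|w 0 j|.
      apply: contrapT => /forallNP h; move: w3; apply/negP; rewrite -ltNge.
      apply: norm_row_lt => // j; rewrite ltNge; apply/negP => wj; apply: (h j).
      by rewrite (le_trans _ wj) // ler_nat.
    by rewrite /A (@bump_row_eq0 _ _ _ j) // mul0r normr0 ltW.
  rewrite /A normrM normrN (ger0_norm (bump_row_ge0 _)); apply: le_trans s2.
  apply: (@le_trans _ _ (1 * `|N a b w|)); first by rewrite ler_wpM2r // bump_row_le1.
  rewrite mul1r (le_trans (ler_norm_sum _ _ _)) //.
  apply: (@le_trans _ _ (\sum_(i < n) s * 3 * K)).
    apply: ler_sum => i _; rewrite normrM; apply: ler_pM => //; last by case: (rayO w w3).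
    by rewrite normrM (gtr0_norm s0) ler_pM2l // (le_trans (abs_coord_le _ _)) // ltW.
  rewrite sumr_const card_ord -[leLHS]mulr_natl.
  have -> : s * (3 * n.+1%:R * K) = n.+1%:R * (s * 3 * K) by ring.
  by rewrite ler_wpM2r ?ler_nat // !mulr_ge0 ?(ltW s0) // (le_trans ler01).
have sA a b : Cinf setT (A a b) by exact: Cinf_bump_mul (sN a b).
have A0 a b (w : 'rV[R]_n.+1) j : 3 < `|w 0 j| -> A a b w = 0.
  by move=> wj; rewrite /A (@bump_row_eq0 _ _ _ j) ?mul0r // (le_trans _ (ltW wj)) // ler_nat.
have [Phi [sPhi Phi0 dPhi uPhi]] := parametric_linear_ode ord0 sA A0 Ad.
(* The ray towards [z y] reaches [y] at time 1/2, and this radius gives [|z y| <= 1 / (n + 1)]. Up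
   to that time the squares of all coordinates add up to at most 1/4 + 3/4, hence the bump is 1. *)
pose rho : R := s / (2 * n.+1%:R).
have n0 : 0 < n.+1%:R :> R by [].
have rho_gt0 : 0 < rho by rewrite divr_gt0 // mulr_gt0.
pose z (y : 'rV[R]_n) : 'rV[R]_n := (2 / s) *: (y - y0).
have zle y : ball y0 rho y -> `|z y| <= n.+1%:R^-1.
  rewrite -ball_normE /ball_/= distrC => yr; rewrite normrZ gtr0_norm ?divr_gt0 //.
  have -> : n.+1%:R^-1 = 2 / s * rho :> R.
    by rewrite /rho; field; rewrite nat1r !gt_eqF.
  by rewrite ler_pM2l ?divr_gt0 // ltW.
have ray_z y : ray s (ray_pt (1 / 2) (z y)) = y.
  rewrite ray_ptE /z scalerA (_ : _ * _ = 1) ?scale1r; last by field; rewrite gt_eqF.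
  by rewrite addrC subrK.
have inv1 : n.+1%:R^-1 <= 1 :> R by rewrite invf_le1 // ler1n.
have pt3 t y : `|t| <= 1 / 2 -> ball y0 rho y -> `|ray_pt t (z y)| < 3.
  move=> t2 yr; apply: (@le_lt_trans _ _ 1); last by rewrite (ltr_nat R 1 3).
  apply: norm_ray_pt; last exact: le_trans (zle y yr) inv1.
  by apply: le_trans t2 _; lra.
have pt_bump t y : `|t| <= 1 / 2 -> ball y0 rho y -> bump_row (ray_pt t (z y)) = 1.
  move=> t2 yr; apply: bump_row_eq1; rewrite big_ord_recl ray_pt0.
  have h1 : t ^+ 2 <= 1 / 4.
    rewrite -real_normK ?num_real //.
    have -> : 1 / 4 = (1 / 2) ^+ 2 :> R by field.
    by rewrite ler_pXn2r // nnegrE.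
  suff h2 : \sum_(i < n) ray_pt t (z y) 0 (lift ord0 i) ^+ 2 <= 3 / 4 by lra.
  apply: (@le_trans _ _ (\sum_(i < n) (n.+1%:R^-1) ^+ 2)).
    apply: ler_sum => i _; rewrite ray_ptS -real_normK ?num_real //.
    rewrite ler_pXn2r // ?nnegrE ?invr_ge0 //.
    exact: le_trans (abs_coord_le _ _) (zle y yr).
  rewrite sumr_const card_ord -[leLHS]mulr_natl exprVn ler_pdivrMr ?exprn_gt0 //.
  have : n.+1%:R = n%:R + 1 :> R by rewrite -natr1.
  move=> ->; have : 0 <= n%:R :> R by [].
  by nra.
have oball : open (ball y0 rho) by exact: ball_open.
exists rho, (fun y => \matrix_(a, b) Phi a b (ray_pt (1 / 2) (z y))); split=> //.
- move=> y yr; rewrite -(ray_z y); apply: (rayO _ _).1.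
  by apply: pt3 => //; rewrite ger0_norm.
- move=> a b k; under eq_fun do rewrite mxE.
  refine (@Ck_comp R n n.+1 k _ setT (Phi a b) (fun y => ray_pt (1 / 2) (z y))
    oball openT _ (sPhi a b k) _) => // j.
  have [i ->|->] := unliftP ord0 j.
    under eq_fun do rewrite ray_ptS.
    rewrite (_ : (fun y => _) = cst (2 / s) * ((fun y : 'rV[R]_n => y 0 i) - cst (y0 0 i))).
      apply: (CkM oball (@Ck_cst _ _ _ _ _)).
      by apply: (CkB oball); [exact: Ck_coord|exact: Ck_cst].
    by apply/funext => y; rewrite !mxE.
  under eq_fun do rewrite ray_pt0; exact: Ck_cst.
move=> y yr a b d; under eq_bigr do under eq_bigr do rewrite !mxE.
under [RHS]eq_bigr do rewrite !mxE.
pose F a b (t : R) := Phi a b (ray_pt t (z y)).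
have dF a' b' (t : R) : `|t| <= 1 / 2 ->
    is_derive t 1 (F a' b') (- \sum_h N a' h (ray_pt t (z y)) * F h b' t).
  move=> t2; have := dPhi a' b' (ray_pt t (z y)).
  rewrite [in X in X -> _]ray_pt_line => /is_derive_line.
  rewrite -ray_pt_line (_ : (fun t => Phi a' b' _) = F a' b'); last first.
    by apply/funext => u; rewrite /F -ray_pt_line.
  move=> hd; apply: (is_derive_eq hd); rewrite -sumrN; apply: eq_bigr => h _.
  by rewrite /A pt_bump // mul1r mulNr.
pose Ct a b d (t : R) := C a b d (ray s (ray_pt t (z y))).
pose Dt a' b' d' t := \sum_h Ct a' b' h t * N d' h (ray_pt t (z y)).
have dC a' b' d' (t : R) : `|t| <= 1 / 2 -> is_derive t 1 (Ct a' b' d')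
    (\sum_h N h a' (ray_pt t (z y)) * Ct h b' d' t + \sum_h N h b' (ray_pt t (z y)) * Ct a' h d' t
     - Dt a' b' d' t).
  move=> t2; have [Ot _] := rayO _ (pt3 t y t2 yr).
  have dray i : is_derive t 1 (fun u => ray s (ray_pt u (z y)) 0 i) (s * z y 0 i).
    rewrite (_ : (fun u => _) = cst (y0 0 i) + (s * z y 0 i) *: id).
      have := is_deriveD (is_derive_cst (y0 0 i) t 1)
        (is_deriveZ (s * z y 0 i) (is_derive_id t (1 : R))).
      by rewrite add0r [_ *: 1]mulr1.
    by apply/funext => u; rewrite ray_ptE !mxE !fctE /GRing.scale /=; ring.
  have := @is_derive_comp_C1 R n _ O (C a' b' d') (fun u : R => ray s (ray_pt u (z y))) t 1 _
    oO (sC a' b' d' 1) Ot dray.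
  move=> hd; apply: (is_derive_eq hd); rewrite /Dt /Ct /N.
  set q := ray s _ in Ot *.
  (* The structure equation replaces each partial derivative of [C]; summed with the velocity as
     weights, [G] becomes [N]. *)
  transitivity (\sum_(i < n) s * z y 0 i *
      (\sum_h G i a' h q * C h b' d' q + \sum_h G i b' h q * C a' h d' q
       - \sum_h C a' b' h q * G i h d' q)).
    apply: eq_bigr => i _; rewrite -(structure_eq i a' b' d' Ot) addrK; ring.
  under eq_bigr do rewrite mulrBr mulrDr !mulr_sumr.
  rewrite sumrB big_split /=; congr (_ + _ - _); rewrite exchange_big /=;
    apply: eq_bigr => h _; rewrite ?mulr_suml ?mulr_sumr; apply: eq_bigr => i _;
    rewrite ray_ptS; ring.
pose E d (t : R) := \sum_a' \sum_b' F a' a t * F b' b t * Ct a' b' d t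
  - \sum_g C a b g y0 * F d g t.
(* After [gauge_cancellation] only the action of [N] on the value of the bracket remains, so the
   defect [E] solves the homogeneous transport equation. *)
have dE d' (t : R) : `|t| <= 1 / 2 -> is_derive t 1 (E d')
    (\sum_h - N d' h (ray_pt t (z y)) * E h t + 0).
  move=> t2.
  have := is_deriveB (is_derive_sumf (fun a' => is_derive_sumf (fun b' =>
      is_deriveM (is_deriveM (dF a' a t t2) (dF b' b t t2)) (dC a' b' d' t t2))))
    (is_derive_sumf (fun g => is_deriveZ (C a b g y0) (dF d' g t t2))).
  move=> hd; apply: (is_derive_eq hd); rewrite /GRing.scale /= addr0.
  set w := ray_pt t (z y).
  rewrite [X in X - _](_ : _ = - \sum_a' \sum_b' F a' a t * F b' b t * Dt a' b' d' t); last first.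
    rewrite -(gauge_cancellation (fun a b => N a b w) (fun a' b' => Ct a' b' d' t)
      (fun a' => F a' a t) (fun b' => F b' b t)).
    apply: eq_bigr => a' _; apply: eq_bigr => b' _; rewrite !fctE /GRing.scale /= -/w; ring.
  under [RHS]eq_bigr do rewrite mulNr mulrBr.
  rewrite sumrN sumrB opprB addrC; congr (_ - _).
    under [RHS]eq_bigr do rewrite mulr_sumr; rewrite [RHS]exchange_big /= -sumrN.
    apply: eq_bigr => g _; rewrite mulrN opprK mulr_sumr; apply: eq_bigr => h _; ring.
  under [RHS]eq_bigr do rewrite mulr_sumr; rewrite [RHS]exchange_big /=.
  apply: eq_bigr => a' _; under [RHS]eq_bigr do rewrite mulr_sumr; rewrite [RHS]exchange_big /=.
  apply: eq_bigr => b' _; rewrite mulr_sumr; apply: eq_bigr => h _; ring.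
have Ebd d' : exists Kd : R, forall t, `|t| <= 1 / 2 -> `|E d' t| <= Kd.
  exact: bounded_on_segment (dE d').
have /choice[Kd KdP] := Ebd.
have F0 a' b' : F a' b' 0 = (a' == b')%:R by apply: Phi0; rewrite ray_pt0.
have E0 d' : E d' 0 = 0.
  have C0 a' b' : Ct a' b' d' 0 = C a' b' d' y0 by rewrite /Ct ray_ptE mulr0 scale0r addr0.
  apply/eqP; rewrite /E subr_eq0; apply/eqP.
  rewrite (bigD1 a) //= [X in _ + X]big1 => [|a' /negbTE aa]; last first.
    by apply: big1 => b' _; rewrite F0 aa !mul0r.
  rewrite (bigD1 b) //= [X in _ + X + _]big1 => [|b' /negbTE bb]; last first.
    by rewrite (F0 b') bb mulr0 mul0r.
  rewrite !F0 !eqxx !mul1r !addr0 C0 (bigD1 d') //= big1 => [|g /negbTE dg]; last first.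
    by rewrite F0 eq_sym dg mulr0.
  by rewrite F0 eqxx mulr1 addr0.
have rd : 16 * (r%:R * (16 * r.+1%:R)^-1) <= 1 :> R.
  rewrite invfM mulrCA (mulrA 16) divff // mul1r ler_pdivrMr // mul1r.
  by rewrite ler_nat.
have half4 : 0 <= (1 / 2 : R) <= 4 by rewrite divr_ge0 //= ler_pdivrMr // -natrM ler1n.
(* Uniqueness: zero initial value and zero source force [E = 0] up to the end point [y]. *)
have : `|E d (1 / 2)| <= 8 * 0.
  apply: (@linear_ode_stability R r (1 / 2) _ half4 rd (fun a b t => A a b (ray_pt t (z y)))
    E (fun _ _ => 0) (\sum_d `|Kd d|)) => //.
  - move=> a' t t2; apply: (is_derive_eq (dE a' t t2)); congr (_ + _).
    by apply: eq_bigr => h _; rewrite /A pt_bump // mul1r.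
  - by move=> ? ? ?; rewrite normr0.
  - move=> d' t t2; rewrite (le_trans (KdP d' t t2)) // (le_trans (ler_norm _)) //.
    by rewrite (bigD1 d') //= lerDl sumr_ge0.
  - by rewrite ger0_norm.
by rewrite mulr0 normr_le0 /E /Ct ray_z subr_eq0 => /eqP.
Qed.

End RadialGauge.

(** The radial gauge is applied to the Christoffel symbols and structure functions read in a chart
    about [p]. The new frame is [e] changed by the transport matrix, and its structure constants are
    the values of the structure functions at [p]. *)
Lemma im_constant_subframe (R : realType) (n : nat) (M : manifold R n) (A : lie_algebroid M)
    (k : forall x : M, {vspace A x}) (L : section A -> oneform A)
    (l : forall x : M, {linear A x -> A x}) (p : M) :
  bundle_of_ideals k -> im_connection k L l ->
  exists U r (f : 'I_r -> section A) C, constant_subframe k U f C /\ U p.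
Proof.
move=> hk hL.
have [W [r [e [sf Wp]]]] := subframe_exists p (bi_subbundle hk).
have [c ac cp] := mf_cover p; have [oc _ cK _ _] := mf_chart ac.
have oX : open (chart_dom c `&` W) by apply: openI => //; exact: sf_open sf.
have [chi [V [hchi Vp]]] := cutoff_exists oX (conj cp Wp).
have VX := cutoff_sub hchi; have [_ oV _ _] := hchi.
pose G i a b := christoffel L c e chi i a b \o chart_inv c.
pose C a b g := structure_fun e chi a b g \o chart_inv c.
pose O := chart_map c @` (chart_dom c `&` V).
have OX : O `<=` chart_map c @` (chart_dom c `&` (chart_dom c `&` W)).
  by move=> _ [x [cx Vx] <-]; exists x => //; split=> //; exact: VX.
have sG i a b : Cinf O (G i a b).
  by move=> q; apply: Ck_subset OX _; exact: (smooth_christoffel hL ac sf hchi i a b ac q).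
have sC a b g : Cinf O (C a b g).
  by move=> q; apply: Ck_subset OX _; exact: (smooth_structure_fun hk ac sf hchi a b g ac q).
have structure_eq i a b g y : O y ->
    'D_(delta_mx 0 i) (C a b g) y + \sum_h C a b h y * G i h g y =
    \sum_h G i a h y * C h b g y + \sum_h G i b h y * C a h g y.
  move=> /(chart_image_inv ac)[_ Vy cy].
  by have := structure_equation hk hL ac sf hchi i a b g Vy; rewrite cy.
have [rho [P [rho0 bO sP uP PC]]] :=
  radial_gauge (chart_image_open ac oV) (ex_intro2 _ _ p (conj cp Vp) erefl) sG sC structure_eq.
pose U := chart_dom c `&` chart_map c @^-1` ball (chart_map c p) rho.
have oU : open U by apply: chart_preimage_open => //; exact: ball_open.
have UV : U `<=` V.
  by move=> x [cx /bO[x' [cx' Vx'] xx']]; rewrite -(cK x cx) -xx' cK.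
have UW : U `<=` W by move=> x /UV/VX[].
exists U, r, (fun a x => \sum_b P (chart_map c x) b a *: e b x),
  (fun a b g => C a b g (chart_map c p)).
split; last by split=> //; exact: ballxx.
split.
  apply: (subframe_change sf oU UW (P := P \o chart_map c)) => [a b|x [_ /uP//]].
  apply: (smooth_on_chart ac oU) => [x []//|q].
  apply: (@Ck_ext _ _ _ _ (fun y => P y a b)).
  - by rewrite -(setIidr (_ : U `<=` chart_dom c)) => [|x []//]; exact: chart_image_open.
  - by move=> _ [x [cx _] <-] /=; rewrite cK.
  - by apply: Ck_subset (sP a b q) => _ [x [_ xr] <-].
move=> x a b Ux; have Vx := UV x Ux; have [cx xr] := Ux.
have ek h : e h x \in k x by apply: (subframe_in sf); exact: UW.
rewrite (fibre_bracket_suml hk) //; last by apply: memv_suml => h _; rewrite memvZ.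
under eq_bigr do rewrite (fibre_bracket_sumr hk) // scaler_sumr.
transitivity (\sum_d (\sum_a' \sum_b' P (chart_map c x) a' a * P (chart_map c x) b' b *
    C a' b' d (chart_map c x)) *: e d x).
  under [RHS]eq_bigr do rewrite scaler_suml; rewrite [RHS]exchange_big /=.
  apply: eq_bigr => a' _.
  under [RHS]eq_bigr do rewrite scaler_suml; rewrite [RHS]exchange_big /=.
  apply: eq_bigr => b' _.
  rewrite (structure_funE hk sf hchi) // !scaler_sumr; apply: eq_bigr => d _.
  by rewrite !scalerA /C /= cK.
under eq_bigr do rewrite PC // scaler_suml; rewrite exchange_big /=.
apply: eq_bigr => g _; rewrite scaler_sumr; apply: eq_bigr => d _.
by rewrite scalerA.
Qed.

Theorem corollary5p7 (R : realType) (n : nat) (M : manifold R n)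
    (A : lie_algebroid M) (k : forall x : M, {vspace A x})
    (L : section A -> oneform A) (l : forall x : M, {linear A x -> A x})
    (hk : bundle_of_ideals k) (hL : im_connection k L l) :
  [/\ linear_connection k (induced_connection L),
      forall (X : vfield M) (xi eta : section A),
        smooth_vf X -> section_of k xi -> section_of k eta ->
        forall x : M,
          induced_connection L X (section_bracket k xi eta) x =
          section_bracket k (induced_connection L X xi) eta x +
          section_bracket k xi (induced_connection L X eta) x &
      locally_trivial k (@fibre_bracket R n M A k)].
Proof.
split.
- exact: induced_linear_connection hL.
- by move=> X xi eta sX xik etak x; exact: (induced_connection_bracket hk hL).
- apply: (constant_subframe_locally_trivial hk) => p.
  exact: im_constant_subframe hk hL.
Qed.
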